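(* Given a Fixed Charge Transportation instance $S,T,(a_i)_{i\in S},(b_j)_{j\in T},(f_{ij}),(c_{ij})$ and a constant $\epsilon>0$, one can compute in polynomial time a vector $x\in\mathbb{R}_{\ge0}^{S\times T}$ such that $\sum_{j\in T}x_{ij}=a_i$ for every $i\in S$, $(1-\epsilon)b_j\le\sum_{i\in S}x_{ij}\le(1+\epsilon)b_j$ for every $j\in T$, and $\sum_{i\in S,j\in T}(\mathbf{1}_{x_{ij}>0}f_{ij}+c_{ij}x_{ij})$ is at most $O(1/\epsilon)$ times the optimum cost of the instance.
   Context: FCT: we are given a set $S$ of $n$ sources and a set $T$ of $m$ sinks; each source $i$ has supply $a_i\in\mathbb{Z}_{>0}$, each sink $j$ has demand $b_j\in\mathbb{Z}_{>0}$, with $\sum_{i\in S}a_i=\sum_{j\in T}b_j$; every pair $(i,j)$ has a fixed cost $f_{ij}\ge0$ and a linear cost ratio $c_{ij}\ge0$. Feasible solutions are $x\in\mathcal{X}=\{x\in\mathbb{R}_{\ge0}^{S\times T}:\sum_{j}x_{ij}=a_i\ \forall i,\ \sum_i x_{ij}=b_j\ \forall j\}$ and the cost of $x$ is $\sum_{i,j}(\mathbf{1}_{x_{ij}>0}f_{ij}+c_{ij}x_{ij})$; the optimum cost is the minimum over $\mathcal{X}$. *)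

(* Defs.v *)
From HB Require Import structures.
From mathcomp Require Import all_boot all_order all_algebra.
From mathcomp Require Import boolp classical_sets reals.

Set Implicit Arguments.
Unset Strict Implicit.
Unset Printing Implicit Defensive.

Import Order.TTheory GRing.Theory Num.Theory.
Local Open Scope ring_scope.

(** Model of computation: the random access machine with logarithmic cost
    (Aho, Hopcroft, Ullman, "The Design and Analysis of Computer Algorithms"),
    with structured control flow in place of jumps.  Registers hold
    arbitrary integers, and every operation costs the binary length of the
    integers and addresses it handles, so this model and Turing machines
    simulate each other with polynomial overhead. *)

Definition memory := nat -> int.

Definition bitlen (z : int) : nat := (trunc_log 2 `|z|%N).+1.

Definition bitsize (s : seq int) : nat := (\sum_(z <- s) bitlen z)%N.

Inductive ram_op := OpAdd | OpSub | OpMul | OpDiv.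

Definition ram_op_eval (o : ram_op) (u v : int) : int :=
  match o with
  | OpAdd => u + v
  | OpSub => u - v
  | OpMul => u * v
  | OpDiv => (u %/ v)%Z
  end.

Inductive expr :=
  | Const of int
  | Cell of expr
  | Binop of ram_op & expr & expr.

(** The sign of an address is ignored. *)
Fixpoint eval (mu : memory) (e : expr) : int :=
  match e with
  | Const z => z
  | Cell e1 => mu `|eval mu e1|%N
  | Binop o e1 e2 => ram_op_eval o (eval mu e1) (eval mu e2)
  end.

Fixpoint eval_cost (mu : memory) (e : expr) : nat :=
  match e with
  | Const z => bitlen z
  | Cell e1 =>
      (eval_cost mu e1 + bitlen (eval mu e1) + bitlen (eval mu (Cell e1)))%N
  | Binop _ e1 e2 =>
      (eval_cost mu e1 + eval_cost mu e2
       + bitlen (eval mu e1) + bitlen (eval mu e2))%N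
  end.

Inductive cmd :=
  | Skip
  | Store of expr & expr
  | Seq of cmd & cmd
  | IfPos of expr & cmd & cmd
  | WhilePos of expr & cmd.

Definition update (mu : memory) (k : nat) (v : int) : memory :=
  fun l => if l == k then v else mu l.

Definition test_cost (mu : memory) (e : expr) : nat :=
  (eval_cost mu e + bitlen (eval mu e))%N.

(** [exec p mu t mu']: started in [mu], [p] halts in [mu'] after time [t]. *)
Inductive exec : cmd -> memory -> nat -> memory -> Prop :=
  | exec_skip mu : exec Skip mu 1 mu
  | exec_store e1 e2 mu :
      exec (Store e1 e2) mu (test_cost mu e1 + test_cost mu e2)%N
           (update mu `|eval mu e1|%N (eval mu e2))
  | exec_seq p q mu mu1 mu2 t1 t2 :
      exec p mu t1 mu1 -> exec q mu1 t2 mu2 ->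
      exec (Seq p q) mu (t1 + t2)%N mu2
  | exec_if_pos e p q mu mu1 t :
      0 < eval mu e -> exec p mu t mu1 ->
      exec (IfPos e p q) mu (test_cost mu e + t)%N mu1
  | exec_if_npos e p q mu mu1 t :
      eval mu e <= 0 -> exec q mu t mu1 ->
      exec (IfPos e p q) mu (test_cost mu e + t)%N mu1
  | exec_while_pos e p mu mu1 mu2 t1 t2 :
      0 < eval mu e -> exec p mu t1 mu1 -> exec (WhilePos e p) mu1 t2 mu2 ->
      exec (WhilePos e p) mu (test_cost mu e + t1 + t2)%N mu2
  | exec_while_npos e p mu :
      eval mu e <= 0 -> exec (WhilePos e p) mu (test_cost mu e) mu.

(** Inputs and outputs are words of integers: the length is in register 0, the
    word itself in the registers that follow. *)
Definition input_memory (s : seq int) : memory := nth 0 ((size s)%:Z :: s).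

Definition output_word (mu : memory) : seq int :=
  mkseq (fun k => mu k.+1) `|mu 0%N|%N.

(** One program solves the search problem [sol] on all inputs [a : A], in time
    polynomial in the binary length of [enc a].  The length of the output is
    charged too, as declaring a long word of untouched registers is cheap. *)
Definition polytime_solvable (A : Type) (enc : A -> seq int)
    (sol : A -> seq int -> Prop) : Prop :=
  exists (p : cmd) (c d : nat), forall a : A, exists (t : nat) (mu : memory),
    [/\ exec p (input_memory (enc a)) t mu,
        (t + bitsize (output_word mu) <= c * bitsize (enc a) ^ d + c)%N
      & sol a (output_word mu)].

(** Costs are rational, so that an instance is a finite object. *)
Record fct := Fct {
  nsrc : nat;
  nsnk : nat;
  supply : 'I_nsrc -> nat;
  demand : 'I_nsnk -> nat;
  fixed_cost : 'M[rat]_(nsrc, nsnk);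
  linear_cost : 'M[rat]_(nsrc, nsnk);
  supply_gt0 : forall i, (0 < supply i)%N;
  demand_gt0 : forall j, (0 < demand j)%N;
  balanced : (\sum_i supply i = \sum_j demand j)%N;
  fixed_cost_ge0 : forall i j, 0 <= fixed_cost i j;
  linear_cost_ge0 : forall i j, 0 <= linear_cost i j
}.

Definition enc_mx n m (A : 'M[rat]_(n, m)) : seq int :=
  flatten [seq [:: numq (A i j); denq (A i j)] | i <- enum 'I_n, j <- enum 'I_m].

Definition enc_fct (I : fct) : seq int :=
  [:: (nsrc I)%:Z; (nsnk I)%:Z]
    ++ [seq (supply i)%:Z | i <- enum 'I_(nsrc I)]
    ++ [seq (demand j)%:Z | j <- enum 'I_(nsnk I)]
    ++ enc_mx (fixed_cost I) ++ enc_mx (linear_cost I).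

(** Same layout as [enc_mx], but fractions need not be in lowest terms. *)
Definition represents n m (s : seq int) (A : 'M[rat]_(n, m)) : Prop :=
  size s = (n * m).*2 /\
  forall (i : 'I_n) (j : 'I_m), let k := (i * m + j).*2 in
    0 < s`_k.+1 /\ A i j = (s`_k)%:~R / (s`_k.+1)%:~R.

Section Transportation.
Variables (R : realType) (I : fct).
Implicit Type x : 'M[R]_(nsrc I, nsnk I).

Definition feasible x : Prop :=
  [/\ forall i j, 0 <= x i j,
      forall i, \sum_j x i j = (supply i)%:R
    & forall j, \sum_i x i j = (demand j)%:R].

Definition cost x : R :=
  \sum_i \sum_j ((if 0 < x i j then ratr (fixed_cost I i j) else 0)
                 + ratr (linear_cost I i j) * x i j).

(** The infimum is a minimum: there are finitely many supports, and for each
    one paying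
    all its fixed costs gives an affine objective on a compact polytope. *)
Definition opt : R := inf [set cost x | x in feasible]%classic.

Definition approx_feasible (eps : R) x : Prop :=
  [/\ forall i j, 0 <= x i j,
      forall i, \sum_j x i j = (supply i)%:R
    & forall j, (1 - eps) * (demand j)%:R <= \sum_i x i j
                  <= (1 + eps) * (demand j)%:R].

End Transportation.

(* Main.v *)
(** Replacing the fixed cost [f i j] by the linear price [f i j / min (a i) (b j)]
    gives prices [w] with [w x] at most the cost of [x] for all feasible [x].
    These are scaled to integers, and the [k]-th positive one is increased by
    [2 ^ k], which at most doubles it.  The Hungarian method with capacity
    scaling yields an optimal flow [x] for them with integer potentials.

    For a constant [K = O(1 / eps)], an edge is small if its price is positive
    and [0 < K x < min (a i) (b j)].  Such edges are tight for the potentials,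
    and because of the distinct powers of 2 they form a forest; pruning it leaf
    by leaf, every node is given a star of child edges and at most one edge
    that belongs to the star of its neighbour.  Inside a star the flow [K x] is
    shifted to cheaper edges until all but one of them carry 0 or
    [min (a i) (b j)], and the last one is dropped.  This changes [K] times the
    supply [a i] by at most [2 (a i)], likewise for demands, and does not
    increase the linear cost.  Rescaling the rows to the exact supplies
    perturbs the demands by a factor within [1 - eps] and [1 + eps].  The edges
    still in use have price 0 or carried at least [min (a i) (b j)], hence
    their fixed costs are paid for by the linear prices, and the cost is at most
    [2 K] times the optimum.

    The algorithm is written in a language with integer arrays, which is
    compiled to the random access machine with polynomial overhead provided
    that word lengths and iteration numbers stay polynomial. *)

Require Import Defs.
From HB Require Import structures.
From mathcomp Require Import all_boot all_order all_algebra.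
From mathcomp Require Import boolp classical_sets reals.
From mathcomp Require Import zify ring lra.

Set Implicit Arguments.
Unset Strict Implicit.
Unset Printing Implicit Defensive.

Import Order.TTheory GRing.Theory Num.Theory.
Local Open Scope ring_scope.

(** * Bit lengths and structural cost bounds *)

(** The threshold [min (a i) (b j)] fits both ends of an edge: no feasible flow exceeds it, which
    makes [w] a lower bound, and emptying or filling one small edge changes the sum at either end by
    less than the supply or demand there. Transfers inside a star cancel at its centre, so each node
    suffers at most two changes, its own dropped edge and the edge to its parent: an error of 2 in
    [K]. After rescaling, the demands are met up to the factor [(K + 2) / (K - 2)], whence
    [K = O(1 / eps)].

    The optimal flow need not be a vertex of the polytope. Instead of cancelling cycles, the
    perturbation makes any set of tight edges of positive price a forest, by arithmetic on integer
    potentials; edges of price 0 may form cycles, but they are left alone.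

    What shapes the Hungarian part is the size of the numbers. The only bound proved for the
    potentials is that they grow by a factor 4 per sink reached. This is harmless as long as the
    number of searches is polynomial in the bit length, and capacity scaling ensures at most [n + m]
    searches per scale. *)

Lemma bitlen_leP (z : int) (b : nat) :
  (0 < b)%N -> (bitlen z <= b)%N = (`|z| < 2 ^ b)%N.
Proof.
move=> b0; rewrite /bitlen; have [->|z0] := posnP `|z|%N.
  by rewrite trunc_log0 b0 expn_gt0.
rewrite ltnNge [RHS]ltnNge; congr (~~ _); apply/idP/idP.
  move=> /(leq_pexp2l (isT : 0 < 2)%N) /leq_trans; apply.
  exact: trunc_logP.
by move=> /(trunc_log_max (isT : 1 < 2)%N).
Qed.

Lemma abs_lt_pow2 (z : int) (b : nat) : (`|z| < 2 ^+ b) = (`|z| < 2 ^ b)%N.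
Proof. by rewrite -ltz_nat abszE -[X in _ = (_ < X)]natz natrX. Qed.

Lemma bitlen_gt0 z : (0 < bitlen z)%N. Proof. by []. Qed.

Lemma bitlen_bound z : (`|z| < 2 ^ bitlen z)%N.
Proof. by rewrite -bitlen_leP. Qed.

(** Products are the extreme case. Sums fit as well because [bitlen] is never 0: for positive [p]
    and [q], [2 ^ p + 2 ^ q <= 2 ^ (p + q)]. *)
Lemma bitlen_op o u v : (bitlen (ram_op_eval o u v) <= bitlen u + bitlen v)%N.
Proof.
have bu := bitlen_bound u; have bv := bitlen_bound v.
rewrite bitlen_leP ?addn_gt0 ?bitlen_gt0 //.
have lt_add : (`|u| + `|v| < 2 ^ (bitlen u + bitlen v))%N.
  have pu := ltn_expl (bitlen u) (isT : 1 < 2)%N.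
  have pv := ltn_expl (bitlen v) (isT : 1 < 2)%N.
  have u1 : (1 < 2 ^ bitlen u)%N by apply: leq_trans pu.
  have v1 : (1 < 2 ^ bitlen v)%N by apply: leq_trans pv.
  rewrite expnD; nia.
case: o => /=.
- by apply: leq_ltn_trans lt_add; lia.
- by apply: leq_ltn_trans lt_add; lia.
- by rewrite abszM expnD; apply: ltn_mul.
apply: leq_ltn_trans (_ : `|u|%N < _)%N; first exact: lez_div.
by apply: leq_ltn_trans lt_add; apply: leq_addr.
Qed.

(** When every cell has length at most [b], a value of [e] has length at most [val_weight e * b]. A
    [Cell] has weight 1 whatever its address, since only the memory bounds what is read. *)
Fixpoint val_weight (e : expr) : nat :=
  match e with
  | Const z => bitlen z
  | Cell _ => 1
  | Binop _ e1 e2 => val_weight e1 + val_weight e2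
  end.

Fixpoint cost_weight (e : expr) : nat :=
  match e with
  | Const z => bitlen z
  | Cell e1 => cost_weight e1 + val_weight e1 + 1
  | Binop _ e1 e2 =>
      cost_weight e1 + cost_weight e2 + val_weight e1 + val_weight e2
  end.

(** The single parameter [x] bounds both the word length and the number of rounds of each loop. The
    successor in the loop case pays for the last, failing test. *)
Fixpoint time_bound (p : cmd) (x : nat) : nat :=
  match p with
  | Skip => 1
  | Store e1 e2 =>
      (cost_weight e1 + val_weight e1 + (cost_weight e2 + val_weight e2)) * x
  | Seq p q => time_bound p x + time_bound q x
  | IfPos e p q =>
      (cost_weight e + val_weight e) * x + (time_bound p x + time_bound q x)
  | WhilePos e p =>
      x.+1 * ((cost_weight e + val_weight e) * x + time_bound p x)
  end.

Definition bounded_mem (b : nat) (mu : memory) := forall k, (bitlen (mu k) <= b)%N.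

Lemma eval_weight b mu e : (0 < b)%N -> bounded_mem b mu ->
  (bitlen (eval mu e) <= val_weight e * b)%N.
Proof.
move=> b0 hb; elim: e => [z|e _|o e1 IH1 e2 IH2] /=.
- by rewrite leq_pmulr.
- by rewrite mul1n.
- by rewrite mulnDl; apply: leq_trans (bitlen_op _ _ _) (leq_add IH1 IH2).
Qed.

Lemma cost_eval_weight b mu e : (0 < b)%N -> bounded_mem b mu ->
  (eval_cost mu e <= cost_weight e * b)%N.
Proof.
move=> b0 hb; elim: e => [z|e IH|o e1 IH1 e2 IH2] /=.
- by rewrite leq_pmulr.
- by rewrite !mulnDl mul1n !leq_add // eval_weight.
- by rewrite !mulnDl !leq_add // eval_weight.
Qed.

Lemma test_cost_weight b x mu e : (0 < b)%N -> (b <= x)%N -> bounded_mem b mu ->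
  (test_cost mu e <= (cost_weight e + val_weight e) * x)%N.
Proof.
move=> b0 bx hb; rewrite /test_cost; apply: leq_trans (leq_mul (leqnn _) bx).
by rewrite mulnDl leq_add ?cost_eval_weight ?eval_weight.
Qed.

Lemma time_bound_poly p :
  exists c d, forall x, (0 < x)%N -> (time_bound p x <= c * x ^ d)%N.
Proof.
elim: p => [|e1 e2|p [c1 [d1 H1]] q [c2 [d2 H2]]|e p [c1 [d1 H1]] q [c2 [d2 H2]]
           |e p [c1 [d1 H1]]] /=.
- by exists 1%N, 0%N.
- by eexists _, 1%N => x _; rewrite expn1.
- exists (c1 + c2)%N, (d1 + d2)%N => x x0; rewrite mulnDl leq_add //.
    by apply: leq_trans (H1 x x0) _; rewrite leq_mul // leq_pexp2l ?leq_addr.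
  by apply: leq_trans (H2 x x0) _; rewrite leq_mul // leq_pexp2l ?leq_addl.
- exists (cost_weight e + val_weight e + (c1 + c2))%N, (d1 + d2).+1 => x x0.
  rewrite [leqRHS]mulnDl leq_add //.
    by rewrite leq_mul // -[leqLHS]expn1 leq_pexp2l.
  rewrite [leqRHS]mulnDl leq_add //.
    by apply: leq_trans (H1 x x0) _; rewrite leq_mul // leq_pexp2l //; lia.
  by apply: leq_trans (H2 x x0) _; rewrite leq_mul // leq_pexp2l //; lia.
- exists (2 * (cost_weight e + val_weight e + c1))%N, d1.+2 => x x0.
  set w := (cost_weight e + val_weight e)%N.
  have le1 : (w * x + time_bound p x <= (w + c1) * x ^ d1.+1)%N.
    rewrite [leqRHS]mulnDl leq_add //.
      by rewrite leq_mul // -[leqLHS]expn1 leq_pexp2l.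
    by apply: leq_trans (H1 x x0) _; rewrite leq_mul // leq_pexp2l.
  have le2 : (x.+1 <= 2 * x)%N by lia.
  apply: leq_trans (leq_mul le2 le1) _.
  by rewrite [(x ^ d1.+2)%N]expnS mulnACA.
Qed.

(** * A small array language *)

(** Each register is an array with two integer indices; scalars live at index
    (0, 0).  Register 0 is the low memory holding the input and output words,
    and may only be accessed at indices (k, 0) with k below its length. *)
Definition store := nat -> int -> int -> int.

Definition upd (s : store) r i j v : store :=
  fun r' i' j' => if [&& r' == r, i' == i & j' == j] then v else s r' i' j'.

Inductive aexp :=
  | ANum of int
  | AGet of nat & aexp & aexp
  | AOp of ram_op & aexp & aexp.

Fixpoint ev (s : store) (e : aexp) : int :=
  match e with
  | ANum z => z
  | AGet r e1 e2 => s r (ev s e1) (ev s e2)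
  | AOp o e1 e2 => ram_op_eval o (ev s e1) (ev s e2)
  end.

Inductive acmd :=
  | ASkip
  | ASet of nat & aexp & aexp & aexp
  | ASeq of acmd & acmd
  | AIf of aexp & acmd & acmd
  | AWhile of aexp & acmd.

Fixpoint iter_while (k : nat) (b : pred store) (f : store -> store) s :=
  if k is k'.+1 then if b s then iter_while k' b f (f s) else s else s.

(** This is [False] when the fuel runs out while the test still holds, so under [while_ok] the
    bounded loop [iter_while] agrees with the unbounded loop of the machine. *)
Fixpoint while_ok (k : nat) (b : pred store) (f : store -> store)
    (Q : store -> Prop) s : Prop :=
  if b s then
    if k is k'.+1 then Q s /\ while_ok k' b f Q (f s) else False
  else True.

Fixpoint low_ok (len : nat) (s : store) (e : aexp) : bool :=
  match e with
  | ANum _ => true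
  | AGet r e1 e2 =>
      [&& low_ok len s e1, low_ok len s e2
        & (r != 0%N) || ((0 <= ev s e1 < len%:Z) && (ev s e2 == 0))]
  | AOp _ e1 e2 => low_ok len s e1 && low_ok len s e2
  end.

(** Copies and tiny constants never make the memory larger. *)
Definition small_exp (e : aexp) : bool :=
  match e with
  | ANum z => `|z| <= 1
  | AGet _ _ _ => true
  | AOp _ _ _ => false
  end.

Record limits := Limits { max_iter : nat; word_len : nat; low_len : nat }.

Section Semantics.
Variable lim : limits.
Let N := max_iter lim.
Let b := word_len lim.
Let len := low_len lim.

Fixpoint run (c : acmd) (s : store) : store :=
  match c with
  | ASkip => s
  | ASet r e1 e2 e => upd s r (ev s e1) (ev s e2) (ev s e)
  | ASeq c1 c2 => run c2 (run c1 s)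
  | AIf e c1 c2 => if 0 < ev s e then run c1 s else run c2 s
  | AWhile e c => iter_while N (fun s => 0 < ev s e) (run c) s
  end.

(** Only stored values need a length bound: values inside an expression are controlled by
    [val_weight]. *)
Fixpoint ok (c : acmd) (s : store) : Prop :=
  match c with
  | ASkip => True
  | ASet r e1 e2 e =>
      low_ok len s (AGet r e1 e2) /\ low_ok len s e /\
      (small_exp e || (`|ev s e| < 2 ^+ b))
  | ASeq c1 c2 => ok c1 s /\ ok c2 (run c1 s)
  | AIf e c1 c2 =>
      low_ok len s e /\ if 0 < ev s e then ok c1 s else ok c2 s
  | AWhile e c =>
      while_ok N (fun s => 0 < ev s e)
        (run c) (fun s => low_ok len s e /\ ok c s) s
      /\ low_ok len (iter_while N (fun s => 0 < ev s e) (run c) s) e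
  end.

End Semantics.

Fixpoint exp_regs (e : aexp) : nat :=
  match e with
  | ANum _ => 0
  | AGet r e1 e2 => maxn r (maxn (exp_regs e1) (exp_regs e2))
  | AOp _ e1 e2 => maxn (exp_regs e1) (exp_regs e2)
  end.

Fixpoint regs (c : acmd) : nat :=
  match c with
  | ASkip => 0
  | ASet r e1 e2 e => maxn (exp_regs (AGet r e1 e2)) (exp_regs e)
  | ASeq c1 c2 => maxn (regs c1) (regs c2)
  | AIf e c1 c2 => maxn (exp_regs e) (maxn (regs c1) (regs c2))
  | AWhile e c => maxn (exp_regs e) (regs c)
  end.

(** * Compilation to the random access machine *)

(** [z |-> z (2 z + 1)] is an injection of the integers into the naturals, and
    [(p, q) |-> (p + q)^2 + p] is one on pairs of naturals. *)
Definition unsign_expr (e : expr) : expr :=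
  Binop OpMul e (Binop OpAdd (Binop OpAdd e e) (Const 1)).

Definition pair_expr (e1 e2 : expr) : expr :=
  Binop OpAdd (Binop OpMul (Binop OpAdd e1 e2) (Binop OpAdd e1 e2)) e1.

(** The input word occupies the cells from 1 up to its length; above it the arrays 1 to [M] are
    interleaved with stride [M]. The length is read from cell 0, which compiled code must therefore
    never overwrite. *)
Definition addr_expr (M r : nat) (e1 e2 : expr) : expr :=
  if r is 0 then Binop OpAdd e1 (Const 1) else
  Binop OpAdd (Binop OpAdd (Cell (Const 0)) (Const r%:Z))
    (Binop OpMul (Const M%:Z) (pair_expr (unsign_expr e1) (unsign_expr e2))).

Section Compilation.
Variable M : nat.

Fixpoint compile_exp (e : aexp) : expr :=
  match e with
  | ANum z => Const z
  | AGet r e1 e2 => Cell (addr_expr M r (compile_exp e1) (compile_exp e2))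
  | AOp o e1 e2 => Binop o (compile_exp e1) (compile_exp e2)
  end.

Fixpoint compile (c : acmd) : cmd :=
  match c with
  | ASkip => Skip
  | ASet r e1 e2 e =>
      Store (addr_expr M r (compile_exp e1) (compile_exp e2)) (compile_exp e)
  | ASeq c1 c2 => Seq (compile c1) (compile c2)
  | AIf e c1 c2 => IfPos (compile_exp e) (compile c1) (compile c2)
  | AWhile e c => WhilePos (compile_exp e) (compile c)
  end.

End Compilation.

Definition unsign (z : int) : int := z * (z + z + 1).
Definition pair_code (i j : int) : int :=
  (unsign i + unsign j) * (unsign i + unsign j) + unsign i.

Lemma unsign_ge0 z : 0 <= unsign z. Proof. rewrite /unsign; nia. Qed.

Lemma unsign_inj : injective unsign.
Proof.
move=> x y; rewrite /unsign => e; apply/eqP; rewrite -subr_eq0.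
have : (x - y) * (2 * (x + y) + 1) = 0 by lia.
by move/eqP; rewrite mulf_eq0 => /orP[//|]; lia.
Qed.

Lemma pair_code_ge0 i j : 0 <= pair_code i j.
Proof. by have := unsign_ge0 i; have := unsign_ge0 j; rewrite /pair_code; nia. Qed.

(** With [s = p + q], the code [s ^ 2 + p] lies between [s ^ 2] and [s ^ 2 + s], hence below
    [(s + 1) ^ 2]; it thus determines [s], then [p]. *)
Lemma pair_code_inj i j i' j' :
  pair_code i j = pair_code i' j' -> i = i' /\ j = j'.
Proof.
move: (unsign_ge0 i) (unsign_ge0 j) (unsign_ge0 i') (unsign_ge0 j').
rewrite /pair_code => i0 j0 i'0 j'0 eq_code.
have eq_sum : unsign i + unsign j = unsign i' + unsign j'.
  move: (unsign i) (unsign j) (unsign i') (unsign j') i0 j0 i'0 j'0 eq_code.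
  move=> p q p' q' p0 q0 p'0 q'0.
  by case: (ltrgtP (p + q) (p' + q')) => // lt; nia.
have ei : unsign i = unsign i' by move: eq_code; rewrite eq_sum; lia.
by split; apply: unsign_inj => //; lia.
Qed.

Section Simulation.
Variables (M : nat) (lim : limits).
Let N := max_iter lim.
Let b := word_len lim.
Let len := low_len lim.

Definition addr (r : nat) (i j : int) : int :=
  if r is 0 then i + 1 else len%:Z + r%:Z + M%:Z * pair_code i j.

Definition represents_store (s : store) (mu : memory) : Prop :=
  [/\ mu 0%N = len%:Z,
      forall k, (k < len)%N -> mu k.+1 = s 0%N k%:Z 0
    & forall r i j, (0 < r <= M)%N -> mu `|addr r i j|%N = s r i j].

(** Two array numbers in the range 1 to [M] differ by less than [M], so they cannot make up for a
    difference between the codes. *)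
Lemma addr_inj r i j r' i' j' : (0 < r <= M)%N -> (0 < r' <= M)%N ->
  `|addr r i j|%N = `|addr r' i' j'|%N -> [/\ r = r', i = i' & j = j'].
Proof.
case: r r' => [|r] [|r'] //= hr hr'.
have := pair_code_ge0 i j; have := pair_code_ge0 i' j' => p0' p0 e.
have e1 : r%:Z + M%:Z * pair_code i j = r'%:Z + M%:Z * pair_code i' j' by lia.
have e2 : pair_code i j = pair_code i' j' by nia.
have [-> ->] := pair_code_inj e2.
by split=> //; move: e1; rewrite e2; lia.
Qed.

Lemma eval_addr s mu r e1 e2 c1 c2 : represents_store s mu ->
  eval mu c1 = ev s e1 -> eval mu c2 = ev s e2 ->
  eval mu (addr_expr M r c1 c2) = addr r (ev s e1) (ev s e2).
Proof.
by case=> m0 _ _ E1 E2; case: r => [|r] /=; rewrite ?m0 ?E1 ?E2.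
Qed.

Lemma eval_compile s mu e : represents_store s mu -> (exp_regs e <= M)%N ->
  low_ok len s e -> eval mu (compile_exp M e) = ev s e.
Proof.
move=> rep; elim: e => [//|r e1 IH1 e2 IH2|o e1 IH1 e2 IH2].
  rewrite /= !geq_max => /and3P[hr h1 h2] /and3P[l1 l2 l].
  rewrite (eval_addr _ rep (IH1 h1 l1) (IH2 h2 l2)).
  case: rep => m0 mlow mhigh; case: r hr l => [_|r hr _]; last exact: mhigh.
  move=> /= /andP[/andP[e1ge e1lt] /eqP->].
  rewrite (_ : `|_|%N = (`|ev s e1|%N).+1); last by lia.
  by rewrite mlow ?gez0_abs //; lia.
by rewrite /= !geq_max => /andP[h1 h2] /andP[l1 l2]; rewrite IH1 ?IH2.
Qed.

Lemma represents_upd s mu r i j v :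
  represents_store s mu -> (r <= M)%N ->
  (r != 0%N) || ((0 <= i < len%:Z) && (j == 0)) ->
  represents_store (upd s r i j v) (update mu `|addr r i j|%N v).
Proof.
move=> [m0 mlow mhigh] rM low.
have code_ge0 i1 j1 : 0 <= M%:Z * pair_code i1 j1.
  by rewrite mulr_ge0 ?pair_code_ge0.
have addr0 : `|addr r i j|%N != 0%N.
  case: r rM low => [|r] _ /=; first by lia.
  by have := code_ge0 i j; move: (M%:Z * _); lia.
have high_addr r' i' j' : (0 < r' <= M)%N -> (len < `|addr r' i' j'|)%N.
  by case: r' => // r' _ /=; have := code_ge0 i' j'; move: (M%:Z * _); lia.
split=> [|k kl|r' i' j' hr']; rewrite /update /upd.
- by rewrite eq_sym (negPf addr0).
- case: r rM low addr0 => [|r] rM low addr0.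
    rewrite eqxx /=; move: low => /= /andP[i0 /eqP->]; rewrite eqxx andbT.
    rewrite (_ : (_ == _) = (k%:Z == i)); last by apply/eqP/eqP; lia.
    by case: eqP => // _; apply: mlow.
  rewrite mlow // ifF //; apply/eqP.
  by have := high_addr r.+1 i j rM; lia.
- case: r rM low addr0 => [|r] rM low addr0.
    rewrite ifF ?ifF ?mhigh //; last first.
      by apply/eqP; have := high_addr _ i' j' hr'; move: low; rewrite /addr /=; lia.
    by case: r' hr'.
  case: (altP and3P) => [[/eqP-> /eqP-> /eqP->]|ne]; first by rewrite eqxx.
  rewrite mhigh // ifF //; apply/eqP => /(addr_inj hr' (rM : (0 < r.+1 <= M)%N)).
  by case=> er ei ej; move: ne; rewrite er ei ej !eqxx.
Qed.

Hypotheses (b_gt0 : (0 < b)%N).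
Let x := (N + b)%N.

(** All time analysis happens here: once [ok] is known, the word length bounds each step and
    [max_iter] bounds each loop, so later parts only have to prove [ok]. *)
Lemma simulation c s mu : (regs c <= M)%N ->
  represents_store s mu -> bounded_mem b mu -> ok lim c s ->
  exists t mu', [/\ exec (compile M c) mu t mu',
    represents_store (run lim c s) mu', bounded_mem b mu'
    & (t <= time_bound (compile M c) x)%N].
Proof.
have bx : (b <= x)%N by apply: leq_addl.
elim: c s mu => [|r e1 e2 e|c1 IH1 c2 IH2|e c1 IH1 c2 IH2|e c IH] s mu /=.
- by move=> _ rep bm _; exists 1%N, mu; split => //; apply: exec_skip.
- rewrite !geq_max => /andP[/and3P[hr h1 h2] h] rep bm [/and3P[l1 l2 l] [le small]].
  have E := eval_compile rep h le.
  have EA := eval_addr r rep (eval_compile rep h1 l1) (eval_compile rep h2 l2).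
  eexists _, _; split; first exact: exec_store.
  + by rewrite EA E; apply: represents_upd.
  + move=> k; rewrite /update; case: eqP => // _.
    move: small => /orP[|]; last first.
      by rewrite E bitlen_leP // abs_lt_pow2.
    case: (e) => [z|r' e1' e2'|o' e1' e2'] //= small.
    by apply: leq_trans b_gt0; rewrite bitlen_leP //; lia.
  + by rewrite [leqRHS]mulnDl leq_add //; apply: test_cost_weight bm.
- rewrite !geq_max => /andP[h1 h2] rep bm [o1 o2].
  have [t1 [mu1 [x1 rep1 bm1 le1]]] := IH1 _ _ h1 rep bm o1.
  have [t2 [mu2 [x2 rep2 bm2 le2]]] := IH2 _ _ h2 rep1 bm1 o2.
  exists (t1 + t2)%N, mu2; split => //; first exact: exec_seq x1 x2.
  exact: leq_add.
- rewrite !geq_max => /and3P[h h1 h2] rep bm [l o].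
  have E := eval_compile rep h l.
  case: ltP o => [pos|npos] o.
    have [t [mu1 [x1 rep1 bm1 le1]]] := IH1 _ _ h1 rep bm o.
    exists (test_cost mu (compile_exp M e) + t)%N, mu1; split => //.
      by apply: exec_if_pos _ x1; rewrite E.
    apply: leq_add; first exact: test_cost_weight bm.
    exact: leq_trans le1 (leq_addr _ _).
  have [t [mu1 [x1 rep1 bm1 le1]]] := IH2 _ _ h2 rep bm o.
  exists (test_cost mu (compile_exp M e) + t)%N, mu1; split => //.
    by apply: exec_if_npos _ x1; rewrite E.
  apply: leq_add; first exact: test_cost_weight bm.
  exact: leq_trans le1 (leq_addl _ _).
rewrite geq_max => /andP[h hc] rep bm [o l].
set w := (_ + time_bound _ _)%N.
have Nx : (N <= x)%N by apply: leq_addr.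
(* The fuel is about to vary in an induction, while the cost [w] of one round must keep the full
   [x]. *)
suff [t [mu' [E rep' bm' le]]] : exists t mu',
    [/\ exec (WhilePos (compile_exp M e) (compile M c)) mu t mu',
     represents_store (iter_while N (fun s => 0 < ev s e) (run lim c) s) mu',
     bounded_mem b mu' & (t <= N.+1 * w)%N].
  by exists t, mu'; split => //; apply: leq_trans le _; rewrite leq_mul.
move: o l; rewrite -/N; elim: N s mu rep bm => [|k IHk] s mu rep bm /=.
  case: ifP => [//|/negbT npos _ l]; exists (test_cost mu (compile_exp M e)), mu.
  split => //.
    by apply: exec_while_npos; rewrite (eval_compile rep h l) leNgt.
  rewrite mul1n; apply: leq_trans (leq_addr _ _).
  exact: test_cost_weight bm.
case: ifP => [pos [[l ok1] ok2] l2|/negbT npos _ l]; last first.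
  exists (test_cost mu (compile_exp M e)), mu; split => //.
    by apply: exec_while_npos; rewrite (eval_compile rep h l) leNgt.
  apply: leq_trans (leq_pmull _ _) => //.
  by apply: leq_trans (leq_addr _ _); apply: test_cost_weight bm.
have [t1 [mu1 [x1 rep1 bm1 le1]]] := IH _ _ hc rep bm ok1.
have [t2 [mu2 [x2 rep2 bm2 le2]]] := IHk _ _ rep1 bm1 ok2 l2.
exists (test_cost mu (compile_exp M e) + t1 + t2)%N, mu2; split => //.
  by apply: exec_while_pos _ x1 x2; rewrite (eval_compile rep h l).
rewrite mulSn leq_add //.
by rewrite leq_add //; apply: test_cost_weight bm.
Qed.

End Simulation.

(** * Program logic *)

Lemma upd_other s r i j v r' : r' != r -> upd s r i j v r' = s r'.
Proof.
by move=> ne; apply/funext => i'; apply/funext => j'; rewrite /upd (negPf ne).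
Qed.

Fixpoint writes (c : acmd) : seq nat :=
  match c with
  | ASkip => [::]
  | ASet r _ _ _ => [:: r]
  | ASeq c1 c2 | AIf _ c1 c2 => writes c1 ++ writes c2
  | AWhile _ c => writes c
  end.

Fixpoint no_low (e : aexp) : bool :=
  match e with
  | ANum _ => true
  | AGet r e1 e2 => [&& r != 0%N, no_low e1 & no_low e2]
  | AOp _ e1 e2 => no_low e1 && no_low e2
  end.

Lemma no_low_ok len s e : no_low e -> low_ok len s e.
Proof.
elim: e => //= [r e1 IH1 e2 IH2 /and3P[-> h1 h2]|o e1 IH1 e2 IH2 /andP[h1 h2]].
  by rewrite IH1 ?IH2.
by rewrite IH1 ?IH2.
Qed.

Definition same_but (w : seq nat) (s s' : store) := forall r, r \notin w -> s' r = s r.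


Lemma same_but_upd w s s' r i j v :
  r \in w -> same_but w s s' -> same_but w s (upd s' r i j v).
Proof.
move=> rw h r' r'w; rewrite upd_other ?h //.
by apply: contraNneq r'w => ->.
Qed.

Lemma same_but_sub w w' s s' :
  same_but w s s' -> {subset w <= w'} -> same_but w' s s'.
Proof. by move=> h sub r rw; rewrite h //; apply: contra rw => /sub. Qed.

Lemma same_but_trans w w' s s' s'' : same_but w s s' -> same_but w' s' s'' ->
  {subset w' <= w} -> same_but w s s''.
Proof. by move=> h h' sub r rw; rewrite h' ?h //; apply: contra rw => /sub. Qed.

Section Logic.
Variable lim : limits.
Implicit Types (Q : store -> Prop) (s : store) (c : acmd).

Definition wp c Q s := ok lim c s /\ Q (run lim c s).

Lemma run_frame c s : same_but (writes c) s (run lim c s).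
Proof.
move=> r; elim: c s => [|r' e1 e2 e|c1 IH1 c2 IH2|e c1 IH1 c2 IH2|e c IH] s //=.
- by rewrite inE => ne; rewrite upd_other.
- by rewrite mem_cat negb_or => /andP[h1 h2]; rewrite IH2 ?IH1.
- by rewrite mem_cat negb_or => /andP[h1 h2]; case: ifP => _; rewrite ?IH1 ?IH2.
move=> h; elim: (max_iter lim) s => [//|k IHk] s /=.
by case: ifP => // _; rewrite IHk IH.
Qed.

Lemma wp_conseq c Q Q' s : wp c Q s ->
  (forall s', same_but (writes c) s s' -> Q s' -> Q' s') -> wp c Q' s.
Proof. by case=> ho hq h; split => //; apply: h => //; apply: run_frame. Qed.

Lemma wp_skip Q s : Q s -> wp ASkip Q s. Proof. by []. Qed.

Lemma wp_seq c1 c2 Q s : wp c1 (wp c2 Q) s -> wp (ASeq c1 c2) Q s.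
Proof. by case=> h1 [h2 h3]. Qed.

Lemma wp_set r e1 e2 e Q s :
  [&& r != 0%N, no_low e1, no_low e2 & no_low e] ->
  small_exp e || (`|ev s e| < 2 ^+ word_len lim) ->
  Q (upd s r (ev s e1) (ev s e2) (ev s e)) -> wp (ASet r e1 e2 e) Q s.
Proof.
case/and4P=> r0 n1 n2 n sm q; split => //=; split; last first.
  by split => //; apply: no_low_ok.
by rewrite !no_low_ok // r0.
Qed.

Lemma wp_if e c1 c2 Q s : no_low e ->
  (0 < ev s e -> wp c1 Q s) -> (ev s e <= 0 -> wp c2 Q s) ->
  wp (AIf e c1 c2) Q s.
Proof.
by rewrite /wp /= => /no_low_ok-> h1 h2; case: ltP => [/h1|/h2] [].
Qed.

(** [I k s] promises that at most [k] rounds remain, so the index is the termination measure and the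
    required fuel at once. *)
Lemma wp_while (I : nat -> store -> Prop) e c Q k s :
  (k <= max_iter lim)%N -> no_low e -> I k s ->
  (forall k s, I k s -> 0 < ev s e ->
     wp c (fun s' => exists2 k', (k' < k)%N & I k' s') s) ->
  (forall s, (exists k, I k s) -> ev s e <= 0 -> Q s) ->
  wp (AWhile e c) Q s.
Proof.
move=> kN ne Ik step fin; rewrite /wp /=.
set b := fun s => 0 < ev s e.
suff [h1 h2] : while_ok (max_iter lim) b (run lim c)
      (fun s => low_ok (low_len lim) s e /\ ok lim c s) s
    /\ Q (iter_while (max_iter lim) b (run lim c) s).
  by split => //; split => //; apply: no_low_ok.
elim: (max_iter lim) k s kN Ik => [|N IH] k s kN Ik /=.
  case: (boolP (b s)) => [pos|npos]; last first.
    by split => //; apply: fin; [exists k | rewrite leNgt].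
  have [_ [k' k'k]] := step _ _ Ik pos; move: kN k'k; rewrite leqn0 => /eqP->.
  by [].
case: (boolP (b s)) => [pos|npos]; last first.
  by split => //; apply: fin; [exists k | rewrite leNgt].
have [o [k' k'k Ik']] := step _ _ Ik pos.
have k'N : (k' <= N)%N by rewrite -ltnS; apply: leq_trans k'k kN.
have [h1 h2] := IH _ _ k'N Ik'; split => //; split => //; split => //.
exact: no_low_ok.
Qed.

End Logic.

Definition V r := AGet r (ANum 0) (ANum 0).
Definition AFor (v rb : nat) (c : acmd) : acmd :=
  ASeq (ASet v (ANum 0) (ANum 0) (ANum 0))
    (AWhile (AOp OpSub (V rb) (V v))
       (ASeq c (ASet v (ANum 0) (ANum 0) (AOp OpAdd (V v) (ANum 1))))).

(** The body is judged on the store in which the counter has already been advanced, so it never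
    deals with the increment. Frames refer to the store before the loop, which keeps all untouched
    registers available in every round. *)
Lemma wp_for lim (n : nat) (I : nat -> store -> Prop) v rb c Q s :
  (n <= max_iter lim)%N -> n%:Z < 2 ^+ word_len lim ->
  [&& v != 0, rb != 0, v != rb, v \notin writes c & rb \notin writes c]%N ->
  s rb 0 0 = n%:Z ->
  I 0%N (upd s v 0 0 0) ->
  (forall k s', (k < n)%N -> same_but (v :: writes c) s s' ->
     s' v 0 0 = k%:Z -> I k s' ->
     wp lim c (fun s'' => I k.+1 (upd s'' v 0 0 k.+1%:Z)) s') ->
  (forall s', same_but (v :: writes c) s s' -> s' v 0 0 = n%:Z -> I n s' -> Q s') ->
  wp lim (AFor v rb c) Q s.
Proof.
move=> nN nb /and5P[v0 rb0 vrb vc rbc] srb I0 step fin.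
apply/wp_seq/wp_set => //; first by rewrite v0.
have rbv : rb != v by rewrite eq_sym.
pose J k s' := exists i, [/\ (i + k)%N = n, same_but (v :: writes c) s s',
  s' v 0 0 = i%:Z & I i s'].
have sameP s' : same_but (v :: writes c) s s' -> s' rb 0 0 = n%:Z.
  by move=> ->; rewrite ?srb // inE negb_or rbv.
apply: (@wp_while _ J _ _ _ n) => //=.
- by rewrite rb0 v0.
- exists 0%N; split => //; last by rewrite /upd !eqxx.
  by move=> r; rewrite inE negb_or => /andP[rv _]; rewrite upd_other.
- move=> k s' [i [ik same' s'v Ii]]; rewrite sameP // s'v subr_gt0 => ilt.
  have i_n : (i < n)%N by lia.
  apply: wp_seq; apply: wp_conseq (step _ _ i_n same' s'v Ii) _ => s1 f1 I1.
  have s1v : s1 v 0 0 = i%:Z by rewrite f1.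
  apply: wp_set => //=; first by rewrite v0.
    by rewrite s1v; lia.
  exists k.-1; first by lia.
  exists i.+1; rewrite s1v; split => //.
  - by lia.
  - move=> r rn; move: (rn); rewrite inE negb_or => /andP[rv rc].
    by rewrite upd_other // f1 // same'.
  - by rewrite /upd !eqxx /=; lia.
  by rewrite (_ : i%:Z + 1 = i.+1%:Z) //; lia.
move=> s' [k [i [ik same' s'v Ii]]].
rewrite sameP // s'v subr_le0 => le.
have e : i = n by lia.
by subst i; apply: fin.
Qed.

(** * The Hungarian method *)

Arguments upd s r i j v r' i' j' /.

Notation rn := 1%N.
Notation rm := 2%N.
Notation rA := 3%N.
Notation rB := 4%N.
Notation rMM := 5%N.
Notation rW := 6%N.
Notation rX := 7%N.
Notation rU := 8%N.
Notation rVd := 9%N.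
Notation rE := 10%N.
Notation rD := 11%N.
Notation rET := 12%N.
Notation rDT := 13%N.
Notation rp := 14%N.
Notation rRS := 15%N.
Notation rRT := 16%N.
Notation rPS := 17%N.
Notation rPT := 18%N.
Notation rk := 19%N.
Notation rbi := 20%N.
Notation rbj := 21%N.
Notation rbd := 22%N.
Notation rhas := 23%N.
Notation ri := 24%N.
Notation rj := 25%N.
Notation rsl := 26%N.
Notation rgo := 27%N.
Notation rcur := 28%N.
Notation rci := 29%N.

Definition G1 r e := AGet r e (ANum 0).
Definition S0 r e := ASet r (ANum 0) (ANum 0) e.
Definition S1 r i e := ASet r i (ANum 0) e.

Declare Scope prog_scope.
Delimit Scope prog_scope with P.
Notation "a + b" := (AOp OpAdd a b) : prog_scope.
Notation "a - b" := (AOp OpSub a b) : prog_scope.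
Notation "a * b" := (AOp OpMul a b) : prog_scope.
Notation "a / b" := (AOp OpDiv a b) : prog_scope.
Notation "c1 ;; c2" := (ASeq c1 c2) (at level 90, right associativity) : prog_scope.
Bind Scope prog_scope with aexp.
Bind Scope prog_scope with acmd.

(** * One search for an augmenting path *)

Definition find_min : acmd :=
  (S0 rhas (ANum 0) ;;
   AFor ri rn
     (AIf (G1 rRS (V ri))
       (AFor rj rm
         (AIf (G1 rRT (V rj)) ASkip
           (S0 rsl (AGet rW (V ri) (V rj) - G1 rU (V ri) - G1 rVd (V rj)) ;;
            AIf (V rhas) ASkip (S0 rbd (V rsl + ANum 1)) ;;
            S0 rhas (ANum 1) ;;
            AIf (V rbd - V rsl)
              (S0 rbd (V rsl) ;; S0 rbi (V ri) ;; S0 rbj (V rj)) ASkip)))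
       ASkip))%P.

Definition update_duals : acmd :=
  (AFor ri rn
     (AIf (G1 rRS (V ri)) (S1 rU (V ri) (G1 rU (V ri) + V rbd)) ASkip) ;;
   AFor rj rm
     (AIf (G1 rRT (V rj)) (S1 rVd (V rj) (G1 rVd (V rj) - V rbd)) ASkip))%P.

Definition reach_sources : acmd :=
  AFor ri rn
    (AIf (G1 rRS (V ri)) ASkip
      (AIf (AGet rX (V ri) (V rbj))
         (ASeq (S1 rRS (V ri) (V rk)) (S1 rPS (V ri) (V rbj))) ASkip)).

Definition reach_sink : acmd :=
  (S1 rRT (V rbj) (V rk) ;; S1 rPT (V rbj) (V rbi))%P.

Definition init_search : acmd :=
  (AFor ri rn (AIf (G1 rE (V ri)) (S1 rRS (V ri) (ANum 1)) (S1 rRS (V ri) (ANum 0))) ;;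
   AFor rj rm (S1 rRT (V rj) (ANum 0)) ;;
   S0 rk (ANum 1) ;; S0 rgo (ANum 1))%P.

Definition search_step : acmd :=
  (S0 rk (V rk + ANum 1) ;; find_min ;; update_duals ;; reach_sink ;;
   AIf (G1 rD (V rbj)) (S0 rgo (ANum 0)) reach_sources)%P.

Definition search : acmd := (init_search ;; AWhile (V rgo) search_step)%P.

Section Hungarian.
Variables (lim : limits) (n m : nat).
Let N := max_iter lim.
Let H : int := 2 ^+ word_len lim.
Hypotheses (nN : (n + m + 3 <= N)%N) (NH : N%:Z < H).

Definition slack (s : store) (i j : nat) : int :=
  s rW i j - s rU i 0 - s rVd j 0.

Definition eligible (s : store) (i j : nat) : Prop :=
  0 < s rRS i 0 /\ s rRT j 0 <= 0.

Definition best_of (s : store) (P : nat -> nat -> Prop) : Prop :=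
  [\/ s rhas 0 0 = 0 /\ (forall i j, P i j -> ~ eligible s i j)
    | s rhas 0 0 = 1 /\ exists i j : nat,
        [/\ (i < n)%N, (j < m)%N & eligible s i j] /\
        [/\ s rbi 0 0 = i, s rbj 0 0 = j, s rbd 0 0 = slack s i j
          & forall i' j', P i' j' -> eligible s i' j' -> s rbd 0 0 <= slack s i' j']].

Definition dims (s : store) := s rn 0 0 = n /\ s rm 0 0 = m.

Lemma best_of_ext s s' (P P' : nat -> nat -> Prop) :
  best_of s P ->
  same_but [:: ri; rj; rsl] s s' ->
  (forall i j, P' i j -> eligible s i j -> P i j) -> best_of s' P'.
Proof.
move=> best e PP.
have eE i j : eligible s' i j = eligible s i j by rewrite /eligible !e.
have eS i j : slack s' i j = slack s i j by rewrite /slack !e.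
case: best => [[h none]|[h [i [j [el [h1 h2 h3 h4]]]]]]; [left|right].
  by rewrite e //; split => // i j p; rewrite eE => el; apply: none (PP _ _ p el) el.
rewrite !e //; split => //; exists i, j; rewrite eS eE; split => //.
by split => // i' j' p; rewrite eE eS => el'; apply: h4 => //; apply: PP.
Qed.

Lemma find_minP s : dims s ->
  (forall i j, (i < n)%N -> (j < m)%N -> `|slack s i j| + 1 < H) ->
  (exists i j, [/\ (i < n)%N, (j < m)%N & eligible s i j]) ->
  wp lim find_min (fun s' => exists i j : nat,
    [/\ (i < n)%N, (j < m)%N & eligible s i j] /\
    [/\ s' rbi 0 0 = i, s' rbj 0 0 = j, s' rbd 0 0 = slack s i j
      & forall i' j', (i' < n)%N -> (j' < m)%N -> eligible s i' j' ->
         slack s i j <= slack s i' j']) s.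
Proof.
move=> [dn dm] bd ex; apply/wp_seq/wp_set => //=.
apply: (@wp_for _ n (fun k s' => best_of s' (fun i j => i < k /\ j < m)%N)) => //=.
- by lia.
- by lia.
- by left; split => // i j [].
- move=> k s1 kn f1 s1i best1; apply: wp_if => //=; rewrite !s1i => hi; last first.
    apply/wp_skip/(best_of_ext best1) => [|i j].
      exact: same_but_upd.
    by rewrite ltnS leq_eqVlt => -[/orP[/eqP->|//] jm] [??]; lia.
  apply: (@wp_for _ m (fun l s' => best_of s'
    (fun i j => (i < k /\ j < m) \/ (i = k /\ j < l))%N)) => //=.
  + by lia.
  + by lia.
  + by rewrite f1.
  + apply: (best_of_ext best1) => [|i j [//|[]//]].
    exact: same_but_upd.
  + move=> l s2 lm f2 s2j best2.
    have s2i : s2 ri 0 0 = k by rewrite f2.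
    apply: wp_if => //=; rewrite !s2j => hj.
      apply/wp_skip/(best_of_ext best2) => [|i j].
        exact: same_but_upd.
      case=> [h|[-> jl]] [h1 h2]; [by left|right; split => //].
      by rewrite ltn_neqAle -ltnS jl andbT; apply: contraPneq hj => <-; lia.
    have E2 : slack s2 k l = slack s k l by rewrite /slack !(f2, f1).
    have bdkl := bd k l kn lm.
    apply/wp_seq/wp_set => //=; rewrite s2i s2j -/(slack s2 k l) E2.
      by rewrite -/H; lia.
    case: best2 => [[h none]|[h [i [j [[il jl el] [h1 h2 h3 h4]]]]]].
      apply/wp_seq/wp_if => //=; rewrite h // => _.
      (* For the first eligible edge the bound is set to its slack plus 1, so that the comparison
         which follows accepts it. *)
      apply: wp_set => //=; first by rewrite -/H; lia.
      apply/wp_seq/wp_set => //=; apply: wp_if => //= [_|]; last by lia.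
      apply/wp_seq/wp_set => //=; apply/wp_seq/wp_set => //=; apply: wp_set => //=.
      right; split => //; exists k, l; split; split => //=.
        by split; rewrite /eligible //=; move: hi hj; rewrite !(f2, f1).
      move=> i' j' p el'; rewrite -E2; case: p => [p|[ek jl]]; last subst i'.
        by case: (none i' j' _ el'); left.
      have [->|jnl] := eqVneq j' l; first exact: lexx.
      by case: (none k j' _ el'); right; split => //; rewrite ltn_neqAle jnl.
    apply/wp_seq/wp_if => //=; rewrite h // => _; apply: wp_skip.
    apply/wp_seq/wp_set => //=; apply: wp_if => //= lt.
      apply/wp_seq/wp_set => //=; apply/wp_seq/wp_set => //=; apply: wp_set => //=.
      right; split => //; exists k, l; split; split => //=.
        by split; rewrite /eligible //=; move: hi hj; rewrite !(f2, f1).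
      move=> i' j' p el'; case: p => [p|[ek jl']]; last subst i'.
        by apply: le_trans (h4 i' j' (or_introl p) el'); lia.
      have [->|jnl] := eqVneq j' l; first by rewrite -E2 /slack /=.
      by apply: le_trans (h4 k j' _ el'); [lia | right; split => //; rewrite ltn_neqAle jnl].
    apply: wp_skip; right; split => //=; exists i, j; split; split => //=.
    move=> i' j' p el'; case: p => [p|[ek jl']]; first exact: h4 (or_introl p) el'.
    subst i'.
    have [->|jnl] := eqVneq j' l; first by move: lt; rewrite -E2 /slack /=; lia.
    by apply: h4 el'; right; split => //; rewrite ltn_neqAle jnl.
  + move=> s2 f2 _ best2; apply: (best_of_ext best2) => [|i j].
      exact: same_but_upd.
    by rewrite ltnS leq_eqVlt => -[/orP[/eqP->|->] jm] _; [right|left].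
- move=> s1 f1 _ best1.
move: best1 => [[_ none]|[_ [i [j [[il jl el] [h1 h2 h3 h4]]]]]].
  by case: ex => i [j [il jl el]]; case: (none i j) => //; rewrite /eligible !f1.
have eE i1 j1 : eligible s1 i1 j1 = eligible s i1 j1 by rewrite /eligible !f1.
have eS i1 j1 : slack s1 i1 j1 = slack s i1 j1 by rewrite /slack !f1.
exists i, j; rewrite -eE -eS; split; split => // i' j' il' jl' el'.
by rewrite -eS -h3; apply: h4 => //; rewrite eE.
Qed.

End Hungarian.

Lemma ltS_eqVlt (i k : nat) : (i < k.+1)%N = (i == k) || (i < k)%N.
Proof. by rewrite ltnS leq_eqVlt. Qed.

Section Search.
Variables (lim : limits) (n m : nat).
Let N := max_iter lim.
Let H : int := 2 ^+ word_len lim.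
Hypotheses (nN : (n + m + 3 <= N)%N) (NH : N%:Z < H).

Lemma update_dualsP s : dims n m s ->
  (forall i, (i < n)%N -> `|s rU i 0 + s rbd 0 0| < H) ->
  (forall j, (j < m)%N -> `|s rVd j 0 - s rbd 0 0| < H) ->
  wp lim update_duals (fun s' =>
    (forall i, (i < n)%N -> s' rU i 0 =
       if 0 < s rRS i 0 then s rU i 0 + s rbd 0 0 else s rU i 0) /\
    (forall j, (j < m)%N -> s' rVd j 0 =
       if 0 < s rRT j 0 then s rVd j 0 - s rbd 0 0 else s rVd j 0)) s.
Proof.
move=> [dn dm] hU hV.
apply: wp_seq; apply: (@wp_for _ n (fun k s' => forall i, (i < n)%N ->
  s' rU i 0 = if (i < k)%N && (0 < s rRS i 0) then s rU i 0 + s rbd 0 0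
              else s rU i 0)) => //=; try lia.
  move=> k s1 kn f1 s1i I1.
  have uk : s1 rU k 0 = s rU k 0 by rewrite I1 // ltnn.
  apply: wp_if => //=; rewrite s1i f1 // => hk.
    apply: wp_set => //=; rewrite s1i uk [s1 rbd]f1 //; first exact: hU.
    move=> i iN; rewrite eqz_nat andbT I1 // ltS_eqVlt.
    by have [->|ne] := eqVneq i k; rewrite //= hk.
  apply: wp_skip => i iN; rewrite I1 // ltS_eqVlt.
  by have [->|//] := eqVneq i k; rewrite ltnn /= ltNge hk.
move=> s1 f1 _ I1.
apply: (@wp_for _ m (fun k s' => forall j, (j < m)%N ->
  s' rVd j 0 = if (j < k)%N && (0 < s rRT j 0) then s rVd j 0 - s rbd 0 0
              else s rVd j 0)) => //=; try lia.
- by rewrite f1.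
- by move=> j jm; rewrite f1.
- move=> k s2 km f2 s2j I2.
  have vk : s2 rVd k 0 = s rVd k 0 by rewrite I2 // ltnn.
  apply: wp_if => //=; rewrite s2j f2 ?f1 // => hk.
    apply: wp_set => //=; rewrite s2j vk [s2 rbd]f2 // [s1 rbd]f1 //; first exact: hV.
    move=> j jm; rewrite eqz_nat andbT I2 // ltS_eqVlt.
    by have [->|ne] := eqVneq j k; rewrite //= hk.
  apply: wp_skip => j jm; rewrite I2 // ltS_eqVlt.
  by have [->|//] := eqVneq j k; rewrite ltnn /= ltNge hk.
move=> s2 f2 _ I2; split=> [i iN|j jm]; last by rewrite I2 // jm.
by rewrite f2 // I1 // iN.
Qed.

Lemma reach_sourcesP s (b : nat) : dims n m s -> s rbj 0 0 = b ->
  wp lim reach_sources (fun s' => forall i, (i < n)%N ->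
    if (s rRS i 0 <= 0) && (0 < s rX i b) then
      s' rRS i 0 = s rk 0 0 /\ s' rPS i 0 = b
    else s' rRS i 0 = s rRS i 0 /\ s' rPS i 0 = s rPS i 0) s.
Proof.
move=> [dn dm] sb.
apply: (@wp_for _ n (fun k s' => forall i, (i < n)%N ->
    if [&& (i < k)%N, s rRS i 0 <= 0 & 0 < s rX i b] then
      s' rRS i 0 = s rk 0 0 /\ s' rPS i 0 = b
    else s' rRS i 0 = s rRS i 0 /\ s' rPS i 0 = s rPS i 0)) => //=; try lia.
  move=> k s1 kn f1 s1i I1.
  have := I1 k kn; rewrite ltnn /= => -[eRS ePS].
  have skip : ~~ ((s rRS k 0 <= 0) && (0 < s rX k b)) ->
      forall i : nat, (i < n)%N ->
      if [&& (i < k.+1)%N, s rRS i 0 <= 0 & 0 < s rX i b]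
      then s1 rRS i 0 = s rk 0 0 /\ s1 rPS i 0 = b
      else s1 rRS i 0 = s rRS i 0 /\ s1 rPS i 0 = s rPS i 0.
    move=> ne i iN; have := I1 i iN; rewrite ltS_eqVlt.
    by have [->|//] := eqVneq i k; rewrite ltnn (negPf ne).
  apply: wp_if => //=; rewrite s1i eRS => hk.
    by apply/wp_skip/skip; rewrite negb_and -ltNge hk.
  apply: wp_if => //=; rewrite s1i [s1 rbj]f1 // [s1 rX]f1 // sb => hx.
    apply/wp_seq/wp_set => //=; apply: wp_set => //= i iN.
    rewrite s1i !eqz_nat !andbT ltS_eqVlt.
    have [->|ne] := eqVneq i k; last exact: I1.
    by rewrite hk hx /= !f1.
  by apply/wp_skip/skip; rewrite negb_and -!leNgt hx orbT.
by move=> s1 f1 _ I1 i iN; have := I1 i iN; rewrite iN.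
Qed.

Lemma init_searchP s : dims n m s ->
  wp lim init_search (fun s' =>
    [/\ forall i, (i < n)%N -> s' rRS i 0 = (0 < s rE i 0),
        forall j, (j < m)%N -> s' rRT j 0 = 0, s' rk 0 0 = 1 & s' rgo 0 0 = 1]) s.
Proof.
move=> [dn dm].
apply: wp_seq; apply: (@wp_for _ n (fun k s' => forall i, (i < k)%N ->
  s' rRS i 0 = (0 < s rE i 0))) => //=; try lia.
  move=> k s1 kn f1 s1i I1; apply: wp_if => //=; rewrite s1i f1 // => hk;
    apply: wp_set => //= i; rewrite s1i eqz_nat andbT ltS_eqVlt;
    have [->|ne /=] := eqVneq i k; rewrite ?hk //; try exact: I1.
  by rewrite ltNge hk.
move=> s1 f1 _ I1.
apply: wp_seq; apply: (@wp_for _ m (fun k s' => forall j, (j < k)%N ->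
  s' rRT j 0 = 0)) => //=; try lia.
- by rewrite f1.
- move=> k s2 km f2 s2j I2; apply: wp_set => //= j; rewrite s2j eqz_nat andbT ltS_eqVlt.
  by have [//|ne /=] := eqVneq j k; apply: I2.
move=> s2 f2 _ I2; apply/wp_seq/wp_set => //=; apply: wp_set => //=; split => //.
by move=> i iN; rewrite f2 // I1.
Qed.

End Search.

(** * Invariants of the search *)

Section SearchInvariant.
Variables (n m : nat).
Implicit Types s : store.

Definition dual_feasible s := forall i j, (i < n)%N -> (j < m)%N ->
  s rU i 0 + s rVd j 0 <= s rW i j.

Definition tight_flow s := forall i j, (i < n)%N -> (j < m)%N ->
  0 <= s rX i j /\ (0 < s rX i j -> s rU i 0 + s rVd j 0 = s rW i j).

Definition duals_within s (f : int) :=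
  (forall i, (i < n)%N -> `|s rU i 0| <= f) /\
  (forall j, (j < m)%N -> `|s rVd j 0| <= f).

(** [RS] and [RT] hold the times at which nodes are reached ([0] if never);
    the predecessor of a node is reached no later, strictly earlier for sinks,
    which makes predecessor chains end in a source with excess. *)
Definition source_inv s := forall i, (i < n)%N ->
  [/\ 0 <= s rRS i 0 <= s rk 0 0, 0 < s rE i 0 -> 0 < s rRS i 0
    & 0 < s rRS i 0 -> 0 < s rE i 0 \/ exists2 j : nat, (j < m)%N &
        [/\ s rPS i 0 = j, 0 < s rRT j 0, s rRT j 0 = s rRS i 0 & 0 < s rX i j]].

Definition sink_inv s := forall j, (j < m)%N ->
  0 <= s rRT j 0 <= s rk 0 0 /\
  (0 < s rRT j 0 -> exists2 i : nat, (i < n)%N &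
    [/\ s rPT j 0 = i, 0 < s rRS i 0, s rRS i 0 < s rRT j 0
      & s rU i 0 + s rVd j 0 = s rW i j]).

(** This keeps flow edges tight when the duals move: both ends of a flow edge into a reached sink
    are shifted together. It breaks once a sink with unmet demand is reached, which is where the
    search stops. *)
Definition closed_search s := forall j, (j < m)%N -> 0 < s rRT j 0 ->
  s rD j 0 <= 0 /\ forall i, (i < n)%N -> 0 < s rX i j -> 0 < s rRS i 0.

Section Step.
Variables (s s' : store) (a b : nat).
Let d := slack s a b.
Hypotheses (an : (a < n)%N) (bm : (b < m)%N).
Hypothesis (elig : eligible s a b).
Hypothesis (dmin : forall i j, (i < n)%N -> (j < m)%N -> eligible s i j ->
  d <= slack s i j).
Hypothesis eU : forall i, (i < n)%N -> s' rU i 0 =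
  if 0 < s rRS i 0 then s rU i 0 + d else s rU i 0.
Hypothesis eV : forall j, (j < m)%N -> s' rVd j 0 =
  if 0 < s rRT j 0 then s rVd j 0 - d else s rVd j 0.
Hypothesis eRT : forall j : nat, s' rRT j 0 = if j == b then s' rk 0 0 else s rRT j 0.
Hypothesis ePT : forall j : nat, s' rPT j 0 = if j == b then a%:Z else s rPT j 0.
Hypothesis ek : s' rk 0 0 = s rk 0 0 + 1.
Hypotheses (eX : s' rX = s rX) (eW : s' rW = s rW) (eE : s' rE = s rE)
  (eD : s' rD = s rD).
Hypotheses (feas : dual_feasible s) (tight : tight_flow s).
Hypotheses (src : source_inv s) (snk : sink_inv s) (cl : closed_search s).

Lemma step_delta_ge0 : 0 <= d.
Proof. by have := feas an bm; rewrite /d /slack; lia. Qed.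

(** Slack is lost only between a reached source and an unreached sink, and there it is at least
    [d]. *)
Lemma step_feasible : dual_feasible s'.
Proof.
move=> i j iN jm; rewrite eU // eV // eW; have := feas iN jm.
have := step_delta_ge0.
case: ltP => hi; case: ltP => hj; try lia.
by have := dmin iN jm (conj hi hj); rewrite [slack s i j]/slack; lia.
Qed.

(** Two cases could lose tightness. From an unreached source to a reached sink there is no flow, by
    [closed_search]; a flow edge from a reached source to an unreached sink has slack 0, which
    forces [d = 0]. *)
Lemma step_tight : tight_flow s'.
Proof.
move=> i j iN jm; rewrite eU // eV // eW eX; have [x0 xt] := tight iN jm.
split => // xpos; have := xt xpos; have := step_delta_ge0.
case: ltP => hi; case: ltP => hj; try lia.
  by have := dmin iN jm (conj hi hj); rewrite [slack s i j]/slack; lia.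
by have [_ /(_ i iN xpos)] := cl jm hj; lia.
Qed.

(** The slack [d] combines one cost and two potentials, so it is at most [3 * f]; this is the origin
    of the factor 4 per reached sink. *)
Lemma step_within f : (forall i j, (i < n)%N -> (j < m)%N -> `|s rW i j| <= f) ->
  duals_within s f -> duals_within s' (4 * f).
Proof.
move=> hW [hU hV]; have ha := hU _ an; have hb := hV _ bm; have hw := hW _ _ an bm.
have hd : `|d| <= 3 * f by rewrite /d /slack; lia.
split=> [i iN|j jm].
  by rewrite eU //; have := hU i iN; case: ifP => _; lia.
by rewrite eV //; have := hV j jm; case: ifP => _; lia.
Qed.

Lemma step_sink (eRS : forall i, (i < n)%N -> 0 < s rRS i 0 -> s' rRS i 0 = s rRS i 0) :
  sink_inv s'.
Proof.
case: elig => ela elb.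
move=> j jm; rewrite eRT ePT ek eW; have [rng prev] := snk jm.
have [ej|ne] := eqVneq j b.
  subst j; split; first by lia.
  move=> _; exists a => //; have [rngs _ _] := src an.
  rewrite eRS // eU // eV // ela [0 < s rRT b 0]ltNge elb /=; split => //; first by lia.
  by rewrite /d /slack; lia.
split; first by lia.
move=> hj; have [i iN [h1 h2 h3 h4]] := prev hj; exists i => //.
by rewrite eRS // eU // eV // h2 hj; split => //; lia.
Qed.

Lemma step_source_stop : s' rRS = s rRS -> s' rPS = s rPS -> source_inv s'.
Proof.
case: elig => ela elb.
move=> eRS ePS i iN; have [h1 h2 h3] := src iN.
rewrite eRS ePS eE eX ek; split => //; first by lia.
move=> /h3[|[j jm [q1 q2 q3 q4]]]; [by left|right; exists j => //].
rewrite eRT; case: eqP => [ej|//]; by subst j; lia.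
Qed.

Hypothesis (eRS : forall i, (i < n)%N ->
  if (s rRS i 0 <= 0) && (0 < s rX i b) then
      s' rRS i 0 = s' rk 0 0 /\ s' rPS i 0 = b
    else s' rRS i 0 = s rRS i 0 /\ s' rPS i 0 = s rPS i 0).

Lemma step_source : source_inv s'.
Proof.
case: elig => ela elb.
move=> i iN; have := eRS iN; have [h1 h2 h3] := src iN.
have kpos : 0 <= s rk 0 0 by lia.
case: ifP => [/andP[hi hx]|_] [-> ->]; rewrite eE eX ek.
  split; [by lia|by lia|move=> _; right; exists b => //].
  by rewrite eRT eqxx ek; split => //; lia.
split; [by lia|done|].
move=> /h3[|[j jm [q1 q2 q3 q4]]]; [by left|right; exists j => //].
rewrite eRT; case: eqP => [ej|//]; by subst j; lia.
Qed.

Lemma step_closed : s rD b 0 <= 0 -> closed_search s'.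
Proof.
move=> hD j jm; rewrite eRT eD eX => hj.
have [rngk _ _] := src an.
suff [h1 h2] : s rD j 0 <= 0 /\
    forall i, (i < n)%N -> 0 < s rX i j -> 0 < s rRS i 0 \/ j = b.
  split => // i iN xpos; have := eRS iN.
  case: (leP (s rRS i 0) 0) => hi /=.
    case: (h2 i iN xpos) => [h|ej]; first by lia.
    by subst j; rewrite xpos => -[-> _]; rewrite ek; lia.
  by case=> -> _.
move: hj; case: eqP => [ej|ne] hj; first by subst j; split => // *; right.
by have [h1 h2] := cl jm hj; split => // i iN xpos; left; apply: h2.
Qed.

End Step.

End SearchInvariant.

Section SearchLoop.
Variables (lim : limits) (n m : nat).
Let N := max_iter lim.
Let H : int := 2 ^+ word_len lim.
Hypotheses (nN : (n + m + 3 <= N)%N) (NH : N%:Z < H).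

Lemma search_stepP s f : dims n m s -> dual_feasible n m s -> duals_within n m s f ->
  (forall i j, (i < n)%N -> (j < m)%N -> `|s rW i j| <= f) -> 1 <= f -> 4 * f < H ->
  `|s rk 0 0 + 1| < H ->
  (exists i j, [/\ (i < n)%N, (j < m)%N & eligible s i j]) ->
  wp lim search_step (fun s' => exists a b : nat,
    [/\ (a < n)%N, (b < m)%N, eligible s a b & s' rbj 0 0 = b] /\
    [/\ forall i j, (i < n)%N -> (j < m)%N -> eligible s i j ->
          slack s a b <= slack s i j,
        forall i, (i < n)%N -> s' rU i 0 =
          if 0 < s rRS i 0 then s rU i 0 + slack s a b else s rU i 0,
        forall j, (j < m)%N -> s' rVd j 0 =
          if 0 < s rRT j 0 then s rVd j 0 - slack s a b else s rVd j 0 &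
      [/\ forall j : nat, s' rRT j 0 = if j == b then s' rk 0 0 else s rRT j 0,
          forall j : nat, s' rPT j 0 = if j == b then a%:Z else s rPT j 0,
          s' rk 0 0 = s rk 0 0 + 1
        & if 0 < s rD b 0 then [/\ s' rgo 0 0 = 0, s' rRS = s rRS & s' rPS = s rPS]
          else s' rgo = s rgo /\ forall i, (i < n)%N ->
            if (s rRS i 0 <= 0) && (0 < s rX i b) then
              s' rRS i 0 = s' rk 0 0 /\ s' rPS i 0 = b
            else s' rRS i 0 = s rRS i 0 /\ s' rPS i 0 = s rPS i 0]]) s.
Proof.
move=> dm feas [hU hV] hW f1 fH kH ex.
have hs i j : (i < n)%N -> (j < m)%N -> `|slack s i j| <= 3 * f.
  by move=> iN jm; have := hU i iN; have := hV j jm; have := hW i j iN jm;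
     rewrite /slack; lia.
apply/wp_seq/wp_set => //=.
set s1 := upd s _ _ _ _.
apply: wp_seq.
have slack1 i j : slack s1 i j = slack s i j by [].
have el1 i j : eligible s1 i j = eligible s i j by [].
apply: wp_conseq (find_minP nN NH (s := s1) _ _ _) _ => //.
  by move=> i j iN jm; rewrite slack1; have := hs i j iN jm; rewrite -/H; lia.
move=> s2 fr2 [a [b [[an bm elig] [e1 e2 e3 dmin]]]].
have k2 : s2 rk 0 0 = s rk 0 0 + 1 by rewrite fr2.
have {}fr2 : same_but (rk :: writes find_min) s s2.
  by move=> r; rewrite inE negb_or => /andP[h1 h2]; rewrite fr2 // /s1 upd_other.
have {}dmin i j : (i < n)%N -> (j < m)%N -> eligible s i j ->
    slack s a b <= slack s i j by apply: dmin.
rewrite slack1 in e3; have hd := hs _ _ an bm.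
apply: wp_seq; apply: wp_conseq (update_dualsP nN NH (s := s2) _ _ _) _.
- by rewrite /dims !fr2.
- by move=> i iN; rewrite e3 fr2 //= -/H; have := hU i iN; lia.
- by move=> j jm; rewrite e3 fr2 //= -/H; have := hV j jm; lia.
rewrite [s2 rU]fr2 // [s2 rVd]fr2 // [s2 rRS]fr2 // [s2 rRT]fr2 // e3.
move=> s3 fr3 [eU eV].
have bj3 : s3 rbj 0 0 = b by rewrite fr3.
have bi3 : s3 rbi 0 0 = a by rewrite fr3.
have k3 : s3 rk 0 0 = s rk 0 0 + 1 by rewrite fr3.
apply: wp_seq; rewrite /reach_sink; apply/wp_seq/wp_set => //=.
apply: wp_set => //=.
set s4 := upd _ _ _ _ _.
have bj4 : s4 rbj 0 0 = b by rewrite /s4 /= bj3.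
have eRT4 : forall j : nat, s4 rRT j 0 = if j == b then s rk 0 0 + 1 else s rRT j 0.
  move=> j; rewrite /s4 /= bj3 eqz_nat andbT k3.
  by case: eqP => // _; rewrite fr3 // fr2.
have ePT4 : forall j : nat, s4 rPT j 0 = if j == b then a%:Z else s rPT j 0.
  move=> j; rewrite /s4 /= bj3 eqz_nat andbT bi3.
  by case: eqP => // _; rewrite fr3 // fr2.
have fr4 : same_but [:: rk; rhas; ri; rj; rbd; rbi; rbj; rsl; rU; rVd; rRT; rPT] s s4.
  do 2 apply: same_but_upd => //.
  by apply: same_but_trans (same_but_sub fr2 _) fr3 _; apply/allP.
have eD : s4 rD b 0 = s rD b 0 by rewrite fr4.
have k4 : s4 rk 0 0 = s rk 0 0 + 1 by rewrite /s4 /= k3.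
have eU4 : s4 rU = s3 rU by apply/funext => i; apply/funext.
have eV4 : s4 rVd = s3 rVd by apply/funext => i; apply/funext.
apply: wp_if => //=; rewrite bj4 eD => hD.
  apply: wp_set => //=; exists a, b; split => //.
  rewrite hD; split => //; split => //.
  by move=> j; rewrite /= eRT4 k4.
  by split => //; rewrite upd_other // fr4.
apply: wp_conseq (reach_sourcesP nN NH (s := s4) _ bj4) _.
  by rewrite /dims !fr4.
move=> s5 fr5; have k5 : s5 rk 0 0 = s rk 0 0 + 1 by rewrite fr5.
rewrite [s4 rRS]fr4 // [s4 rX]fr4 // [s4 rPS]fr4 // k4 -k5.
move=> eRS.
exists a, b; split; first by split => //; rewrite fr5.
rewrite ltNge hD /=; split => //.
- by move=> i iN; rewrite fr5 // eU4 eU.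
- by move=> j jm; rewrite fr5 // eV4 eV.
split => //.
- by move=> j; rewrite k5 -eRT4 fr5.
- by move=> j; rewrite fr5.
by split; first by rewrite fr5 // fr4.
Qed.

End SearchLoop.

Section SearchCorrect.
Variables (lim : limits) (n m : nat).
Let N := max_iter lim.
Let H : int := 2 ^+ word_len lim.
Hypotheses (nN : (n + m + 3 <= N)%N) (NH : N%:Z < H).

Definition unreached (s : store) : nat := #|[pred j : 'I_m | s rRT j 0 <= 0]|.

Lemma unreached_step (s s' : store) (b : nat) : (b < m)%N -> s rRT b 0 <= 0 ->
  0 < s' rk 0 0 ->
  (forall j : nat, s' rRT j 0 = if j == b then s' rk 0 0 else s rRT j 0) ->
  unreached s = (unreached s').+1.
Proof.
move=> bm sb kpos e; rewrite /unreached (cardD1 (Ordinal bm)) inE /= sb add1n.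
congr _.+1; apply: eq_card => j; rewrite !inE e.
have -> : (j == Ordinal bm) = (j == b :> nat) by [].
by have [->|//] := eqVneq (j : nat) b; rewrite /= leNgt kpos.
Qed.

Definition target_found (s : store) : Prop := exists b : nat,
  [/\ (b < m)%N, s rbj 0 0 = b, 0 < s rRT b 0 & 0 < s rD b 0].

Lemma searchP s f : dims n m s -> dual_feasible n m s -> tight_flow n m s ->
  duals_within n m s f ->
  (forall i j, (i < n)%N -> (j < m)%N -> `|s rW i j| <= f) -> 1 <= f ->
  4 ^+ m * f < H ->
  (exists2 i : nat, (i < n)%N & 0 < s rE i 0) ->
  (exists2 j : nat, (j < m)%N & 0 < s rD j 0) ->
  wp lim search (fun s' =>
    [/\ dual_feasible n m s', tight_flow n m s' & duals_within n m s' (4 ^+ m * f)] /\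
    [/\ source_inv n m s', sink_inv n m s', s' rk 0 0 <= m.+1%:Z & target_found s']) s.
Proof.
move=> dm feas tight du hW f1 fH [i0 i0n Ei0] [j0 j0m Dj0].
apply: wp_seq; apply: wp_conseq (init_searchP nN NH dm) _ => s1 fr1 [eRS eRT ek ego].
pose w := [:: rRS; rRT; rPS; rPT; rk; rgo; rhas; ri; rj; rbd; rbi; rbj; rsl; rU; rVd].
have frw : same_but w s s1 by apply: same_but_sub fr1 _; apply/allP.
(* While the search runs, [c] counts the reached sinks; it gives the clock [c + 1] and the bound
   [4 ^+ c * f]. The measure is one more than the number of unreached sinks, and 0 once the target
   is found. *)
pose J k s2 := [/\ same_but w s s2, dual_feasible n m s2, tight_flow n m s2 &
  [/\ source_inv n m s2, sink_inv n m s2 &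
    [\/ exists c : nat, [/\ s2 rgo 0 0 = 1, closed_search n m s2,
          (c + unreached s2)%N = m, k = (unreached s2).+1 &
          duals_within n m s2 (4 ^+ c * f) /\ s2 rk 0 0 = c.+1%:Z]
      | [/\ s2 rgo 0 0 = 0, k = 0%N, duals_within n m s2 (4 ^+ m * f),
          s2 rk 0 0 <= m.+1%:Z & target_found s2]]]].
apply: (@wp_while _ J _ _ _ m.+1) => //=; first by lia.
- have u1 : unreached s1 = m.
    rewrite -[RHS]card_ord; apply: eq_card => j; rewrite !inE /=.
    by rewrite eRT.
  split => //.
  + by move=> i j iN jm; rewrite !fr1 //; apply: feas.
  + by move=> i j iN jm; rewrite !fr1 //; apply: tight.
  + split; last first.
    * left; exists 0%N; rewrite u1 expr0 mul1r; split => //.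
        by move=> j jm; rewrite eRT.
      by split => //; case: du => hU hV; split=> *; rewrite fr1 //; auto.
    * by move=> j jm; rewrite eRT // ek.
    * move=> i iN; rewrite eRS // ek [s1 rE]fr1 //.
      by case: ltP => h; split => //; left.
- move=> k s2 [fr2 feas2 tight2 [src2 snk2 [[c [ego2 cl2 cm ek2 [du2 k2]]]|[-> //]]]] _.
  have dm2 : dims n m s2 by rewrite /dims !fr2.
  have hp : (0 < 4 :> int) by [].
  (* The search cannot get stuck: the source [i0] with excess is reached, the sink [j0] with demand
     is not, and every pair is an edge. *)
  have el2 : exists i j, [/\ (i < n)%N, (j < m)%N & eligible s2 i j].
    exists i0, j0; split => //; split.
      by have [_ h _] := src2 i0 i0n; apply: h; rewrite fr2.
    by rewrite leNgt; apply/negP => /(cl2 _ j0m)[]; rewrite fr2 //; lia.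
  have c_lt : (c < m)%N.
    case: el2 => i [j [iN jm [_ hj]]]; rewrite -cm -addn1 leq_add2l.
    by apply/card_gt0P; exists (Ordinal jm); rewrite inE.
  have p1 : 1 <= 4 ^+ c :> int by rewrite exprn_ege1.
  have p2 : 4 * 4 ^+ c <= 4 ^+ m :> int by rewrite -exprS ler_eXn2l.
  have hW2 i j : (i < n)%N -> (j < m)%N -> `|s2 rW i j| <= 4 ^+ c * f.
    by move=> iN jm; rewrite fr2 //; apply: le_trans (hW _ _ iN jm) _; nia.
  have f1' : 1 <= 4 ^+ c * f by nia.
  have fH' : 4 * (4 ^+ c * f) < H by apply: le_lt_trans fH; nia.
  have kH : `|s2 rk 0 0 + 1| < H by rewrite k2; lia.
  apply: wp_conseq (search_stepP nN NH dm2 feas2 du2 hW2 f1' fH' kH el2) _.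
  move=> s3 fr3 [a [b [[an bm elab ebj] [dmin eU eV [eRT3 ePT3 ek3 branch]]]]].
  have fr : same_but w s s3.
    by apply: same_but_trans fr2 fr3 _; apply/allP.
  have [eX eW eE eD] : [/\ s3 rX = s2 rX, s3 rW = s2 rW, s3 rE = s2 rE & s3 rD = s2 rD].
    by rewrite !fr3.
  have feas3 : dual_feasible n m s3 by apply: (@step_feasible n m s2 s3 a b).
  have tight3 : tight_flow n m s3 by apply: (@step_tight n m s2 s3 a b).
  have du3 : duals_within n m s3 (4 * (4 ^+ c * f)).
    by apply: (@step_within n m s2 s3 a b).
  have k3 : s3 rk 0 0 = c.+2%:Z by rewrite ek3 k2; lia.
  have un : unreached s2 = (unreached s3).+1.
    by apply: unreached_step eRT3 => //; [case: elab|rewrite k3].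
  case: ifP branch => hD [].
    move=> ego3 eRS3 ePS3; exists 0%N; first by rewrite ek2.
    split => //; split.
    + by apply: (@step_source_stop n m s2 s3 a b).
    + by apply: (@step_sink n m s2 s3 a b) => // i _ _; rewrite eRS3.
    right; split => //.
    + case: du3 => hU hV; split=> [i iN|j jm].
        by apply: le_trans (hU i iN) _; nia.
      by apply: le_trans (hV j jm) _; nia.
    + by rewrite k3; lia.
    + by exists b; split => //; rewrite ?eRT3 ?eqxx ?k3 // eD.
  move=> ego3 eRS3; exists (unreached s3).+1; first by rewrite ek2 un.
  split => //; split.
  + by apply: (@step_source n m s2 s3 a b).
  + apply: (@step_sink n m s2 s3 a b) => // i iN hi.
    by have := eRS3 i iN; rewrite leNgt hi /= => -[].
  left; exists c.+1; split => //.
  + by rewrite ego3.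
  + by apply: (@step_closed n m s2 s3 a b) => //; rewrite leNgt hD.
  + by rewrite -cm un; lia.
  + by rewrite exprS -mulrA k3.
- move=> s2 [k [fr2 feas2 tight2 [src2 snk2 [[c [-> //]]|[_ _ du2 k2 tg]]]]] _.
  by [].
Qed.

End SearchCorrect.

(** A wrapper that keeps the arithmetic solvers from seeing different instances
    of the same iterated sum. *)
Definition psum (n : nat) (f : nat -> int) : int := \sum_(i < n) f i.

Lemma psum0 f : psum 0 f = 0. Proof. exact: big_ord0. Qed.

Lemma psumS n f : psum n.+1 f = psum n f + f n. Proof. exact: big_ord_recr. Qed.

Lemma eq_psum n f g : (forall i, (i < n)%N -> f i = g i) -> psum n f = psum n g.
Proof. by move=> e; apply: eq_bigr => i _; apply: e. Qed.

Lemma le_psum n f g : (forall i, (i < n)%N -> f i <= g i) -> psum n f <= psum n g.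
Proof. by move=> e; apply: ler_sum => i _; apply: e. Qed.

Lemma psumD n f g : psum n (fun i => f i + g i) = psum n f + psum n g.
Proof. exact: big_split. Qed.

Lemma psumB n f g : psum n (fun i => f i - g i) = psum n f - psum n g.
Proof. exact: sumrB. Qed.

Lemma psumZ n c f : psum n (fun i => c * f i) = c * psum n f.
Proof. by rewrite /psum mulr_sumr. Qed.

Lemma psum_ge0 n f : (forall i, (i < n)%N -> 0 <= f i) -> 0 <= psum n f.
Proof. by move=> pos; apply: sumr_ge0 => i _; apply: pos. Qed.

Lemma exchange_psum n m (f : nat -> nat -> int) :
  psum n (fun i => psum m (f i)) = psum m (fun j => psum n (f^~ j)).
Proof. exact: exchange_big. Qed.

Lemma psum_point (n k : nat) (f : nat -> int) (v : int) : (k < n)%N ->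
  psum n (fun i => if i == k then v else f i) = psum n f + (v - f k).
Proof.
elim: n => // n IH; rewrite ltnS leq_eqVlt !psumS => /orP[/eqP->|kn].
  rewrite eqxx (@eq_psum n _ f); first by lia.
  by move=> i iN; rewrite ifN // ltn_eqF.
by rewrite IH // ifN; [lia|rewrite gtn_eqF].
Qed.

Lemma psum_le_prefix (n k : nat) (f : nat -> int) : (k <= n)%N ->
  (forall i, (i < n)%N -> 0 <= f i) -> psum k f <= psum n f.
Proof.
elim: n => [|n IH]; first by rewrite leqn0 => /eqP->.
rewrite leq_eqVlt => /orP[/eqP->//|kn] pos; rewrite psumS.
have := pos n (leqnn _); have := IH kn (fun i iN => pos i (ltnW iN)); lia.
Qed.

Lemma psum_ge (n k : nat) f : (forall i, (i < n)%N -> 0 <= f i) ->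
  (k < n)%N -> f k <= psum n f.
Proof.
move=> pos kn; apply: le_trans (psum_le_prefix kn pos); rewrite psumS.
by rewrite lerDr psum_ge0 // => i ik; apply: pos; lia.
Qed.

Definition row_sum (m : nat) (s : store) (r i : nat) : int :=
  psum m (fun j => s r i j).
Definition col_sum (n : nat) (s : store) (r j : nat) : int :=
  psum n (fun i => s r i j).

Lemma row_sum_upd m s r (i k c : nat) v : (c < m)%N ->
  row_sum m (upd s r i c v) r k =
  row_sum m s r k + (if k == i then v - s r i c else 0).
Proof.
move=> cm; rewrite /row_sum /= eqxx /= eqz_nat; have [->|ne] := eqVneq k i.
  by rewrite -(psum_point (fun j => s r i j)).
by rewrite addr0.
Qed.

Lemma col_sum_upd n s r (i k c : nat) v : (i < n)%N ->
  col_sum n (upd s r i c v) r k =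
  col_sum n s r k + (if k == c then v - s r i c else 0).
Proof.
move=> iN; rewrite /col_sum /= eqxx /=; have [->|ne] := eqVneq k c.
  rewrite -(psum_point (fun i => s r i c)) //.
  by apply: eq_psum => l _; rewrite eqxx andbT.
by rewrite addr0; apply: eq_psum => l _; rewrite !eqz_nat (negPf ne) andbF.
Qed.

Lemma row_sum_ge m (s : store) r (i j : nat) :
  (forall j, (j < m)%N -> 0 <= s r i j) -> (j < m)%N -> s r i j <= row_sum m s r i.
Proof. by move=> pos jm; apply: (@psum_ge m j (fun j => s r i j)). Qed.

(** * Augmentation along the chain of predecessors *)

Definition augment_step : acmd :=
  (S0 rci (G1 rPT (V rcur)) ;;
   ASet rX (V rci) (V rcur) (AGet rX (V rci) (V rcur) + ANum 1) ;;
   AIf (G1 rE (V rci))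
     (S1 rE (V rci) (G1 rE (V rci) - ANum 1) ;;
      S0 rET (V rET - ANum 1) ;; S0 rgo (ANum 0))
     (S0 rcur (G1 rPS (V rci)) ;;
      ASet rX (V rci) (V rcur) (AGet rX (V rci) (V rcur) - ANum 1)))%P.

Definition augment : acmd :=
  (S1 rD (V rbj) (G1 rD (V rbj) - ANum 1) ;; S0 rDT (V rDT - ANum 1) ;;
   S0 rcur (V rbj) ;; S0 rgo (ANum 1) ;; AWhile (V rgo) augment_step)%P.

Section Augment.
Variables (lim : limits) (n m : nat).
Let N := max_iter lim.
Let H : int := 2 ^+ word_len lim.
Hypotheses (nN : (n + m + 3 <= N)%N) (NH : N%:Z < H).

(** The walk back from the target keeps all row sums and moves one unit of
    missing column sum from the target to the current sink. *)
Lemma augmentP s : tight_flow n m s -> source_inv n m s -> sink_inv n m s ->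
  s rk 0 0 <= m.+1%:Z -> target_found m s ->
  (forall i, (i < n)%N -> row_sum m s rX i + 1 < H /\ `|s rE i 0| + 1 < H) ->
  (forall j, (j < m)%N -> `|s rD j 0| + 1 < H) ->
  `|s rET 0 0| + 1 < H -> `|s rDT 0 0| + 1 < H ->
  wp lim augment (fun s' => tight_flow n m s' /\ exists a b : nat,
    [/\ (a < n)%N, (b < m)%N, 0 < s rE a 0 & 0 < s rD b 0] /\
    [/\ forall i, (i < n)%N -> s' rE i 0 = s rE i 0 - (i == a)%:Z,
        forall j, (j < m)%N -> s' rD j 0 = s rD j 0 - (j == b)%:Z,
        s' rET 0 0 = s rET 0 0 - 1, s' rDT 0 0 = s rDT 0 0 - 1 &
        (forall i, (i < n)%N -> row_sum m s' rX i = row_sum m s rX i + (i == a)%:Z) /\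
        (forall j, (j < m)%N -> col_sum n s' rX j = col_sum n s rX j + (j == b)%:Z)]) s.
Proof.
move=> tight src snk rkm [b [bm ebj RTb Db]] hE hD hET hDT.
apply/wp_seq/wp_set => //=; rewrite ebj.
  by have := hD b bm; rewrite -/H; lia.
apply/wp_seq/wp_set => //=; first by rewrite -/H; lia.
apply/wp_seq/wp_set => //=; apply/wp_seq/wp_set => //=; rewrite ebj.
pose w := [:: rX; rE; rET; rD; rDT; rcur; rci; rgo].
(* The measure is the time at which the current sink was reached, which decreases along the walk.
   The last clause says that sources reached before that time still have the flow on their
   predecessor edge, so that a unit can be taken off it later. *)
pose J k s1 := [/\ same_but w s s1, tight_flow n m s1,
  (forall j, (j < m)%N -> s1 rD j 0 = s rD j 0 - (j == b)%:Z) /\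
    s1 rDT 0 0 = s rDT 0 0 - 1 &
  [\/ exists c : nat, [/\ (c < m)%N, s1 rgo 0 0 = 1, s1 rcur 0 0 = c, 0 < s rRT c 0 &
        [/\ k = `|s rRT c 0|.+1, s1 rE = s rE /\ s1 rET = s rET,
          forall i, (i < n)%N -> row_sum m s1 rX i = row_sum m s rX i,
          forall j, (j < m)%N -> col_sum n s1 rX j =
             col_sum n s rX j + (j == b)%:Z - (j == c)%:Z
        & forall i, (i < n)%N -> 0 < s rRS i 0 -> s rRS i 0 < s rRT c 0 ->
             s rE i 0 <= 0 -> 0 < s1 rX i (s rPS i 0)]]
    | s1 rgo 0 0 = 0 /\ k = 0%N /\ exists a : nat, [/\ (a < n)%N, 0 < s rE a 0,
        forall i, (i < n)%N -> s1 rE i 0 = s rE i 0 - (i == a)%:Z,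
        s1 rET 0 0 = s rET 0 0 - 1 &
        (forall i, (i < n)%N -> row_sum m s1 rX i = row_sum m s rX i + (i == a)%:Z) /\
        (forall j, (j < m)%N -> col_sum n s1 rX j = col_sum n s rX j + (j == b)%:Z)]]].
have RTm j : (j < m)%N -> s rRT j 0 <= m.+1%:Z.
  by move=> jm; have [] := snk j jm; lia.
apply: (@wp_while _ J _ _ _ (`|s rRT b 0|.+1)) => //=.
- by have := RTm b bm; lia.
- split => //.
  + by do 4 apply: same_but_upd => //.
  + split => // j jm /=; rewrite eqz_nat andbT.
    by have [->|ne] := eqVneq j b => //=; lia.
  + left; exists b; split => //; split => //.
    * by move=> j jm; rewrite -[col_sum n (upd _ _ _ _ _) _ _]/(col_sum n s rX j); lia.
    * move=> i iN RSi _ nE; have [_ _ /(_ RSi)[|]] := src i iN; first by lia.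
      by case=> j jm [-> _ _].
- move=> k s1 [fr1 tight1 [hD1 hDT1]
     [[c [cm ego ecur RTc [ek [eE eET] rows cols posX]]]|[-> //]]] _.
  have [_ /(_ RTc)[i iN [ePT RSi RSlt dual_ic]]] := snk c cm.
  have row1 : row_sum m s1 rX i + 1 < H by rewrite rows //; case: (hE i iN).
  have x1 : s1 rX i c <= row_sum m s1 rX i.
    by apply: row_sum_ge => // j jm; case: (tight1 i j iN jm).
  have [x1_ge0 _] := tight1 i c iN cm.
  have s1PT : s1 rPT c 0 = i by rewrite fr1.
  apply/wp_seq/wp_set => //=; rewrite ecur s1PT.
  apply/wp_seq/wp_set => //=; rewrite ecur; first by rewrite -/H; lia.
  set s2 := upd _ rX _ _ _.
  have tight2 : tight_flow n m s2.
    move=> i' j' iN' jm'; rewrite /s2 /= !eqz_nat.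
    case: andP => [[/eqP-> /eqP->]|_]; last exact: tight1.
    by split=> [|_]; [lia|rewrite !fr1].
  have row2 i' : row_sum m s2 rX i' = row_sum m s1 rX i' + (i' == i)%:Z.
    rewrite /s2 row_sum_upd // -[row_sum m (upd _ _ _ _ _) _ _]/(row_sum m s1 rX i') /=.
    by case: (i' == i) => /=; lia.
  have col2 j' : col_sum n s2 rX j' = col_sum n s1 rX j' + (j' == c)%:Z.
    rewrite /s2 col_sum_upd // -[col_sum n (upd _ _ _ _ _) _ _]/(col_sum n s1 rX j') /=.
    by case: (j' == c) => /=; lia.
  have fr2 : same_but w s s2 by do 2 apply: same_but_upd => //.
  have ci2 : s2 rci 0 0 = i by [].
  have E2 : s2 rE = s rE by rewrite /s2 !upd_other.
  have ET2 : s2 rET = s rET by rewrite /s2 !upd_other.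
  apply: wp_if => //=; rewrite ci2 E2 => hEi.
    apply/wp_seq/wp_set => //=.
      by rewrite ?ci2 ?E2 -/H; have [_ h] := hE i iN; lia.
    apply/wp_seq/wp_set => //=; first by rewrite ?ET2 -/H; lia.
    apply: wp_set => //=; exists 0%N; first by rewrite ek.
    split => //; first by do 3 apply: same_but_upd => //.
    right; split => //; split => //; exists i; split => //.
    + move=> i' iN' /=; rewrite ?ci2 eqz_nat andbT ?E2.
      by have [->|ne] := eqVneq i' i => //=; lia.
    + by rewrite /= ?ET2.
    split=> [i' iN'|j' jm'].
      by rewrite -rows // -row2.
    by rewrite -[col_sum n (upd _ _ _ _ _) _ _]/(col_sum n s2 rX j') col2 cols //; lia.
  have [_ _ /(_ RSi)[|[c' cm' [ePS RTc' eRT Xic]]]] := src i iN; first by lia.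
  have cc' : c' != c by apply: contraTneq RSlt => <-; rewrite eRT ltxx.
  have pos' : 0 < s1 rX i c'.
    by rewrite -ePS; apply: posX.
  have x1' : s1 rX i c' <= row_sum m s1 rX i.
    by apply: row_sum_ge => // j jm; case: (tight1 i j iN jm).
  have s2PS : s2 rPS i 0 = c' by rewrite fr2.
  apply/wp_seq/wp_set => //=; rewrite s2PS.
  set s3 := upd s2 rcur 0 0 c'.
  have e23 : s2 rX i c' = s1 rX i c'.
    by rewrite /s2 /= !eqz_nat (negPf cc') andbF.
  have ci3 : s3 rci 0 0 = i by [].
  have cur3 : s3 rcur 0 0 = c' by [].
  have e33 : s3 rX i c' = s1 rX i c' := e23.
  apply: wp_set => //=; rewrite ci3 cur3 e33; first by rewrite -/H; lia.
  set s4 := upd _ rX _ _ _.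
  have row4 i' : row_sum m s4 rX i' = row_sum m s1 rX i'.
    rewrite /s4 row_sum_upd // -[row_sum m s3 rX i']/(row_sum m s2 rX i') row2.
    by rewrite e33; case: eqP => _ /=; lia.
  have col4 j' : col_sum n s4 rX j' = col_sum n s1 rX j' + (j' == c)%:Z - (j' == c')%:Z.
    rewrite /s4 col_sum_upd // -[col_sum n s3 rX j']/(col_sum n s2 rX j') col2.
    by rewrite e33; case: (j' == c') => /=; lia.
  have X4 i' (z : int) : i' != i -> s4 rX i' z = s1 rX i' z.
    by move=> ne; rewrite /s4 /s3 /s2 /= !eqz_nat (negPf ne).
  exists (`|s rRT c' 0|.+1); first by rewrite ek; lia.
  split => //.
  + by do 2 apply: same_but_upd => //.
  + move=> i' j' iN' jm'; rewrite /s4 /= !eqz_nat.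
    case: andP => [[/eqP-> /eqP->]|_]; last exact: tight2.
    by split=> [|_]; [lia|case: (tight1 i c' iN cm') => _ /(_ pos')].
  left; exists c'; split => //; split => //.
  + by move=> i' iN'; rewrite row4 rows.
  + by move=> j' jm'; rewrite col4 cols //; lia.
  move=> i' iN' RSi' lt' nE'; rewrite X4; last first.
    by apply: contraTneq lt' => ->; rewrite eRT ltxx.
  by apply: posX => //; lia.
move=> s1 [k [fr1 tight1 [hD1 hDT1] [[c [cm -> //]]|[_ [_ [a [an Ea hE1 hET1 [rows cols]]]]]]]] _.
by split => //; exists a, b.
Qed.

End Augment.

(** * Capacity scaling *)

Notation rtot := 30%N.

(** Flow is counted in units of the scale. When the scale is halved, doubling the numbers keeps the
    actual flow, and the excesses are recomputed from the finer quotients. *)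
Definition double_rows : acmd :=
  (S0 rET (ANum 0) ;;
   AFor ri rn
     (S1 rE (V ri) (G1 rA (V ri) / V rp) ;;
      AFor rj rm
        (ASet rX (V ri) (V rj) (AGet rX (V ri) (V rj) + AGet rX (V ri) (V rj)) ;;
         S1 rE (V ri) (G1 rE (V ri) - AGet rX (V ri) (V rj))) ;;
      S0 rET (V rET + G1 rE (V ri))))%P.

Definition reset_cols : acmd :=
  (S0 rDT (ANum 0) ;;
   AFor rj rm
     (S1 rD (V rj) (G1 rB (V rj) / V rp) ;;
      AFor ri rn (S1 rD (V rj) (G1 rD (V rj) - AGet rX (V ri) (V rj))) ;;
      S0 rDT (V rDT + G1 rD (V rj))))%P.

Lemma divz_le_self (a p : int) : 0 <= a -> 0 < p -> (a %/ p)%Z <= a.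
Proof. by move=> a0 p0; have := lez_div a p; have := divz_ge0 a p0; lia. Qed.

Section Doubling.
Variables (lim : limits) (n m : nat).
Let N := max_iter lim.
Let H : int := 2 ^+ word_len lim.
Hypotheses (nN : (n + m + 3 <= N)%N) (NH : N%:Z < H).

Lemma double_rowsP s (p : int) : dims n m s -> s rp 0 0 = p -> 0 < p ->
  (forall i j, (i < n)%N -> (j < m)%N -> 0 <= s rX i j) ->
  (forall i, (i < n)%N -> 0 < s rA i 0) ->
  (forall i, (i < n)%N -> 2 * row_sum m s rX i <= (s rA i 0 %/ p)%Z) ->
  psum n (fun i => s rA i 0) < H ->
  wp lim double_rows (fun s' =>
    [/\ forall i j, (i < n)%N -> (j < m)%N -> s' rX i j = 2 * s rX i j,
        forall i, (i < n)%N -> s' rE i 0 = (s rA i 0 %/ p)%Z - 2 * row_sum m s rX i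
      & s' rET 0 0 = psum n (fun i => s' rE i 0)]) s.
Proof.
move=> dm sp p0 X0 A0 hrow hA.
have quoA i : (i < n)%N -> (s rA i 0 %/ p)%Z <= s rA i 0.
  by move=> iN; apply: divz_le_self => //; apply/ltW/A0.
have A_lt i : (i < n)%N -> s rA i 0 < H.
  move=> iN; apply: le_lt_trans hA; apply: (@psum_ge n i (fun i => s rA i 0)) => //.
  by move=> k kn; apply/ltW/A0.
pose e (i : nat) := (s rA i 0 %/ p)%Z - 2 * row_sum m s rX i.
have e_ge0 i : (i < n)%N -> 0 <= e i by move=> iN; rewrite /e subr_ge0 hrow.
have row_ge0 i : (i < n)%N -> 0 <= row_sum m s rX i.
  by move=> iN; apply: psum_ge0 => j jm; apply: X0.
have sum_e : psum n e < H.
  apply: le_lt_trans hA; apply: le_psum => i iN; rewrite /e.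
  by have := quoA i iN; have := row_ge0 i iN; lia.
have sum_ek k : (k <= n)%N -> 0 <= psum k e <= psum n e.
  move=> kn; rewrite psum_le_prefix // andbT psum_ge0 // => i ik.
  by apply: e_ge0; apply: leq_trans kn.
apply/wp_seq/wp_set => //=.
apply: (@wp_for _ n (fun k s1 =>
  [/\ forall i j, (i < n)%N -> (j < m)%N ->
        s1 rX i j = if (i < k)%N then 2 * s rX i j else s rX i j,
      forall i, (i < k)%N -> s1 rE i 0 = e i
    & s1 rET 0 0 = psum k e])) => //=; try lia.
- by case: dm.
- by split => //; rewrite psum0.
- move=> k s1 kn fr1 s1i [X1 E1 ET1].
  have A1 : s1 rA k 0 = s rA k 0 by rewrite fr1.
  have p1 : s1 rp 0 0 = p by rewrite fr1.
  have hd : 0 <= (s rA k 0 %/ p)%Z < H.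
    by rewrite divz_ge0 // (ltW (A0 k kn)) (le_lt_trans (quoA k kn) (A_lt k kn)).
  have X1k j : (j < m)%N -> s1 rX k j = s rX k j by move=> jm; rewrite X1 // ltnn.
  have pre l : (l <= m)%N -> 0 <= psum l (fun j => s rX k j) <= row_sum m s rX k.
    move=> lm; rewrite /row_sum (@psum_le_prefix _ _ (fun j => s rX k j)) //.
      rewrite andbT psum_ge0 // => j jl; apply: X0 => //.
      exact: leq_trans jl lm.
    by move=> j jm; apply: X0.
  have [q qE] : exists q, (s rA k 0 %/ p)%Z = q by eexists.
  rewrite qE in hd.
  apply/wp_seq/wp_set => //=; rewrite s1i A1 p1 qE; first by rewrite -/H; lia.
  apply: wp_seq; apply: (@wp_for _ m (fun l s2 =>
    [/\ forall i j, (i < n)%N -> (j < m)%N ->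
          s2 rX i j = if (i == k) && (j < l)%N then 2 * s rX k j else s1 rX i j,
        forall i, (i < k)%N -> s2 rE i 0 = s1 rE i 0
      & s2 rE k 0 = q - 2 * psum l (fun j => s rX k j)])) => //=; try lia.
  + by rewrite fr1 //; case: dm.
  + split => //.
    * by move=> i j iN jm; rewrite andbF.
    * by move=> i ik; rewrite eqz_nat ifN // andbT; lia.
    * by rewrite eqxx psum0 mulr0 subr0.
  + move=> l s2 lm fr2 s2j [X2 E2 Ek2].
    have s2i : s2 ri 0 0 = k by rewrite fr2.
    have Xkl : s2 rX k l = s rX k l by rewrite X2 // eqxx ltnn X1k.
    have hs := pre l.+1 lm; rewrite psumS /= in hs.
    have hs' := pre l (ltnW lm); have rowk := hrow k kn; rewrite qE in rowk;
    have Xkl0 := X0 k l kn lm.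
    apply/wp_seq/wp_set => //=; rewrite s2i s2j Xkl; first by rewrite -/H; lia.
    apply: wp_set => //=; rewrite s2i s2j !eqxx /= Ek2; first by rewrite -/H; lia.
    split=> [i j iN jm|i ik|].
    * rewrite !eqz_nat X2 // ltS_eqVlt; have [->|//] := eqVneq i k.
      by have [->|//] := eqVneq j l => /=; lia.
    * by rewrite eqz_nat ifN ?E2 // andbT; lia.
    * by rewrite psumS; lia.
  move=> s2 fr2 _ [X2 E2 Ek2].
  have s2i : s2 ri 0 0 = k by rewrite fr2.
  have ET2 : s2 rET 0 0 = psum k e by rewrite fr2 //= ET1.
  have h1 := sum_ek k.+1 kn; have h2 := sum_ek k (ltnW kn).
  rewrite psumS in h1.
  have ek : s2 rE k 0 = e k by rewrite Ek2 -qE.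
  apply: wp_set => //=; rewrite s2i ek ET2; first by rewrite -/H; lia.
  split=> [i j iN jm|i|].
  + rewrite X2 // X1 // ltS_eqVlt; have [->|//] := eqVneq i k.
    by rewrite jm.
  + by rewrite ltS_eqVlt; have [->|_ /= ik] := eqVneq i k; rewrite // E2 // E1.
  + by rewrite psumS.
move=> s1 fr1 _ [X1 E1 ET1]; split => // [i j iN jm|].
  by rewrite X1 // iN.
by rewrite ET1; apply: eq_psum => i iN; rewrite E1.
Qed.

Lemma reset_colsP s (p : int) : dims n m s -> s rp 0 0 = p -> 0 < p ->
  (forall i j, (i < n)%N -> (j < m)%N -> 0 <= s rX i j) ->
  (forall j, (j < m)%N -> 0 < s rB j 0) ->
  (forall j, (j < m)%N -> col_sum n s rX j <= (s rB j 0 %/ p)%Z) ->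
  psum m (fun j => s rB j 0) < H ->
  wp lim reset_cols (fun s' =>
    (forall j, (j < m)%N -> s' rD j 0 = (s rB j 0 %/ p)%Z - col_sum n s rX j) /\
    s' rDT 0 0 = psum m (fun j => s' rD j 0)) s.
Proof.
move=> dm sp p0 X0 B0 hcol hB.
have quoB j : (j < m)%N -> (s rB j 0 %/ p)%Z <= s rB j 0.
  by move=> jm; apply: divz_le_self => //; apply/ltW/B0.
have B_lt j : (j < m)%N -> s rB j 0 < H.
  move=> jm; apply: le_lt_trans hB; apply: (@psum_ge m j (fun j => s rB j 0)) => //.
  by move=> k km; apply/ltW/B0.
pose e (j : nat) := (s rB j 0 %/ p)%Z - col_sum n s rX j.
have e_ge0 j : (j < m)%N -> 0 <= e j by move=> jm; rewrite /e subr_ge0 hcol.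
have col_ge0 j : (j < m)%N -> 0 <= col_sum n s rX j.
  by move=> jm; apply: psum_ge0 => i iN; apply: X0.
have sum_e : psum m e < H.
  apply: le_lt_trans hB; apply: le_psum => j jm; rewrite /e.
  by have := quoB j jm; have := col_ge0 j jm; lia.
have sum_ek k : (k <= m)%N -> 0 <= psum k e <= psum m e.
  move=> km; rewrite psum_le_prefix // andbT psum_ge0 // => j jk.
  by apply: e_ge0; apply: leq_trans km.
apply/wp_seq/wp_set => //=.
apply: (@wp_for _ m (fun k s1 =>
  (forall j, (j < k)%N -> s1 rD j 0 = e j) /\
  s1 rDT 0 0 = psum k e)) => //=; try lia.
- by case: dm.
- by split => //; rewrite psum0.
- move=> k s1 km fr1 s1j [D1 DT1].
  have B1 : s1 rB k 0 = s rB k 0 by rewrite fr1.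
  have p1 : s1 rp 0 0 = p by rewrite fr1.
  have hd : 0 <= (s rB k 0 %/ p)%Z < H.
    by rewrite divz_ge0 // (ltW (B0 k km)) (le_lt_trans (quoB k km) (B_lt k km)).
  have pre l : (l <= n)%N -> 0 <= psum l (fun i => s rX i k) <= col_sum n s rX k.
    move=> ln; rewrite /col_sum (@psum_le_prefix _ _ (fun i => s rX i k)) //.
      rewrite andbT psum_ge0 // => i il; apply: X0 => //.
      exact: leq_trans il ln.
    by move=> i iN; apply: X0.
  have [q qE] : exists q, (s rB k 0 %/ p)%Z = q by eexists.
  rewrite qE in hd.
  apply/wp_seq/wp_set => //=; rewrite s1j B1 p1 qE; first by rewrite -/H; lia.
  apply: wp_seq; apply: (@wp_for _ n (fun l s2 =>
    (forall j, (j < k)%N -> s2 rD j 0 = s1 rD j 0) /\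
    s2 rD k 0 = q - psum l (fun i => s rX i k))) => //=; try lia.
  + by rewrite fr1 //; case: dm.
  + split=> [j jk|]; first by rewrite eqz_nat ifN // andbT; lia.
    by rewrite eqxx psum0 subr0.
  + move=> l s2 ln fr2 s2i [D2 Dk2].
    have s2j : s2 rj 0 0 = k by rewrite fr2.
    have Xlk : s2 rX l k = s rX l k by rewrite fr2 //= fr1.
    have hs := pre l.+1 ln; rewrite psumS /= in hs.
    have hs' := pre l (ltnW ln); have colk := hcol k km; rewrite qE in colk;
    have Xlk0 := X0 l k ln km.
    apply: wp_set => //=; rewrite s2i s2j Xlk Dk2; first by rewrite -/H; lia.
    split=> [j jk|]; first by rewrite eqz_nat ifN ?D2 // andbT; lia.
    by rewrite eqxx psumS /=; lia.
  move=> s2 fr2 _ [D2 Dk2].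
  have s2j : s2 rj 0 0 = k by rewrite fr2.
  have DT2 : s2 rDT 0 0 = psum k e by rewrite fr2 //= DT1.
  have h1 := sum_ek k.+1 km; have h2 := sum_ek k (ltnW km).
  rewrite psumS in h1.
  have ek : s2 rD k 0 = e k by rewrite Dk2 -qE.
  apply: wp_set => //=; rewrite s2j ek DT2; first by rewrite -/H; lia.
  split=> [j|]; last by rewrite psumS.
  by rewrite ltS_eqVlt; have [->|_ /= jk] := eqVneq j k; rewrite // D2 // D1.
move=> s1 fr1 _ [D1 DT1]; split => //.
by rewrite DT1; apply: eq_psum => j jm; rewrite D1.
Qed.

End Doubling.

(** Supplies and demands rounded to a coarse scale need not balance, so a phase ends as soon as one
    of the two remaining totals is 0; hence the product in the test. *)
Definition phase : acmd :=
  (S0 rp (V rp / ANum 2) ;; double_rows ;; reset_cols ;;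
   AWhile (V rET * V rDT) (search ;; augment))%P.

Lemma psum_gt0_ex n f : 0 < psum n f -> exists2 i : nat, (i < n)%N & 0 < f i.
Proof.
elim: n => [|n IH]; rewrite ?psum0 // psumS => h.
have [fn|fn] := ltP 0 (f n); first by exists n.
have [|i iN fi] := IH; first by lia.
by exists i => //; apply: ltnW.
Qed.

Lemma psum_delta n a : (a < n)%N -> psum n (fun i => (i == a)%:Z) = 1.
Proof.
move=> an; rewrite (@eq_psum _ _ (fun i => if i == a then 1 else 0)).
  by rewrite (psum_point (fun=> 0)) // (@eq_psum _ _ (fun i => 0 * 0)) ?psumZ //; lia.
by move=> i _; case: eqP.
Qed.

Lemma psum_const n c : psum n (fun=> c) = n%:Z * c.
Proof. by elim: n => [|n IH]; rewrite ?psum0 ?mul0r // psumS IH; lia. Qed.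

Lemma div_double (a p : int) : 0 < p ->
  2 * (a %/ (2 * p))%Z <= (a %/ p)%Z <= 2 * (a %/ (2 * p))%Z + 1.
Proof. by move=> p0; rewrite [2 * p]mulrC divzMA_ge0 ?(ltW p0) //; move: (a %/ p)%Z => q; lia. Qed.

Section Phases.
Variables (lim : limits) (n m : nat).
Let N := max_iter lim.
Let H : int := 2 ^+ word_len lim.
Hypotheses (nN : (n + m + 3 <= N)%N) (NH : N%:Z < H).

(** A partial flow for the data rounded down to multiples of [p], in units of [p]; [rE] and [rD]
    hold what is still to be shipped and received. *)
Definition flow_state (p : int) (s : store) : Prop :=
  [/\ forall i, (i < n)%N -> 0 <= s rE i 0 /\
        row_sum m s rX i + s rE i 0 = (s rA i 0 %/ p)%Z,
      forall j, (j < m)%N -> 0 <= s rD j 0 /\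
        col_sum n s rX j + s rD j 0 = (s rB j 0 %/ p)%Z,
      s rET 0 0 = psum n (fun i => s rE i 0) /\
      s rDT 0 0 = psum m (fun j => s rD j 0)
    & dual_feasible n m s /\ tight_flow n m s].

Definition valid_input (tot : int) (s : store) : Prop :=
  [/\ dims n m s, forall i, (i < n)%N -> 0 < s rA i 0,
      forall j, (j < m)%N -> 0 < s rB j 0,
      psum n (fun i => s rA i 0) = tot & psum m (fun j => s rB j 0) = tot].

Lemma flow_state_bounds p tot s : 0 < p -> valid_input tot s -> flow_state p s ->
  [/\ forall i, (i < n)%N -> 0 <= row_sum m s rX i <= tot /\ 0 <= s rE i 0 <= tot,
      forall j, (j < m)%N -> 0 <= s rD j 0 <= tot,
      0 <= s rET 0 0 <= tot & 0 <= s rDT 0 0 <= tot].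
Proof.
move=> p0 [dm A0 B0 totA totB] [rows cols [ET DT] [_ tight]].
have row0 i : (i < n)%N -> 0 <= row_sum m s rX i.
  by move=> iN; apply: psum_ge0 => j jm; case: (tight i j iN jm).
have col0 j : (j < m)%N -> 0 <= col_sum n s rX j.
  by move=> jm; apply: psum_ge0 => i iN; case: (tight i j iN jm).
have E_le i : (i < n)%N -> s rE i 0 + row_sum m s rX i <= s rA i 0.
  move=> iN; have [_ h] := rows i iN; have := divz_le_self (ltW (A0 i iN)) p0.
  by move: h; move: (_ %/ _)%Z; lia.
have D_le j : (j < m)%N -> s rD j 0 + col_sum n s rX j <= s rB j 0.
  move=> jm; have [_ h] := cols j jm; have := divz_le_self (ltW (B0 j jm)) p0.
  by move: h; move: (_ %/ _)%Z; lia.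
split.
- move=> i iN; have := E_le i iN; have := row0 i iN; have [h _] := rows i iN.
  have : s rA i 0 <= psum n (fun i => s rA i 0).
    by apply: (@psum_ge n i (fun i => s rA i 0)) => // k kn; apply/ltW/A0.
  by lia.
- move=> j jm; have := D_le j jm; have := col0 j jm; have [h _] := cols j jm.
  have : s rB j 0 <= psum m (fun j => s rB j 0).
    by apply: (@psum_ge m j (fun j => s rB j 0)) => // k kn; apply/ltW/B0.
  by lia.
- rewrite ET psum_ge0 => [|i iN]; last by case: (rows i iN).
  by rewrite -totA le_psum // => i iN; have := E_le i iN; have := row0 i iN; lia.
- rewrite DT psum_ge0 => [|j jm]; last by case: (cols j jm).
  by rewrite -totB le_psum // => j jm; have := D_le j jm; have := col0 j jm; lia.
Qed.

Lemma valid_input_ext tot s s' w : valid_input tot s -> same_but w s s' ->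
  [&& rn \notin w, rm \notin w, rA \notin w & rB \notin w] -> valid_input tot s'.
Proof.
move=> [[h1 h2] h3 h4 h5 h6] fr /and4P[w1 w2 w3 w4].
by split; rewrite /dims ?fr // => i iN; rewrite ?fr; auto.
Qed.

Let flow_regs := [:: rX; rU; rVd; rE; rD; rET; rDT; rp; rRS; rRT; rPS; rPT; rk;
   rbi; rbj; rbd; rhas; ri; rj; rsl; rgo; rcur; rci].

(** Each augmentation lowers both remaining totals by 1, so a bound [k0] on either of them bounds
    the number of searches. *)
Lemma augment_loopP s p tot f (k0 : nat) :
  0 < p -> valid_input tot s -> flow_state p s -> tot + 1 < H -> (k0 <= N)%N ->
  duals_within n m s f -> (forall i j, (i < n)%N -> (j < m)%N -> `|s rW i j| <= f) ->
  1 <= f -> 4 ^+ (m * k0) * f < H ->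
  s rET 0 0 <= k0%:Z \/ s rDT 0 0 <= k0%:Z ->
  wp lim (AWhile (V rET * V rDT)%P (search ;; augment)%P) (fun s' =>
    [/\ flow_state p s', duals_within n m s' (4 ^+ (m * k0) * f)
      & s' rET 0 0 * s' rDT 0 0 <= 0]) s.
Proof.
move=> p0 val st totH k0N du hW f1 fH le_k0.
pose J k s1 := [/\ same_but flow_regs s s1, flow_state p s1,
  s1 rET 0 0 <= k%:Z \/ s1 rDT 0 0 <= k%:Z
  & exists t : nat, (t + k)%N = k0 /\ duals_within n m s1 (4 ^+ (m * t) * f)].
apply: (@wp_while _ J _ _ _ k0) => //=.
- by split => //; exists 0%N; rewrite muln0 expr0 mul1r.
- move=> k s1 [fr1 st1 le_k [t [tk du1]]] pos.
  have val1 : valid_input tot s1 by apply: valid_input_ext fr1 _.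
  have [bE bD bET bDT] := flow_state_bounds p0 val1 st1.
  have [rows cols [ET DT] [feas tight]] := st1.
  have ETpos : 0 < s1 rET 0 0 by nia.
  have DTpos : 0 < s1 rDT 0 0 by nia.
  have k_pos : (0 < k)%N by case: le_k; lia.
  have exE : exists2 i : nat, (i < n)%N & 0 < s1 rE i 0.
    by apply: psum_gt0_ex; rewrite -ET.
  have exD : exists2 j : nat, (j < m)%N & 0 < s1 rD j 0.
    by apply: psum_gt0_ex; rewrite -DT.
  have p1 : 1 <= 4 ^+ (m * t) :> int by rewrite exprn_ege1.
  have p2 : 4 ^+ m * 4 ^+ (m * t) <= 4 ^+ (m * k0) :> int.
    by rewrite -exprD -mulnS ler_weXn2l // leq_mul2l; apply/orP; right; lia.
  have fH1 : 4 ^+ m * (4 ^+ (m * t) * f) < H.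
    by rewrite mulrA; apply: le_lt_trans fH; rewrite ler_wpM2r //; lia.
  have dm1 : dims n m s1 by case: val1.
  have hW1 i j : (i < n)%N -> (j < m)%N -> `|s1 rW i j| <= 4 ^+ (m * t) * f.
    by move=> iN jm; rewrite fr1 //; apply: le_trans (hW i j iN jm) _; nia.
  have f1' : 1 <= 4 ^+ (m * t) * f by nia.
  apply: wp_seq; apply: wp_conseq (searchP nN NH dm1 feas tight du1 hW1 f1' fH1 exE exD) _.
  move=> s2 fr2 [[feas2 tight2 du2] [src2 snk2 k2 tg2]].
  have fr02 : same_but flow_regs s s2.
    by apply: same_but_trans fr1 fr2 _; apply/allP.
  have row2 i : row_sum m s2 rX i = row_sum m s1 rX i by rewrite /row_sum fr2.
  have col2 j : col_sum n s2 rX j = col_sum n s1 rX j by rewrite /col_sum fr2.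
  have [E2 D2 ET2 DT2] : [/\ s2 rE = s1 rE, s2 rD = s1 rD, s2 rET = s1 rET & s2 rDT = s1 rDT].
    by rewrite !fr2.
  apply: wp_conseq (augmentP nN NH tight2 src2 snk2 k2 tg2 _ _ _ _) _;
    rewrite ?E2 ?D2 ?ET2 ?DT2 -?/H.
  + by move=> i iN; rewrite row2; have [] := bE i iN; lia.
  + by move=> j jm; have := bD j jm; lia.
  + by lia.
  + by lia.
  move=> s3 fr3 [tight3 [a [b [[an bm Ea Db] [E3 D3 ET3 DT3 [row3 col3]]]]]].
  exists k.-1; first by rewrite prednK.
  split.
  + by apply: same_but_trans fr02 fr3 _; apply/allP.
  + split.
    * move=> i iN; rewrite E3 // row3 // row2 [s3 rA]fr3 // [s2 rA]fr2 //.
      have [h1 h2] := rows i iN; split; last by rewrite -h2; lia.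
      by have [->|] := eqVneq i a => /=; lia.
    * move=> j jm; rewrite D3 // col3 // col2 [s3 rB]fr3 // [s2 rB]fr2 //.
      have [h1 h2] := cols j jm; split; last by rewrite -h2; lia.
      by have [->|] := eqVneq j b => /=; lia.
    * split.
        rewrite ET3 ET (@eq_psum _ (fun i => s3 rE i 0) (fun i => s1 rE i 0 - (i == a)%:Z)).
          by rewrite psumB psum_delta.
        by move=> i iN; apply: E3.
      rewrite DT3 DT (@eq_psum _ (fun i => s3 rD i 0) (fun i => s1 rD i 0 - (i == b)%:Z)).
        by rewrite psumB psum_delta.
      by move=> i iN; apply: D3.
    * by split => // i j iN jm; rewrite !fr3 //; apply: feas2.
  + by rewrite ET3 DT3; case: le_k; [left|right]; lia.
  exists t.+1; split; first by lia.
  have [hU hV] := du2.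
  rewrite mulnS exprD -mulrA; split=> [i iN|j jm]; rewrite fr3 //; auto.
move=> s1 [k [fr1 st1 _ [t [tk [hU hV]]]]] npos; split => //.
have p2 : 4 ^+ (m * t) <= 4 ^+ (m * k0) :> int.
  by rewrite ler_weXn2l // leq_mul2l; apply/orP; right; lia.
split=> [i iN|j jm]; [apply: le_trans (hU i iN) _|apply: le_trans (hV j jm) _];
by rewrite ler_wpM2r //; lia.
Qed.

(** Halving the scale sends a quotient [q] to [2 * q] or [2 * q + 1], so each remaining total at
    most doubles and gains one unit per node. One of them was 0, so it is now at most [n] or [m],
    and [n + m] augmentations suffice. *)
Lemma phaseP s p tot f : 0 < p -> s rp 0 0 = 2 * p ->
  valid_input tot s -> flow_state (2 * p) s -> tot + 1 < H -> p < H ->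
  duals_within n m s f -> (forall i j, (i < n)%N -> (j < m)%N -> `|s rW i j| <= f) ->
  1 <= f -> 4 ^+ (m * (n + m)) * f < H -> s rET 0 0 * s rDT 0 0 <= 0 ->
  wp lim phase (fun s' =>
    [/\ flow_state p s', duals_within n m s' (4 ^+ (m * (n + m)) * f),
        s' rET 0 0 * s' rDT 0 0 <= 0 & s' rp 0 0 = p]) s.
Proof.
move=> p0 sp val st totH pH du hW f1 fH ed0.
have [dm A0 B0 totA totB] := val.
have [rows cols [ET DT] [feas tight]] := st.
have p20 : 0 < 2 * p by lia.
have [bE bD bET bDT] := flow_state_bounds p20 val st.
have half : (s rp 0 0 %/ 2)%Z = p by rewrite sp; lia.
apply/wp_seq/wp_set => //=; rewrite half; first by rewrite -/H; lia.
set s1 := upd s _ _ _ _.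
have row_le i : (i < n)%N -> 2 * row_sum m s rX i <= (s rA i 0 %/ p)%Z.
  move=> iN; have [h1 h2] := rows i iN; have := div_double (s rA i 0) p0.
  by move: h2; move: (_ %/ _)%Z (_ %/ _)%Z; lia.
have col_le j : (j < m)%N -> 2 * col_sum n s rX j <= (s rB j 0 %/ p)%Z.
  move=> jm; have [h1 h2] := cols j jm; have := div_double (s rB j 0) p0.
  by move: h2; move: (_ %/ _)%Z (_ %/ _)%Z; lia.
have X0 i j : (i < n)%N -> (j < m)%N -> 0 <= s rX i j.
  by move=> iN jm; case: (tight i j iN jm).
apply: wp_seq; apply: wp_conseq (double_rowsP nN NH (s := s1) (p := p) _ _ _ _ _ _ _) _ => //.
  by rewrite [psum _ _]totA -/H; lia.
move=> s2 fr2 [X2 E2 ET2].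
have row2 i : (i < n)%N -> row_sum m s2 rX i = 2 * row_sum m s rX i.
  by move=> iN; rewrite /row_sum -psumZ; apply: eq_psum => j jm; apply: X2.
have col2 j : (j < m)%N -> col_sum n s2 rX j = 2 * col_sum n s rX j.
  by move=> jm; rewrite /col_sum -psumZ; apply: eq_psum => i iN; apply: X2.
have fr02 : same_but flow_regs s s2.
  by apply: (@same_but_trans _ _ s s1) fr2 _; [apply: same_but_upd|apply/allP].
have val2 : valid_input tot s2 by apply: valid_input_ext fr02 _.
have B2 : s2 rB = s rB by rewrite fr02.
have p2 : s2 rp 0 0 = p by rewrite fr2.
apply: wp_seq; apply: wp_conseq (reset_colsP nN NH (s := s2) (p := p) _ _ _ _ _ _ _) _ => //.
- by case: val2.
- by move=> i j iN jm; rewrite X2 // mulr_ge0 // X0.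
- by rewrite B2.
- by move=> j jm; rewrite col2 // B2 col_le.
- by rewrite B2 totB -/H; lia.
move=> s3 fr3 [D3 DT3].
have fr03 : same_but flow_regs s s3.
  by apply: same_but_trans fr02 fr3 _; apply/allP.
have val3 : valid_input tot s3 by apply: valid_input_ext fr03 _.
have row3 i : (i < n)%N -> row_sum m s3 rX i = 2 * row_sum m s rX i.
  by move=> iN; rewrite -row2 // /row_sum fr3.
have col3 j : (j < m)%N -> col_sum n s3 rX j = 2 * col_sum n s rX j.
  by move=> jm; rewrite -col2 // /col_sum fr3.
have E3 i : (i < n)%N -> s3 rE i 0 = (s rA i 0 %/ p)%Z - 2 * row_sum m s rX i.
  by move=> iN; rewrite fr3 // E2.
have {}D3 j : (j < m)%N -> s3 rD j 0 = (s rB j 0 %/ p)%Z - 2 * col_sum n s rX j.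
  by move=> jm; rewrite D3 // col2 // B2.
have U3 : s3 rU = s rU by rewrite fr3 // fr2.
have V3 : s3 rVd = s rVd by rewrite fr3 // fr2.
have W3 : s3 rW = s rW by rewrite fr3 // fr2.
have {}ET3 : s3 rET 0 0 = psum n (fun i => s3 rE i 0).
  by rewrite fr3 // ET2; apply: eq_psum => i iN; rewrite fr3.
have X3 i j : (i < n)%N -> (j < m)%N -> s3 rX i j = 2 * s rX i j.
  by move=> iN jm; rewrite fr3 // X2.
have st3 : flow_state p s3.
  split => //.
  - move=> i iN; rewrite E3 // row3 // fr03 // subr_ge0 row_le //; split => //.
    by move: (_ %/ _)%Z; lia.
  - move=> j jm; rewrite D3 // col3 // fr03 // subr_ge0 col_le //; split => //.
    by move: (_ %/ _)%Z; lia.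
  split=> i j iN jm; rewrite /dual_feasible U3 V3 W3; first exact: feas.
  by rewrite X3 //; have [h1 h2] := tight i j iN jm; split; [lia|move=> h; apply: h2; lia].
have le_ET : s3 rET 0 0 <= 2 * s rET 0 0 + n%:Z.
  rewrite ET3 ET -psumZ -[n%:Z]mulr1 -psum_const -psumD; apply: le_psum => i iN.
  rewrite E3 //; have [h1 h2] := rows i iN; have := div_double (s rA i 0) p0.
  by move: h2; move: (_ %/ _)%Z (_ %/ _)%Z; lia.
have le_DT : s3 rDT 0 0 <= 2 * s rDT 0 0 + m%:Z.
  rewrite DT3 DT -psumZ -[m%:Z]mulr1 -psum_const -psumD; apply: le_psum => j jm.
  rewrite D3 //; have [h1 h2] := cols j jm; have := div_double (s rB j 0) p0.
  by move: h2; move: (_ %/ _)%Z (_ %/ _)%Z; lia.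
have zero : s rET 0 0 = 0 \/ s rDT 0 0 = 0 by nia.
apply: wp_conseq (@augment_loopP s3 p tot f (n + m) _ _ _ _ _ _ _ _ _ _) _ => //.
- by lia.
- by case: du => hU hV; split=> *; rewrite ?U3 ?V3; auto.
- by rewrite W3.
- by case: zero; [left|right]; lia.
move=> s4 fr4 [st4 du4 ed4]; split => //.
by rewrite fr4 // fr3.
Qed.

End Phases.

Definition hungarian : acmd :=
  (S0 rtot (ANum 0) ;; AFor ri rn (S0 rtot (V rtot + G1 rA (V ri))) ;;
   S0 rp (ANum 1) ;; AWhile (V rtot - V rp + ANum 1) (S0 rp (V rp + V rp)) ;;
   AWhile (V rp - ANum 1) phase)%P.

Section HungarianCorrect.
Variables (lim : limits) (n m : nat).
Let N := max_iter lim.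
Let H : int := 2 ^+ word_len lim.
Hypotheses (nN : (n + m + 3 <= N)%N) (NH : N%:Z < H).

Lemma hungarianP s (tot f : int) (T : nat) : valid_input n m tot s ->
  [/\ forall i j, (i < n)%N -> (j < m)%N -> s rX i j = 0,
      forall i, (i < n)%N -> s rU i 0 = 0 & forall j, (j < m)%N -> s rVd j 0 = 0] ->
  [/\ forall i, (i < n)%N -> s rE i 0 = 0, forall j, (j < m)%N -> s rD j 0 = 0,
      s rET 0 0 = 0 & s rDT 0 0 = 0] ->
  (forall i j, (i < n)%N -> (j < m)%N -> 0 <= s rW i j <= f) -> 1 <= f ->
  tot < 2 ^+ T -> (T <= N)%N -> 2 ^+ T + 1 < H -> 4 ^+ (m * (n + m) * T) * f < H ->
  wp lim hungarian (fun s' =>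
    [/\ dual_feasible n m s', tight_flow n m s',
        forall i, (i < n)%N -> row_sum m s' rX i = s rA i 0
      & forall j, (j < m)%N -> col_sum n s' rX j = s rB j 0]) s.
Proof.
move=> val [X0 U0 V0] [E0 D0 ET0 DT0] hW f1 totT TN TH fH.
have [dm A0 B0 totA totB] := val.
have tot_ge0 : 0 <= tot by rewrite -totA psum_ge0 // => i iN; apply/ltW/A0.
have A_pre k : (k <= n)%N -> 0 <= psum k (fun i => s rA i 0) <= tot.
  move=> kn; rewrite -totA psum_le_prefix // => [|i iN]; last exact/ltW/A0.
  by rewrite andbT psum_ge0 // => i ik; apply/ltW/A0/(leq_trans ik).
apply/wp_seq/wp_set => //=; apply: wp_seq.
apply: (@wp_for _ n (fun k s1 => s1 rtot 0 0 = psum k (fun i => s rA i 0))) => //=; try lia.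
- by case: dm.
- by rewrite psum0.
- move=> k s1 kn fr1 s1i tot1; have hk := A_pre k.+1 kn.
  by apply: wp_set => //=; rewrite s1i tot1 fr1 //= -psumS // -/H; lia.
move=> s1 fr1 _; rewrite totA => tot1.
apply/wp_seq/wp_set => //=; apply: wp_seq.
set s2 := upd s1 _ _ _ _.
have tot2 : s2 rtot 0 0 = tot := tot1.
have two_pow t : (t <= T)%N -> 1 <= (2 ^+ t : int) <= 2 ^+ T.
  by move=> tT; rewrite exprn_ege1 //= ler_weXn2l.
apply: (@wp_while _ (fun k s3 => same_but [:: rp] s2 s3 /\
  exists t, (t + k)%N = T /\ s3 rp 0 0 = 2 ^+ t) _ _ _ T) => //=.
- by split => //; exists 0%N.
- move=> k s3 [fr3 [t [tk p3]]]; rewrite [s3 rtot]fr3 // tot2 p3 => le.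
  have tT : (t < T)%N.
    rewrite ltnNge; apply/negP => Tt; have : 2 ^+ T <= 2 ^+ t :> int by rewrite ler_weXn2l.
    by lia.
  have [_ hp] := andP (two_pow _ tT).
  have p2 : 2 ^+ t + 2 ^+ t = 2 ^+ t.+1 :> int by rewrite exprS; lia.
  apply: wp_set => //=; rewrite p3 p2; first by rewrite -/H ger0_norm ?exprn_ge0 //; lia.
  exists k.-1; first by lia.
  by split; [apply: same_but_upd|exists t.+1; split => //; lia].
move=> s3 [k0 [fr3 [t [tk p3]]]]; rewrite [s3 rtot]fr3 // tot2 p3 => lt_tot.
have {lt_tot}tot_lt : tot < 2 ^+ t by lia.
have fr03 : same_but [:: ri; rtot; rp] s s3.
  apply: same_but_trans fr3 _; last by apply/allP.
  apply: same_but_upd => //; apply: same_but_trans fr1 _; last by apply/allP.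
  exact: same_but_upd.
have val3 : valid_input n m tot s3 by apply: valid_input_ext fr03 _.
have quo0 (a : int) : 0 < a -> a <= tot -> (a %/ 2 ^+ t)%Z = 0.
  by move=> a0 at_; rewrite divz_small // abszE ger0_norm ?exprn_ge0 //; lia.
(* At a scale above the total all quotients are 0, so the zero flow is complete, and zero potentials
   are feasible because costs are nonnegative. *)
have st3 : flow_state n m (2 ^+ t) s3.
  split.
  - move=> i iN; rewrite fr03 // E0 // lexx; split => //.
    rewrite [s3 rA]fr03 // quo0 ?A0 //; last first.
      by rewrite -totA; apply: (@psum_ge n i (fun i => s rA i 0)) => // k kn; apply/ltW/A0.
    rewrite addr0 /row_sum (@eq_psum _ _ (fun=> 0)) ?psum_const ?mulr0 // => j jm.
    by rewrite fr03 // X0.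
  - move=> j jm; rewrite fr03 // D0 // lexx; split => //.
    rewrite [s3 rB]fr03 // quo0 ?B0 //; last first.
      by rewrite -totB; apply: (@psum_ge m j (fun j => s rB j 0)) => // k kn; apply/ltW/B0.
    rewrite addr0 /col_sum (@eq_psum _ _ (fun=> 0)) ?psum_const ?mulr0 // => i iN.
    by rewrite fr03 // X0.
  - rewrite !fr03 // ET0 DT0; split.
      by rewrite (@eq_psum _ _ (fun=> 0)) ?psum_const ?mulr0.
    by rewrite (@eq_psum _ _ (fun=> 0)) ?psum_const ?mulr0.
  - split=> i j iN jm; rewrite !fr03 //.
      by rewrite U0 // V0 // add0r; case/andP: (hW i j iN jm).
    by rewrite X0.
pose w := [:: rX; rU; rVd; rE; rD; rET; rDT; rp; rRS; rRT; rPS; rPT; rk;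
   rbi; rbj; rbd; rhas; ri; rj; rsl; rgo; rcur; rci].
(* The exponent of the current scale is the measure; [q] counts finished phases, each of which
   multiplies the bound on the potentials by [4 ^+ (m * (n + m))]. *)
pose J k s4 := [/\ same_but w s3 s4, flow_state n m (2 ^+ k) s4,
  s4 rET 0 0 * s4 rDT 0 0 <= 0, s4 rp 0 0 = 2 ^+ k &
  exists q, (q + k)%N = t /\ duals_within n m s4 (4 ^+ (m * (n + m) * q) * f)].
apply: (@wp_while _ J _ _ _ t) => //=; first by lia.
- split => //; first by rewrite !fr03 // ET0 mul0r.
  exists 0%N; split => //; rewrite muln0 expr0 mul1r.
  by split=> [i iN|j jm]; rewrite fr03 // ?U0 ?V0 // normr0; lia.
- move=> k s4 [fr4 st4 ed4 p4 [q [qk du4]]]; rewrite p4 => pgt.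
  case: k pgt st4 p4 qk => [|k]; first by rewrite expr0 subrr ltxx.
  move=> _ st4 p4 qk.
  have val4 : valid_input n m tot s4 by apply: valid_input_ext fr4 _.
  have kT : (k <= T)%N by lia.
  have hk := two_pow k kT.
  have c1 : 1 <= 4 ^+ (m * (n + m) * q) :> int by rewrite exprn_ege1.
  have c2 : 4 ^+ (m * (n + m)) * 4 ^+ (m * (n + m) * q) <= 4 ^+ (m * (n + m) * T) :> int.
    by rewrite -exprD -mulnS ler_weXn2l // leq_mul2l; apply/orP; right; lia.
  apply: wp_conseq (phaseP nN NH (s := s4) (p := 2 ^+ k) (tot := tot)
    (f := 4 ^+ (m * (n + m) * q) * f) _ _ _ _ _ _ _ _ _ _ _) _ => //; rewrite -?/H.
  + by rewrite exprn_gt0.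
  + by rewrite p4 exprS.
  + by rewrite -exprS.
  + by lia.
  + by lia.
  + move=> i j iN jm; rewrite fr4 // fr03 //; have := hW i j iN jm.
    by move=> hw; rewrite ger0_norm; nia.
  + by nia.
  + by rewrite mulrA; apply: le_lt_trans fH; rewrite ler_wpM2r //; lia.
  move=> s5 fr5 [st5 du5 ed5 p5]; exists k => //; split => //.
    by apply: same_but_trans fr4 fr5 _; apply/allP.
  by exists q.+1; split; [lia|rewrite mulnS exprD -mulrA].
move=> s4 [k [fr4 st4 ed4 p4 _]]; rewrite p4 => ple.
have ge1 : 1 <= 2 ^+ k :> int by rewrite exprn_ege1.
have p1 : 2 ^+ k = 1 :> int by lia.
have val4 : valid_input n m tot s4 by apply: valid_input_ext fr4 _.
have [rows cols [ET DT] [feas tight]] := st4.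
have [_ _ _ totA4 totB4] := val4.
rewrite p1 in rows cols.
(* At scale 1 nothing is rounded, so total supply equals total demand and the two remainders agree.
   Their product is at most 0, hence both vanish. *)
have eqED : s4 rET 0 0 = s4 rDT 0 0.
  have e1 : psum n (fun i => row_sum m s4 rX i) + s4 rET 0 0 = tot.
    rewrite ET -psumD -totA4; apply: eq_psum => i iN.
    by have [_ ->] := rows i iN; rewrite divz1.
  have e2 : psum m (fun j => col_sum n s4 rX j) + s4 rDT 0 0 = tot.
    rewrite DT -psumD -totB4; apply: eq_psum => j jm.
    by have [_ ->] := cols j jm; rewrite divz1.
  have e3 : psum n (fun i => row_sum m s4 rX i) = psum m (fun j => col_sum n s4 rX j).
    exact: exchange_psum.
  by lia.
have Epos i : (i < n)%N -> 0 <= s4 rE i 0 by move=> iN; case: (rows i iN).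
have Dpos j : (j < m)%N -> 0 <= s4 rD j 0 by move=> jm; case: (cols j jm).
have ET4 : s4 rET 0 0 = 0.
  have : 0 <= s4 rET 0 0 by rewrite ET psum_ge0.
  by move: ed4; rewrite -eqED; nia.
split => // [i iN|j jm].
  have [_ e] := rows i iN; move: e; rewrite divz1 [s4 rA]fr4 // [s3 rA]fr03 // => <-.
  have := @psum_ge n i (fun i => s4 rE i 0) Epos iN; rewrite -ET ET4 => h.
  by have := Epos i iN; lia.
have [_ e] := cols j jm; move: e; rewrite divz1 [s4 rB]fr4 // [s3 rB]fr03 // => <-.
have := @psum_ge m j (fun j => s4 rD j 0) Dpos jm; rewrite -DT -eqED ET4 => h.
by have := Dpos j jm; lia.
Qed.

End HungarianCorrect.

(** * Orienting the small edges *)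

Notation rY := 31%N.
Notation rSM := 32%N.
Notation rcnt := 33%N.
Notation rlast := 34%N.
Notation rsel := 35%N.
Notation rsi := 36%N.
Notation rsj := 37%N.

(** [rSM] is 0 on large edges, 1 on small edges not yet oriented, and 2 (resp.
    3) on small edges oriented away from their source (resp. sink), the child.
    With [tr] set the roles of sources and sinks are exchanged. *)
Definition scan (tr : bool) : acmd :=
  let: (v, b, v', b') := if tr then (rj, rm, ri, rn) else (ri, rn, rj, rm) in
  AFor v b
    (S0 rcnt (ANum 0) ;;
     AFor v' b'
       (AIf (AGet rSM (V ri) (V rj) * (ANum 2 - AGet rSM (V ri) (V rj)))
          (S0 rcnt (V rcnt + ANum 1) ;; S0 rlast (V v')) ASkip) ;;
     AIf (V rcnt * (ANum 2 - V rcnt))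
       (S0 rsel (ANum (if tr then 3 else 2)) ;;
        S0 rsi (V (if tr then rlast else ri)) ;;
        S0 rsj (V (if tr then rj else rlast))) ASkip)%P.

Definition orient : acmd :=
  (S0 rgo (ANum 1) ;;
   AWhile (V rgo)
     (S0 rsel (ANum 0) ;; scan false ;; scan true ;;
      AIf (V rsel) (ASet rSM (V rsi) (V rsj) (V rsel)) (S0 rgo (ANum 0))))%P.

Definition entry (tr : bool) (s : store) (r p q : nat) : int :=
  if tr then s r q p else s r p q.

Definition only_one (tr : bool) (s : store) (k p q : nat) : Prop :=
  [/\ (q < k)%N, entry tr s rSM p q = 1
    & forall q', (q' < k)%N -> entry tr s rSM p q' = 1 -> q' = q].

Section Orientation.
Variables (lim : limits) (n m : nat).
Let N := max_iter lim.
Let H : int := 2 ^+ word_len lim.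
Hypotheses (nN : (n + m + n * m + 3 <= N)%N) (NH : N%:Z + 8 < H).

Let dim1 (tr : bool) := if tr then m else n.
Let dim2 (tr : bool) := if tr then n else m.

Lemma scanP (tr : bool) s : dims n m s ->
  (forall i j, (i < n)%N -> (j < m)%N -> 0 <= s rSM i j <= 3) ->
  wp lim (scan tr) (fun s' =>
    [\/ s' rsel = s rsel /\ s' rsi = s rsi /\ s' rsj = s rsj /\
        (forall p q, (p < dim1 tr)%N -> ~ only_one tr s (dim2 tr) p q)
      | s' rsel 0 0 = (if tr then 3 else 2) /\ exists i j : nat,
        [/\ (i < n)%N, (j < m)%N, s' rsi 0 0 = i, s' rsj 0 0 = j &
          if tr then only_one tr s n j i else only_one tr s m i j]]) s.
Proof.
move=> dm rng.
have rng' p q : (p < dim1 tr)%N -> (q < dim2 tr)%N -> 0 <= entry tr s rSM p q <= 3.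
  by case: (tr) => hp hq; apply: rng.
have d1N : (dim1 tr <= N)%N by rewrite /dim1; case: (tr); lia.
have d2N : (dim2 tr <= N)%N by rewrite /dim2; case: (tr); lia.
pose v1 := if tr then rj else ri; pose b1 := if tr then rm else rn.
pose v2 := if tr then ri else rj; pose b2 := if tr then rn else rm.
have sb1 : s b1 0 0 = dim1 tr by rewrite /b1 /dim1; case: dm => ? ?; case: (tr).
have sb2 : s b2 0 0 = dim2 tr by rewrite /b2 /dim2; case: dm => ? ?; case: (tr).
pose sel_ok (s1 : store) := s1 rsel 0 0 = (if tr then 3 else 2) /\ exists i j : nat,
        [/\ (i < n)%N, (j < m)%N, s1 rsi 0 0 = i, s1 rsj 0 0 = j &
          if tr then only_one tr s n j i else only_one tr s m i j].
pose body2 := AIf (AGet rSM (V ri) (V rj) * (ANum 2 - AGet rSM (V ri) (V rj)))%P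
          (S0 rcnt (V rcnt + ANum 1) ;; S0 rlast (V v2))%P ASkip.
pose tail := AIf (V rcnt * (ANum 2 - V rcnt))%P
       (S0 rsel (ANum (if tr then 3 else 2)) ;;
        S0 rsi (V (if tr then rlast else ri)) ;;
        S0 rsj (V (if tr then rj else rlast)))%P ASkip.
have -> : scan tr = AFor v1 b1 (S0 rcnt (ANum 0) ;; AFor v2 b2 body2 ;; tail)%P.
  by rewrite /scan /body2 /tail /v1 /v2 /b1 /b2; case: (tr).
pose w := [:: ri; rj; rcnt; rlast; rsel; rsi; rsj].
have notw : [/\ v1 \in w, v2 \in w, b1 \notin w & b2 \notin w].
  by rewrite /v1 /v2 /b1 /b2; case: (tr).
pose I (k : nat) (s1 : store) := [\/ s1 rsel = s rsel /\ s1 rsi = s rsi /\ s1 rsj = s rsj /\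
        (forall p q, (p < k)%N -> ~ only_one tr s (dim2 tr) p q)
      | sel_ok s1].
apply: (@wp_for _ (dim1 tr) I) => //.
- by have := d1N; rewrite -/H; lia.
- by rewrite /v1 /b1 /body2 /tail /v2 /b2; case: (tr).
- by left; rewrite /v1; case: (tr); rewrite !upd_other.
- move=> k s1 k1 fr1 s1v I1.
  have {}fr1 : same_but w s s1.
    by apply: same_but_sub fr1 _; rewrite /v1 /body2 /tail /v2; case: (tr); apply/allP.
  apply/wp_seq/wp_set => //=; apply: wp_seq.
  set s2 := upd s1 _ _ _ _.
  have fr2 : same_but w s s2 by apply: same_but_upd.
  have s2v : s2 v1 0 0 = k by rewrite -s1v /s2 upd_other // /v1; case: (tr).
  pose J (l : nat) (s3 : store) :=
     [\/ s3 rcnt 0 0 = 0 /\ (forall q, (q < l)%N -> entry tr s rSM k q != 1),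
     s3 rcnt 0 0 = 1 /\ (exists q : nat, s3 rlast 0 0 = q /\ only_one tr s l k q)
   | 2 <= s3 rcnt 0 0 <= l%:Z /\ (exists q q', [/\ (q < l)%N, (q' < l)%N, q != q',
        entry tr s rSM k q = 1 & entry tr s rSM k q' = 1])].
  apply: (@wp_for _ (dim2 tr) J) => //.
  + by have := d2N; rewrite -/H; lia.
  + by rewrite /v2 /b2 /body2; case: (tr).
  + by rewrite fr2 //; case: notw.
  + by constructor 1; split => //=; rewrite /v2; case: (tr).
  + move=> l s3 l2 fr3 s3v J3.
    have {fr3}[fr3 s3v1] : same_but w s s3 /\ s3 v1 0 0 = k.
      split; last by rewrite fr3 // /body2 /v1 /v2; case: (tr).
      apply: same_but_trans fr2 fr3 _.
      by rewrite /body2 /v2; case: (tr); apply/allP.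
    (* Among the values 0 to 3, [z * (2 - z)] is positive only at 1; the product serves as an
       equality test. *)
    have test : (0 < ev s3 (AGet rSM (V ri) (V rj) * (ANum 2 - AGet rSM (V ri) (V rj)))%P)
        = (entry tr s rSM k l == 1).
      have -> : ev s3 (AGet rSM (V ri) (V rj) * (ANum 2 - AGet rSM (V ri) (V rj)))%P =
          entry tr s rSM k l * (2 - entry tr s rSM k l).
        by move: s3v s3v1; rewrite /v1 /v2 /entry /=; case: (tr) => -> ->; rewrite fr3.
      have := rng' k l k1 l2; move: (entry _ _ _ _ _) => x hx.
      by apply/idP/eqP => [|->]; [nia|].
    apply: wp_if; [by []|rewrite test => /eqP e1|rewrite leNgt test => e1].
      have cnt_le : 0 <= s3 rcnt 0 0 <= l%:Z.
        by case: J3 => [[-> _]|[-> [q [_ [ql _ _]]]]|[h _]]; lia.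
      apply/wp_seq/wp_set => //=; first by rewrite -/H; lia.
      apply: wp_set => //=; first by rewrite /v2; case: (tr).
      have e3 : upd (upd (upd s3 rcnt 0 0 (s3 rcnt 0 0 + 1)) rlast 0 0
          (upd s3 rcnt 0 0 (s3 rcnt 0 0 + 1) v2 0 0)) v2 0 0 l.+1 rcnt 0 0
          = s3 rcnt 0 0 + 1 by rewrite /v2; case: (tr).
      have e4 : upd (upd (upd s3 rcnt 0 0 (s3 rcnt 0 0 + 1)) rlast 0 0
          (upd s3 rcnt 0 0 (s3 rcnt 0 0 + 1) v2 0 0)) v2 0 0 l.+1 rlast 0 0
          = l by rewrite -s3v /v2; case: (tr).
      rewrite /J e3 e4;
      case: J3 => [[-> none]|[-> [q [_ [ql eq uq]]]]|[h [q [q' [ql q'l ne eq eq']]]]].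
      * constructor 2; split => //; exists l; split => //; split => // q'.
        by rewrite ltS_eqVlt => /orP[/eqP->//|/none/eqP].
      * constructor 3; split; first by lia.
        by exists q, l; split => //; [exact: ltnW|rewrite neq_ltn ql].
      * by constructor 3; split; [lia|exists q, q'; split => //; apply: ltnW].
    apply: wp_skip.
    have e3 : upd s3 v2 0 0 l.+1 rcnt 0 0 = s3 rcnt 0 0 by rewrite /v2; case: (tr).
    have e4 : upd s3 v2 0 0 l.+1 rlast 0 0 = s3 rlast 0 0 by rewrite /v2; case: (tr).
    rewrite /J e3 e4;
      case: J3 => [[-> none]|[-> [q [eq0 [ql eq uq]]]]|[h [q [q' [ql q'l ne eq eq']]]]].
    * by constructor 1; split => // q; rewrite ltS_eqVlt => /orP[/eqP->//|/none].
    * constructor 2; split => //; exists q; split => //; split => //; first exact: ltnW.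
      by move=> q'; rewrite ltS_eqVlt => /orP[/eqP->|/uq//] /eqP; rewrite (negPf e1).
    * by constructor 3; split; [lia|exists q, q'; split => //; apply: ltnW].
  move=> s3 fr3 _ J3.
  have s3v1 : s3 v1 0 0 = k by rewrite fr3 // /body2 /v1 /v2; case: (tr).
  have I3 : I k s3.
    have e r : r \in [:: rsel; rsi; rsj] -> s3 r = s1 r.
      by rewrite !inE => h; rewrite fr3 /s2 ?upd_other // /body2 /v2;
         case: (tr); case/or3P: h => /eqP->.
    by case: I1 => h; [left|right]; move: h; rewrite /sel_ok !e.
  have skipI : (forall q, ~ only_one tr s (dim2 tr) k q) -> I k.+1 (upd s3 v1 0 0 k.+1).
    move=> no; case: I3 => [[h1 [h2 [h3 h4]]]|h]; [left|right].
      rewrite -h1 -h2 -h3; do ?split; rewrite ?upd_other //; try by rewrite /v1; case: (tr).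
      by move=> p q; rewrite ltS_eqVlt => /orP[/eqP->|/h4]; [apply: no|].
    by move: h; rewrite /sel_ok /v1; case: (tr).
  apply: wp_if => //= hc; last first.
    apply/wp_skip/skipI => q [qk eq uq].
    case: J3 => [[_ none]|[c1 _]|[h [q1 [q2 [q1l q2l ne e1 e2]]]]].
    * by have /eqP := none q qk.
    * by rewrite c1 in hc.
    * by rewrite (uq _ q1l e1) (uq _ q2l e2) eqxx in ne.
  have [q [lastq one]] : exists q : nat,
      s3 rlast 0 0 = q /\ only_one tr s (dim2 tr) k q.
    by case: J3 => [[c0 _]|[_ //]|[h _]]; [rewrite c0 in hc|nia].
  have [ql _ _] := one.
  apply/wp_seq/wp_set => //=; first by case: (tr); rewrite -/H; lia.
  apply/wp_seq/wp_set => //=; first by case: (tr).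
  apply: wp_set => //=; first by case: (tr).
  right; split; first by rewrite /v1; case: (tr).
  exists (if tr then q else k), (if tr then k else q).
  move: s3v1 one ql k1; rewrite /v1 /dim1 /dim2.
  by case: (tr) => s3v1 one ql k1 /=; rewrite s3v1 lastq.
Qed.

(** Pruning needs a leaf in whatever edges are left, so the forest hypothesis is stated for all
    nonempty sets of small edges. A node becomes a child when a single unoriented edge remains at
    it; afterwards none remains, so it is a child only once. *)
Lemma orientP s : dims n m s ->
  (forall i j, (i < n)%N -> (j < m)%N -> 0 <= s rSM i j <= 1) ->
  (forall E : nat -> nat -> Prop,
     (forall i j, E i j -> [/\ (i < n)%N, (j < m)%N & s rSM i j = 1]) ->
     (exists i j, E i j) ->
     exists i j, E i j /\
       ((forall j', E i j' -> j' = j) \/ (forall i', E i' j -> i' = i))) ->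
  wp lim orient (fun s' =>
    [/\ forall i j, (i < n)%N -> (j < m)%N ->
          if s rSM i j == 1 then s' rSM i j = 2 \/ s' rSM i j = 3 else s' rSM i j = 0,
        forall i j j', (i < n)%N -> (j < m)%N -> (j' < m)%N ->
          s' rSM i j = 2 -> s' rSM i j' = 2 -> j' = j
      & forall i i' j, (i < n)%N -> (i' < n)%N -> (j < m)%N ->
          s' rSM i j = 3 -> s' rSM i' j = 3 -> i' = i]) s.
Proof.
move=> dm rng forest; apply/wp_seq/wp_set => //=.
pose ones (s1 : store) := #|[pred e : 'I_n * 'I_m | s1 rSM e.1 e.2 == 1]|.
pose w := [:: ri; rj; rcnt; rlast; rsel; rsi; rsj; rgo; rSM].
(* The last two clauses carry the uniqueness: a node that is already a child has no unoriented edge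
   left. *)
pose Inv (s1 : store) := [/\ same_but w s s1,
  forall i j, (i < n)%N -> (j < m)%N ->
    if s rSM i j == 1 then 1 <= s1 rSM i j <= 3 else s1 rSM i j == 0,
  forall i j j', (i < n)%N -> (j < m)%N -> (j' < m)%N ->
    s1 rSM i j = 2 -> s1 rSM i j' != 1 /\ (s1 rSM i j' = 2 -> j' = j)
  & forall i i' j, (i < n)%N -> (i' < n)%N -> (j < m)%N ->
    s1 rSM i j = 3 -> s1 rSM i' j != 1 /\ (s1 rSM i' j = 3 -> i' = i)].
pose J (k : nat) (s1 : store) := Inv s1 /\
  ((s1 rgo 0 0 = 1 /\ k = (ones s1).+1) \/
   [/\ s1 rgo 0 0 = 0, k = 0%N &
     forall i j, (i < n)%N -> (j < m)%N -> s1 rSM i j != 1]).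
apply: (@wp_while _ J _ _ _ ((ones s).+1)) => //=.
- have : (ones s <= n * m)%N by rewrite (leq_trans (max_card _)) // card_prod !card_ord.
  by lia.
- split; last by left.
  split => //.
  + exact: same_but_upd.
  + by move=> i j iN jm; have := rng i j iN jm; case: eqP => /=; lia.
  + by move=> i j j' iN jm jm' /=; have := rng i j iN jm; lia.
  + by move=> i j j' iN jm jm' /=; have := rng i j' iN jm'; lia.
- move=> k s1 [[fr1 val1 row1 col1] [[go1 kE]|[-> //]]] _.
  apply/wp_seq/wp_set => //=; set s2 := upd s1 _ _ _ _.
  have fr02 : same_but w s s2 by apply: same_but_upd.
  have rng1 i j : (i < n)%N -> (j < m)%N -> 0 <= s1 rSM i j <= 3.
    by move=> iN jm; have := val1 i j iN jm; case: ifP => _; lia.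
  have dm2 : dims n m s2 by rewrite /dims !fr02.
  apply: wp_seq; apply: wp_conseq (@scanP false s2 dm2 rng1) _ => s3 fr3 sel3.
  have fr03 : same_but w s s3.
    by apply: same_but_trans fr02 fr3 _; apply/allP.
  have SM3 : s3 rSM = s1 rSM by rewrite fr3.
  have dm3 : dims n m s3 by rewrite /dims !fr03.
  have rng3 i j : (i < n)%N -> (j < m)%N -> 0 <= s3 rSM i j <= 3 by rewrite SM3; apply: rng1.
  apply: wp_seq; apply: wp_conseq (@scanP true s3 dm3 rng3) _ => s4 fr4 sel4.
  have fr04 : same_but w s s4.
    by apply: same_but_trans fr03 fr4 _; apply/allP.
  have SM4 : s4 rSM = s1 rSM by rewrite fr4.
  have go4 : s4 rgo = s1 rgo by rewrite fr4 // fr3.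
  have one3 tr d p q : only_one tr s3 d p q <-> only_one tr s1 d p q.
    by rewrite /only_one /entry SM3.
  have sel : [\/ s4 rsel 0 0 = 0 /\
        (forall i j, (i < n)%N -> ~ only_one false s1 m i j) /\
        (forall i j, (j < m)%N -> ~ only_one true s1 n j i),
      s4 rsel 0 0 = 2 /\ exists i j : nat, [/\ (i < n)%N, (j < m)%N,
        s4 rsi 0 0 = i, s4 rsj 0 0 = j & only_one false s1 m i j]
    | s4 rsel 0 0 = 3 /\ exists i j : nat, [/\ (i < n)%N, (j < m)%N,
        s4 rsi 0 0 = i, s4 rsj 0 0 = j & only_one true s1 n j i]].
    case: sel4 => [[e1 [e2 [e3 no4]]]|[e1 [i [j [iN jm e2 e3 /one3 one]]]]]; last first.
      by constructor 3; split => //; exists i, j.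
    rewrite e1 e2 e3; case: sel3 => [[h1 [h2 [h3 no3]]]|h]; last by constructor 2.
    constructor 1; rewrite h1; split => //; split => [i j iN one|i j jm /one3 one].
      exact: no3 iN one.
    exact: no4 jm one.
  case: sel => [[e [norow nocol]]|[e [i [j [iN jm ei ej one]]]]|[e [i [j [iN jm ei ej one]]]]].
  + apply: wp_if => //=; rewrite e // => _; apply: wp_set => //=.
    exists 0%N; first by rewrite kE.
    have none i j : (i < n)%N -> (j < m)%N -> s1 rSM i j != 1.
      move=> iN jm; apply/negP => /eqP e1.
      have := forest (fun i j => [/\ (i < n)%N, (j < m)%N & s1 rSM i j = 1]).
      case=> [i1 j1 [i1n j1m e2]||i1 [j1 [[i1n j1m e2] [uniq|uniq]]]].
      * split => //; have := val1 i1 j1 i1n j1m; rewrite e2.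
        by case: eqP.
      * by exists i, j.
      * by case: (norow i1 j1 i1n); split => // j' j'm e3; apply: uniq.
      * by case: (nocol i1 j1 j1m); split => // i' i'n e3; apply: uniq.
    split; last by right; split => // i j iN jm /=; rewrite SM4 none.
    split; rewrite /= ?SM4 //.
    exact: same_but_upd.
  + have [_ e1 uniq] := one; rewrite /entry /= in e1 uniq.
    apply: wp_if => //=; rewrite e // => _; apply: wp_set => //=.
    rewrite ei ej e; set s5 := upd s4 rSM _ _ _.
    have SM5 (i' j' : nat) : s5 rSM i' j' = if (i' == i) && (j' == j) then 2 else s1 rSM i' j'.
      by rewrite /s5 /= !eqz_nat SM4.
    exists (ones s5).+1.
      rewrite kE ltnS /ones (cardD1 (Ordinal iN, Ordinal jm) [pred e0 | s1 rSM _ _ == 1]).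
      rewrite inE /= e1 eqxx add1n ltnS; apply: subset_leq_card; apply/fintype.subsetP => -[i' j'].
      rewrite !inE /= SM5 xpair_eqE -!val_eqE /=; by case: ifP => //= -> ->.
    split; last by left; rewrite /s5 /= go4.
    split.
    * exact: same_but_upd.
    * move=> i' j' i'n j'm; rewrite SM5; have := val1 i' j' i'n j'm.
      case: (boolP ((i' == i) && (j' == j))) => [/andP[/eqP-> /eqP->]|//].
      by rewrite e1; case: ifP.
    * move=> i' j1 j2 i'n j1m j2m; rewrite !SM5; have [->|ni] := eqVneq i' i => /=; last first.
        exact: row1.
      have [->|n1] := eqVneq j1 j; have [->|n2] := eqVneq j2 j => //.
      - move=> _; split.
          by apply: contraNneq n2 => e2; apply/eqP/uniq.
        by move=> e2; have [] := row1 i j2 j iN j2m jm e2; rewrite e1.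
      - by move=> e2; have [] := row1 i j1 j iN j1m jm e2; rewrite e1.
      - exact: row1.
    * move=> i1 i2 j' i1n i2n j'm; rewrite !SM5.
      have [->|n1] := eqVneq i1 i; have [->|n2] := eqVneq i2 i => /=.
      - by case: (eqVneq j' j) => _; [move/eqP|apply: col1].
      - by case: (eqVneq j' j) => _; [move/eqP|apply: col1].
      - by case: (eqVneq j' j) => _; [move=> _; split => // /eqP|apply: col1].
      - exact: col1.
  + have [_ e1 uniq] := one; rewrite /entry /= in e1 uniq.
    apply: wp_if => //=; rewrite e // => _; apply: wp_set => //=.
    rewrite ei ej e; set s5 := upd s4 rSM _ _ _.
    have SM5 (i' j' : nat) : s5 rSM i' j' = if (i' == i) && (j' == j) then 3 else s1 rSM i' j'.
      by rewrite /s5 /= !eqz_nat SM4.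
    exists (ones s5).+1.
      rewrite kE ltnS /ones (cardD1 (Ordinal iN, Ordinal jm) [pred e0 | s1 rSM _ _ == 1]).
      rewrite inE /= e1 eqxx add1n ltnS; apply: subset_leq_card; apply/fintype.subsetP => -[i' j'].
      rewrite !inE /= SM5 xpair_eqE -!val_eqE /=; by case: ifP => //= -> ->.
    split; last by left; rewrite /s5 /= go4.
    split.
    * exact: same_but_upd.
    * move=> i' j' i'n j'm; rewrite SM5; have := val1 i' j' i'n j'm.
      case: (boolP ((i' == i) && (j' == j))) => [/andP[/eqP-> /eqP->]|//].
      by rewrite e1; case: ifP.
    * move=> i' j1 j2 i'n j1m j2m; rewrite !SM5.
      have [->|n1] := eqVneq j1 j; have [->|n2] := eqVneq j2 j; rewrite ?andbT ?andbF /=.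
      - by case: (eqVneq i' i) => _; [move/eqP|apply: row1].
      - by case: (eqVneq i' i) => _; [move/eqP|apply: row1].
      - by case: (eqVneq i' i) => _; [move=> _; split => // /eqP|apply: row1].
      - exact: row1.
    * move=> i1 i2 j' i1n i2n j'm; rewrite !SM5; have [->|nj] := eqVneq j' j.
        rewrite !andbT; have [->|n1] := eqVneq i1 i; have [->|n2] := eqVneq i2 i => //.
        - move=> _; split.
            by apply: contraNneq n2 => e2; apply/eqP/uniq.
          by move=> e2; have [] := col1 i2 i j i2n iN jm e2; rewrite e1.
        - by move=> e2; have [] := col1 i1 i j i1n iN jm e2; rewrite e1.
        - exact: col1.
      rewrite !andbF; exact: col1.
- move=> s1 [k [[fr1 val1 row1 col1] [[-> //]|[_ _ none]]]] _; split.
  + move=> i j iN jm; have := val1 i j iN jm; have := none i j iN jm.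
    by case: ifP => // _; [lia|move=> _ /eqP].
  + by move=> i j j' iN jm jm' e1 e2; have [_] := row1 i j j' iN jm jm' e1; apply.
  + by move=> i i' j iN i'n jm e1 e2; have [_] := col1 i i' j iN i'n jm e1; apply.
Qed.

End Orientation.

(** * Concentrating the flow of a star *)

Notation rhc := 39%N.
Notation rcq := 40%N.
Notation rlo := 41%N.
Notation rhi := 42%N.
Notation rt := 43%N.

(** The entry of [r] between the current parent and child number [e]. *)
Definition acc (tr : bool) (r : nat) (e : aexp) : aexp :=
  if tr then AGet r e (V rj) else AGet r (V ri) e.

Definition acc_set (tr : bool) (r : nat) (e v : aexp) : acmd :=
  if tr then ASet r e (V rj) v else ASet r (V ri) e v.

(** [rhc] is positive exactly when the current child is fractional. If the giving edge is emptied,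
    the receiving edge becomes current and [rhc] gets its free capacity, which is 0 when both edges
    have become extreme at once. *)
Definition merge (tr : bool) : acmd :=
  (S0 rt (acc tr rMM (V rlo) - acc tr rY (V rlo)) ;;
   AIf (V rt - acc tr rY (V rhi)) (S0 rt (acc tr rY (V rhi))) ASkip ;;
   acc_set tr rY (V rlo) (acc tr rY (V rlo) + V rt) ;;
   acc_set tr rY (V rhi) (acc tr rY (V rhi) - V rt) ;;
   AIf (acc tr rY (V rhi)) (S0 rcq (V rhi))
     (S0 rcq (V rlo) ;; S0 rhc (acc tr rMM (V rlo) - acc tr rY (V rlo))))%P.

(** The two tests select label 2 when the parents are sinks and label 3 when they are sources:
    [(z - 1) * (3 - z)] and [z - 2] are positive, on 0 to 3, only at these values. *)
Definition star_step (tr : bool) : acmd :=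
  let v' := if tr then ri else rj in
  AIf (if tr then (acc tr rSM (V v') - ANum 1) * (ANum 3 - acc tr rSM (V v'))
       else acc tr rSM (V v') - ANum 2)%P
    (AIf (V rhc)
      (AIf (acc tr rW (V v') - acc tr rW (V rcq))
         (S0 rlo (V rcq) ;; S0 rhi (V v')) (S0 rlo (V v') ;; S0 rhi (V rcq)) ;;
       merge tr)
      (S0 rhc (ANum 1) ;; S0 rcq (V v')))%P ASkip.

Definition star (tr : bool) : acmd :=
  let: (v, b, v', b') := if tr then (rj, rm, ri, rn) else (ri, rn, rj, rm) in
  AFor v b
    (S0 rhc (ANum 0) ;; AFor v' b' (star_step tr) ;;
     AIf (V rhc) (acc_set tr rY (V rcq) (ANum 0)) ASkip)%P.

Definition code (tr : bool) : int := if tr then 2 else 3.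

Section Star.
Variables (lim : limits) (n m : nat).
Let N := max_iter lim.
Let H : int := 2 ^+ word_len lim.
Hypotheses (nN : (n + m + n * m + 3 <= N)%N) (NH : N%:Z + 8 < H).

Let dim1 (tr : bool) := if tr then m else n.
Let dim2 (tr : bool) := if tr then n else m.
Let var1 (tr : bool) := if tr then rj else ri.
Let var2 (tr : bool) := if tr then ri else rj.

Definition upd_entry (tr : bool) (s : store) r (p q : nat) v :=
  if tr then upd s r q p v else upd s r p q v.

Lemma entry_upd tr (s : store) r r' (p q p' q' : nat) v :
  entry tr (upd_entry tr s r p q v) r' p' q' =
  if [&& r' == r, p' == p & q' == q] then v else entry tr s r' p' q'.
Proof. by case: tr; rewrite /= !eqz_nat // [(q' == q) && _]andbC. Qed.

Lemma upd_entry_other tr (s : store) r (p q : nat) v r' :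
  r' != r -> upd_entry tr s r p q v r' = s r'.
Proof. by case: tr; apply: upd_other. Qed.

Lemma ev_acc tr r x (s : store) (p q : nat) : s (var1 tr) 0 0 = p -> s x 0 0 = q ->
  ev s (acc tr r (V x)) = entry tr s r p q.
Proof. by case: tr => /= -> ->. Qed.

Lemma acc_no_low tr r e : no_low (acc tr r e) = (r != 0%N) && no_low e.
Proof. by case: tr => /=; rewrite ?andbT. Qed.

Lemma wp_acc_set tr r x v (s : store) (p q : nat) Q : s (var1 tr) 0 0 = p -> s x 0 0 = q ->
  [&& r != 0%N, x != 0%N & no_low v] ->
  small_exp v || (`|ev s v| < 2 ^+ word_len lim) ->
  Q (upd_entry tr s r p q (ev s v)) -> wp lim (acc_set tr r (V x) v) Q s.
Proof.
by case: tr => /= h1 h2 /and3P[h3 h4 h5] h6 h7; apply: wp_set; rewrite /= ?h1 ?h2 ?h3 ?h4.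
Qed.

Lemma acc_set_writes tr r e v : writes (acc_set tr r e v) = [:: r].
Proof. by case: tr. Qed.

Lemma acc_small tr r e : small_exp (acc tr r e).
Proof. by case: tr. Qed.

Lemma mergeP (tr : bool) (s : store) (p lo hi : nat) :
  s (var1 tr) 0 0 = p -> s rlo 0 0 = lo -> s rhi 0 0 = hi -> lo != hi ->
  0 <= entry tr s rY p lo <= entry tr s rMM p lo -> entry tr s rMM p lo < H ->
  0 <= entry tr s rY p hi < H ->
  wp lim (merge tr) (fun s' =>
    let t := Num.min (entry tr s rMM p lo - entry tr s rY p lo) (entry tr s rY p hi) in
    (forall p' q' : nat, entry tr s' rY p' q' =
      if (p' == p) && (q' == lo) then entry tr s rY p lo + t
      else if (p' == p) && (q' == hi) then entry tr s rY p hi - t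
      else entry tr s rY p' q') /\
    if 0 < entry tr s rY p hi - t then s' rcq 0 0 = hi /\ s' rhc 0 0 = s rhc 0 0
    else s' rcq 0 0 = lo /\
      s' rhc 0 0 = entry tr s rMM p lo - (entry tr s rY p lo + t)) s.
Proof.
set t := Num.min _ _; rewrite /= /merge => sp slo shi ne hlo MMH hhi.
have v1 : var1 tr \in [:: ri; rj] by rewrite /var1; case: (tr).
have v1rt : var1 tr != rt by rewrite /var1; case: (tr).
have v1rY : var1 tr != rY by rewrite /var1; case: (tr).
apply: wp_seq; apply: wp_set; [by rewrite /= !acc_no_low| |];
  rewrite /= !(ev_acc _ sp slo); first by rewrite -/H; lia.
set s1 := upd s _ _ _ _.
have sp1 : s1 (var1 tr) 0 0 = p by rewrite /s1 upd_other.
have t1 : s1 rt 0 0 = entry tr s rMM p lo - entry tr s rY p lo by [].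
have shi1 : s1 rhi 0 0 = hi := shi.
have e1 r (p' q' : nat) : r != rt -> entry tr s1 r p' q' = entry tr s r p' q'.
  by move=> h; rewrite /s1 /entry upd_other.
have h : wp lim (AIf (V rt - acc tr rY (V rhi)) (S0 rt (acc tr rY (V rhi))) ASkip)%P
      (fun s2 => same_but [:: rt] s s2 /\ s2 rt 0 0 = t) s1.
  apply: wp_if; [by rewrite /= !acc_no_low| |]; rewrite /= (ev_acc _ sp1 shi1) e1 //= t1 => hlt.
    apply: wp_set; rewrite ?acc_small //= ?acc_no_low // (ev_acc _ sp1 shi1) e1 //.
    by split; [do 2 apply: same_but_upd => // | rewrite ?eqxx /= /t; lia].
  apply: wp_skip; split; first exact: same_but_upd.
  by rewrite t1 /t; lia.
apply: wp_seq; apply: wp_conseq h _ => s2 _ [fr2 t2].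
have t_le : 0 <= t <= entry tr s rMM p lo - entry tr s rY p lo by rewrite /t; lia.
have t_le' : t <= entry tr s rY p hi by rewrite /t; lia.
have sp2 : s2 (var1 tr) 0 0 = p by rewrite fr2 // inE.
have slo2 : s2 rlo 0 0 = lo by rewrite fr2.
have e2 r (p' q' : nat) : r != rt -> entry tr s2 r p' q' = entry tr s r p' q'.
  by move=> r'; rewrite /entry fr2 // inE.
apply: wp_seq; apply: (wp_acc_set sp2 slo2); [by rewrite /= acc_no_low| |];
  rewrite /= (ev_acc _ sp2 slo2) e2 //= t2; first by rewrite -/H; lia.
set s3 := upd_entry _ _ _ _ _ _.
have sp3 : s3 (var1 tr) 0 0 = p by rewrite /s3 upd_entry_other.
have shi3 : s3 rhi 0 0 = hi by rewrite /s3 upd_entry_other // fr2.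
have t3 : s3 rt 0 0 = t by rewrite /s3 upd_entry_other.
have hi3 : entry tr s3 rY p hi = entry tr s rY p hi.
  by rewrite /s3 entry_upd !eqxx eq_sym (negPf ne) /= e2.
apply: wp_seq; apply: (wp_acc_set sp3 shi3); [by rewrite /= acc_no_low| |];
  rewrite /= (ev_acc _ sp3 shi3) hi3 t3; first by rewrite -/H; lia.
set s4 := upd_entry _ _ _ _ _ _.
have sp4 : s4 (var1 tr) 0 0 = p by rewrite /s4 upd_entry_other.
have shi4 : s4 rhi 0 0 = hi by rewrite /s4 upd_entry_other.
have slo4 : s4 rlo 0 0 = lo by rewrite /s4 upd_entry_other // /s3 upd_entry_other.
have Y4 (p' q' : nat) : entry tr s4 rY p' q' =
    if (p' == p) && (q' == lo) then entry tr s rY p lo + t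
    else if (p' == p) && (q' == hi) then entry tr s rY p hi - t
    else entry tr s rY p' q'.
  rewrite /s4 entry_upd eqxx /= /s3 entry_upd eqxx /= e2 //.
  by case: eqP => //= _; have [->|//] := eqVneq q' hi; rewrite eq_sym (negPf ne).
have hi4 : entry tr s4 rY p hi = entry tr s rY p hi - t.
  by rewrite Y4 eqxx /= eq_sym (negPf ne) eqxx.
have MM4 : entry tr s4 rMM p lo = entry tr s rMM p lo.
  by rewrite -(e2 rMM) // /s4 entry_upd /= /s3 entry_upd.
have lo4 : entry tr s4 rY p lo = entry tr s rY p lo + t by rewrite Y4 !eqxx.
have hc4 : s4 rhc 0 0 = s rhc 0 0.
  by rewrite /s4 upd_entry_other // /s3 upd_entry_other // fr2.
have eY r v (s' : store) (r' p' q' : nat) : r' != r ->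
    entry tr (upd s' r 0 0 v) r' p' q' = entry tr s' r' p' q'.
  by move=> h'; rewrite /entry upd_other.
apply: wp_if; [by rewrite acc_no_low| |]; rewrite (ev_acc _ sp4 shi4) hi4 => h4.
  apply: wp_set => //; rewrite h4; split=> [p' q'|]; first by rewrite eY ?Y4.
  by split => //=.
apply: wp_seq; apply: wp_set => //=.
set s5 := upd s4 _ _ _ _.
have sp5 : s5 (var1 tr) 0 0 = p by rewrite /s5 upd_other // /var1; case: (tr).
have slo5 : s5 rlo 0 0 = lo by [].
apply: wp_set; [by rewrite /= !acc_no_low| |];
  rewrite /= !(ev_acc _ sp5 slo5) !eY // MM4 lo4; first by rewrite -/H; lia.
by rewrite ltNge h4; split=> [p' q'|]; [rewrite !eY ?Y4|split => //=].
Qed.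

End Star.

Section StarCorrect.
Variables (lim : limits) (n m : nat).
Let N := max_iter lim.
Let H : int := 2 ^+ word_len lim.
Hypotheses (nN : (n + m + n * m + 3 <= N)%N) (NH : N%:Z + 8 < H).

Let dim1 (tr : bool) := if tr then m else n.
Let dim2 (tr : bool) := if tr then n else m.
Let var1 (tr : bool) := if tr then rj else ri.
Let var2 (tr : bool) := if tr then ri else rj.

Definition line_sum (tr : bool) (d : nat) (s : store) (p : nat) : int :=
  psum d (fun q => entry tr s rY p q).
Definition line_cost (tr : bool) (d : nat) (s : store) (p : nat) : int :=
  psum d (fun q => entry tr s rW p q * entry tr s rY p q).

Section Line.
Variables (tr : bool) (s : store).
Hypothesis rng : forall p q, (p < dim1 tr)%N -> (q < dim2 tr)%N ->
  0 <= entry tr s rSM p q <= 3.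
Hypothesis frac : forall p q, (p < dim1 tr)%N -> (q < dim2 tr)%N ->
  entry tr s rSM p q = code tr -> 0 < entry tr s rY p q < entry tr s rMM p q.
Hypothesis MMH : forall p q, (p < dim1 tr)%N -> (q < dim2 tr)%N ->
  entry tr s rMM p q < H.
Hypothesis W0 : forall p q, (p < dim1 tr)%N -> (q < dim2 tr)%N ->
  0 <= entry tr s rW p q.
Let d2 := dim2 tr.

Let star_regs := [:: ri; rj; rY; rhc; rcq; rlo; rhi; rt].

(** Among the first [l] children only the current one may be fractional. *)
Definition line_inv (s0 : store) (p l : nat) (s1 : store) : Prop :=
  [/\ same_but star_regs s s1,
      forall p' q' : nat, p' != p -> entry tr s1 rY p' q' = entry tr s0 rY p' q',
      forall q : nat, (l <= q)%N \/ entry tr s rSM p q <> code tr ->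
        entry tr s1 rY p q = entry tr s rY p q,
      line_sum tr d2 s1 p = line_sum tr d2 s p /\
      line_cost tr d2 s1 p <= line_cost tr d2 s p
    & [\/ s1 rhc 0 0 = 0 /\ (forall q, (q < l)%N -> entry tr s rSM p q = code tr ->
            entry tr s1 rY p q = 0 \/ entry tr s1 rY p q = entry tr s rMM p q)
        | 0 < s1 rhc 0 0 /\ exists c : nat,
            [/\ (c < l)%N, s1 rcq 0 0 = c, entry tr s rSM p c = code tr,
                0 < entry tr s1 rY p c < entry tr s rMM p c
              & forall q, (q < l)%N -> q != c -> entry tr s rSM p q = code tr ->
            entry tr s1 rY p q = 0 \/ entry tr s1 rY p q = entry tr s rMM p q]]].

Lemma line_inv_transfer (p : nat) (y : nat -> int) (lo hi : nat) (t : int) :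
  (lo < d2)%N -> (hi < d2)%N -> lo != hi -> 0 <= t ->
  entry tr s rW p lo <= entry tr s rW p hi ->
  let y' q := if q == lo then y lo + t else if q == hi then y hi - t else y q in
  psum d2 y' = psum d2 y /\
  psum d2 (fun q => entry tr s rW p q * y' q) <= psum d2 (fun q => entry tr s rW p q * y q).
Proof.
move=> lod hid ne t0 Wle y'; split.
  by rewrite /y' (psum_point (fun q => if q == hi then y hi - t else y q)) //
    (psum_point y) // (negPf ne); lia.
pose g q := entry tr s rW p q * y q.
rewrite (@eq_psum _ (fun q => entry tr s rW p q * y' q)
  (fun q => if q == lo then entry tr s rW p lo * (y lo + t)
            else if q == hi then entry tr s rW p hi * (y hi - t) else g q)).
  rewrite (psum_point (fun q => if q == hi then entry tr s rW p hi * (y hi - t) else g q)) //.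
  rewrite (psum_point g) // (negPf ne) /g; nia.
move=> q _; rewrite /y'; case: eqP => [->//|_].
by case: eqP => [->|].
Qed.

Lemma star_stepP (s0 s1 : store) (p l : nat) : (p < dim1 tr)%N -> (l < d2)%N ->
  s1 (var1 tr) 0 0 = p -> s1 (var2 tr) 0 0 = l -> line_inv s0 p l s1 ->
  wp lim (star_step tr) (line_inv s0 p l.+1) s1.
Proof.
move=> pd ld s1p s1l [fr1 other1 rest1 [sum1 cost1] cur1].
have e1 r (q : nat) : r \notin star_regs -> entry tr s1 r p q = entry tr s r p q.
  by move=> h; rewrite /entry fr1.
have yl : entry tr s1 rY p l = entry tr s rY p l by apply: rest1; left.
rewrite /star_step; cbv zeta; rewrite -/(var2 tr); set b := (X in AIf X _ _).
have nb : no_low b by rewrite /b; case: (tr).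
have tb : (0 < ev s1 b) = (entry tr s rSM p l == code tr).
  have := rng pd ld; rewrite -e1 // /b /code; move: s1p s1l; rewrite /var1 /var2 /entry.
  by case: (tr) => /= -> ->; [move: (s1 _ _ _) => x hx; apply/idP/eqP; nia|lia].
apply: wp_if; rewrite // ?tb; last first.
  rewrite leNgt tb => /eqP nc; apply: wp_skip; split => //.
    by move=> q [lq|h]; apply: rest1; [left; apply: ltnW|right].
  case: cur1 => [[hc none]|[hc [c [cl ec SMc yc none]]]]; [left|right]; split => //.
    by move=> q; rewrite ltS_eqVlt => /orP[/eqP->//|]; apply: none.
  exists c; split => //; first exact: ltnW.
  by move=> q; rewrite ltS_eqVlt => /orP[/eqP->//|]; apply: none.
move=> /eqP SMl.
have fl := frac pd ld SMl.
case: cur1 => [[hc none]|[hc [c [cl ec SMc yc none]]]].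
  apply: wp_if; rewrite //= hc // => _.
  apply/wp_seq/wp_set => //=; apply: wp_set => //=; first by rewrite /var2; case: (tr).
  set s2 := upd _ _ _ _ _.
  have Y2 (p' q' : nat) : entry tr s2 rY p' q' = entry tr s1 rY p' q' by rewrite /entry /s2 /=.
  have W2 (q : nat) : entry tr s2 rW p q = entry tr s1 rW p q by rewrite /entry /s2 /=.
  split.
  - by do 2 apply: same_but_upd => //.
  - by move=> p' q' ne; rewrite Y2 other1.
  - by move=> q [lq|h]; rewrite Y2; apply: rest1; [left; apply: ltnW|right].
  - by split => //; rewrite /line_cost.
  right; split => //; exists l; rewrite Y2 yl; split => //.
    by rewrite -s1l /s2 /= /var2; case: (tr).
  move=> q; rewrite ltS_eqVlt Y2 => /orP[/eqP->|ql _]; first by rewrite eqxx.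
  exact: none.
have cl' : c != l by rewrite ltn_eqF.
have cd : (c < d2)%N by apply: ltn_trans cl ld.
have yl' : 0 < entry tr s1 rY p l < entry tr s rMM p l by rewrite yl.
apply: wp_if; [by []|move=> _|by rewrite /= leNgt hc].
(* the costlier of the two edges gives *)
have choose : wp lim (AIf (acc tr rW (V (var2 tr)) - acc tr rW (V rcq))
   (S0 rlo (V rcq) ;; S0 rhi (V (var2 tr))) (S0 rlo (V (var2 tr)) ;; S0 rhi (V rcq)))%P
   (fun s2 => same_but [:: rlo; rhi] s1 s2 /\ exists lo hi : nat,
      [/\ s2 rlo 0 0 = lo, s2 rhi 0 0 = hi, (lo = c /\ hi = l) \/ (lo = l /\ hi = c)
        & entry tr s rW p lo <= entry tr s rW p hi]) s1.
  apply: wp_if; rewrite /= ?acc_no_low //.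
    by rewrite /= /var2; case: (tr).
    rewrite (ev_acc _ s1p s1l) (ev_acc _ s1p ec) !e1 // => h.
    apply/wp_seq/wp_set => //=; apply: wp_set => //=; first by rewrite /var2; case: (tr).
    split; first by do 2 apply: same_but_upd => //.
    exists c, l; split; [by []| |by left|by lia].
    by rewrite /= -s1l /var2; case: (tr).
  rewrite (ev_acc _ s1p s1l) (ev_acc _ s1p ec) !e1 // => h.
  apply/wp_seq/wp_set => //=; first by rewrite /var2; case: (tr).
  apply: wp_set => //=.
  split; first by do 2 apply: same_but_upd => //.
  exists l, c; split; [|by []|by right|by lia].
  by rewrite /= -s1l /var2; case: (tr).
apply: wp_seq; apply: wp_conseq choose _ => s2 _ [fr2 [lo [hi [elo ehi lohi Wle]]]].
have s2p : s2 (var1 tr) 0 0 = p by rewrite fr2 // /var1; case: (tr).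
have ne : lo != hi by case: lohi => -[-> ->] //; rewrite eq_sym.
have [lod hid] : (lo < d2)%N /\ (hi < d2)%N by case: lohi => -[-> ->].
have Y2 (p' q' : nat) : entry tr s2 rY p' q' = entry tr s1 rY p' q' by rewrite /entry fr2.
have MM2 (q : nat) : entry tr s2 rMM p q = entry tr s rMM p q by rewrite -e1 // /entry fr2.
have hlo : 0 < entry tr s1 rY p lo < entry tr s rMM p lo by case: lohi => -[-> _].
have hhi : 0 < entry tr s1 rY p hi < entry tr s rMM p hi by case: lohi => -[_ ->].
have mlo := MMH pd lod; have mhi := MMH pd hid.
have fr12 : same_but star_regs s s2.
  by apply: same_but_trans fr1 fr2 _; apply/allP.
apply: wp_conseq (mergeP nN NH s2p elo ehi ne _ _ _) _; rewrite ?Y2 ?MM2 -?/H //; try lia.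
set t := Num.min _ _ => s3 fr3 /= [Y3 cur3].
have t0 : 0 <= t by rewrite /t; lia.
have fr03 : same_but star_regs s s3.
  apply: same_but_trans fr12 fr3 _; rewrite /merge /= !acc_set_writes.
  by apply/allP.
have Y3p (q : nat) : entry tr s3 rY p q = if q == lo then entry tr s1 rY p lo + t
    else if q == hi then entry tr s1 rY p hi - t else entry tr s1 rY p q.
  by rewrite Y3 eqxx /= Y2.
have W3 (q : nat) : entry tr s3 rW p q = entry tr s rW p q by rewrite /entry fr03.
have W1 (q : nat) : entry tr s1 rW p q = entry tr s rW p q by rewrite e1.
have [sum3 cost3] := @line_inv_transfer p (fun q => entry tr s1 rY p q) lo hi t
  lod hid ne t0 Wle.
have others q : (q < l.+1)%N -> q != lo -> q != hi -> entry tr s rSM p q = code tr ->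
    entry tr s3 rY p q = 0 \/ entry tr s3 rY p q = entry tr s rMM p q.
  move=> ql n1 n2; rewrite Y3p (negPf n1) (negPf n2); move: ql n1 n2; rewrite ltS_eqVlt.
  by case: lohi => -[-> ->] /orP[/eqP->|ql]; rewrite ?eqxx // => n1 n2; apply: none.
split => //.
- by move=> p' q' np; rewrite Y3 (negPf np) /= Y2 other1.
- move=> q h; have nq : q != c /\ q != l.
    case: h => [lq|h]; first by lia.
    by split; apply: contra_notN h => /eqP->.
  have {nq}[n1 n2] : q != lo /\ q != hi by case: lohi nq => -[-> ->] [].
  rewrite Y3p (negPf n1) (negPf n2); apply: rest1.
  by case: h => [lq|h]; [left; apply: ltnW|right].
- split; first by rewrite -sum1 /line_sum -[RHS]sum3; apply: eq_psum => q _; apply: Y3p.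
  apply: le_trans cost1; rewrite /line_cost.
  rewrite (@eq_psum _ (fun q => entry tr s1 rW p q * _)
    (fun q => entry tr s rW p q * entry tr s1 rY p q)).
    apply: le_trans cost3; rewrite le_eqVlt; apply/orP; left; apply/eqP.
    by apply: eq_psum => q _; rewrite W3 Y3p.
  by move=> q _; rewrite W1.
have Ylo : entry tr s3 rY p lo = entry tr s1 rY p lo + t by rewrite Y3p eqxx.
have Yhi : entry tr s3 rY p hi = entry tr s1 rY p hi - t by rewrite Y3p eq_sym (negPf ne) eqxx.
have SMlo : entry tr s rSM p lo = code tr by case: lohi => -[-> _].
have SMhi : entry tr s rSM p hi = code tr by case: lohi => -[_ ->].
have lol : (lo < l.+1)%N by case: lohi => -[-> _] //; apply: ltnW.
have hil : (hi < l.+1)%N by case: lohi => -[_ ->] //; apply: ltnW.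
move: cur3; case: ifP => hpos [ecq ehc].
  right; split; first by rewrite ehc fr2.
  exists hi; split => //; first by rewrite Yhi; lia.
  move=> q ql nhi SMq; have [->|nlo] := eqVneq q lo; last exact: others.
  by right; rewrite Ylo; move: hpos; rewrite /t; lia.
have hi0 : entry tr s3 rY p hi = 0 by rewrite Yhi; move: hpos; rewrite /t; lia.
have [pos|npos] := ltP 0 (s3 rhc 0 0).
  right; split => //; exists lo; split => //; first by rewrite Ylo; move: pos; rewrite ehc; lia.
  move=> q ql nlo SMq; have [->|nhi] := eqVneq q hi; last exact: others.
  by left.
have lo_full : entry tr s3 rY p lo = entry tr s rMM p lo.
  by rewrite Ylo; move: npos; rewrite ehc /t; lia.
left; split; first by rewrite ehc; move: lo_full; rewrite Ylo; lia.
move=> q ql SMq; have [->|nlo] := eqVneq q lo; first by right.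
have [->|nhi] := eqVneq q hi; first by left.
exact: others.
Qed.

End Line.

(** Transfers keep the sum of a line and never raise its cost. Only the last fractional child is
    dropped, so the sum falls by less than one capacity, and dropping is free since costs are
    nonnegative. *)
Lemma starP (tr : bool) (s : store) : dims n m s ->
  (forall p q, (p < dim1 tr)%N -> (q < dim2 tr)%N -> 0 <= entry tr s rSM p q <= 3) ->
  (forall p q, (p < dim1 tr)%N -> (q < dim2 tr)%N ->
     entry tr s rSM p q = code tr -> 0 < entry tr s rY p q < entry tr s rMM p q) ->
  (forall p q, (p < dim1 tr)%N -> (q < dim2 tr)%N -> entry tr s rMM p q < H) ->
  (forall p q, (p < dim1 tr)%N -> (q < dim2 tr)%N -> 0 <= entry tr s rW p q) ->
  wp lim (star tr) (fun s' => forall p, (p < dim1 tr)%N ->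
    [/\ forall q, (q < dim2 tr)%N -> entry tr s rSM p q <> code tr ->
          entry tr s' rY p q = entry tr s rY p q,
        forall q, (q < dim2 tr)%N -> entry tr s rSM p q = code tr ->
          entry tr s' rY p q = 0 \/ entry tr s' rY p q = entry tr s rMM p q,
        line_sum tr (dim2 tr) s' p <= line_sum tr (dim2 tr) s p,
        forall M, 0 < M -> (forall q, (q < dim2 tr)%N -> entry tr s rMM p q <= M) ->
          line_sum tr (dim2 tr) s p - line_sum tr (dim2 tr) s' p < M
      & line_cost tr (dim2 tr) s' p <= line_cost tr (dim2 tr) s p]) s.
Proof.
move=> dm rng frac MMH W0.
pose b1 := if tr then rm else rn; pose b2 := if tr then rn else rm.
have d1N : (dim1 tr <= N)%N by rewrite /dim1; case: (tr); lia.
have d2N : (dim2 tr <= N)%N by rewrite /dim2; case: (tr); lia.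
have sb1 : s b1 0 0 = dim1 tr by rewrite /b1 /dim1; case: dm => ? ?; case: (tr).
have sb2 : s b2 0 0 = dim2 tr by rewrite /b2 /dim2; case: dm => ? ?; case: (tr).
have -> : star tr = AFor (var1 tr) b1
    (S0 rhc (ANum 0) ;; AFor (var2 tr) b2 (star_step tr) ;;
     AIf (V rhc) (acc_set tr rY (V rcq) (ANum 0)) ASkip)%P.
  by rewrite /star /var1 /var2 /b1 /b2; case: (tr).
pose w := [:: ri; rj; rY; rhc; rcq; rlo; rhi; rt].
have wstep : {subset writes (star_step tr) <= w}.
  by case: (tr); apply/allP.
have wbody : {subset var1 tr :: writes (S0 rhc (ANum 0) ;;
     AFor (var2 tr) b2 (star_step tr) ;;
     AIf (V rhc) (acc_set tr rY (V rcq) (ANum 0)) ASkip)%P <= w}.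
  by rewrite /var1 /var2; case: (tr); apply/allP.
have nv : (var1 tr \in w) && (var2 tr \in w) by rewrite /var1 /var2; case: (tr).
have [v1w v2w] := andP nv.
pose good (s' : store) p := [/\ forall q, (q < dim2 tr)%N -> entry tr s rSM p q <> code tr ->
          entry tr s' rY p q = entry tr s rY p q,
        forall q, (q < dim2 tr)%N -> entry tr s rSM p q = code tr ->
          entry tr s' rY p q = 0 \/ entry tr s' rY p q = entry tr s rMM p q,
        line_sum tr (dim2 tr) s' p <= line_sum tr (dim2 tr) s p,
        forall M, 0 < M -> (forall q, (q < dim2 tr)%N -> entry tr s rMM p q <= M) ->
          line_sum tr (dim2 tr) s p - line_sum tr (dim2 tr) s' p < M
      & line_cost tr (dim2 tr) s' p <= line_cost tr (dim2 tr) s p].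
have good_ext (s1 s2 : store) p : (forall q : nat, entry tr s2 rY p q = entry tr s1 rY p q) ->
    entry tr s2 rW p = entry tr s1 rW p -> good s1 p -> good s2 p.
  move=> e1 e2 [h1 h2 h3 h4 h5].
  have es : line_sum tr (dim2 tr) s2 p = line_sum tr (dim2 tr) s1 p.
    by apply: eq_psum => q _; apply: e1.
  have ec : line_cost tr (dim2 tr) s2 p = line_cost tr (dim2 tr) s1 p.
    by apply: eq_psum => q _; rewrite e1 e2.
  by split; rewrite ?es ?ec // => q qd; rewrite e1; auto.
have wE (s1 s2 : store) p : same_but w s1 s2 -> entry tr s2 rW p = entry tr s1 rW p.
  by move=> h; rewrite /entry h.
apply: (@wp_for _ (dim1 tr) (fun k s1 =>
  (forall p, (p < k)%N -> good s1 p) /\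
  (forall p q : nat, (k <= p)%N -> entry tr s1 rY p q = entry tr s rY p q))) => //.
- by have := d1N; rewrite -/H; lia.
- by rewrite /var1 /b1 /var2; case: (tr).
- by split => // p q _; rewrite /entry upd_other // /var1; case: (tr).
- move=> k s1 k1 fr1 s1v [done1 rest1].
  have {}fr1 : same_but w s s1.
    exact: same_but_sub fr1 wbody.
  apply/wp_seq/wp_set => //=; apply: wp_seq.
  set s2 := upd s1 _ _ _ _.
  have fr2 : same_but w s s2 by apply: same_but_upd.
  have Y2 (p q : nat) : entry tr s2 rY p q = entry tr s1 rY p q by rewrite /entry /s2 /=.
  apply: (@wp_for _ (dim2 tr) (fun l s3 => line_inv tr s s1 k l s3)) => //.
  + by have := d2N; rewrite -/H; lia.
  + by rewrite /var2 /b2; case: (tr).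
  + by rewrite fr2 //; rewrite /b2; case: (tr).
  + have Y3 (p q : nat) : entry tr (upd s2 (var2 tr) 0 0 0) rY p q = entry tr s1 rY p q.
      by rewrite /entry upd_other ?Y2 // /var2; case: (tr).
    have W3 (p q : nat) : entry tr (upd s2 (var2 tr) 0 0 0) rW p q = entry tr s rW p q.
      by rewrite /entry upd_other ?fr2 // /var2; case: (tr).
    split => //.
    * exact: same_but_upd.
    * by move=> q _; rewrite Y3 rest1.
    * split; first by apply: eq_psum => q _; rewrite Y3 rest1.
      rewrite le_eqVlt; apply/orP; left; apply/eqP; apply: eq_psum => q _.
      by rewrite W3 Y3 rest1.
    * by left; rewrite upd_other //= /var2; case: (tr).
  + move=> l s3 l2 fr3 s3v J3.
    have s3v1 : s3 (var1 tr) 0 0 = k.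
      rewrite fr3 ?/s2 ?upd_other //; rewrite /var1 /var2; case: (tr) => //.
    apply: wp_conseq (star_stepP rng frac MMH k1 l2 s3v1 s3v J3) _ => s4 fr4 J4.
    case: J4 => [h1 h2 h3 [h4 h5] h6].
    have eY (p q : nat) : entry tr (upd s4 (var2 tr) 0 0 l.+1) rY p q = entry tr s4 rY p q.
      by rewrite /entry upd_other // /var2; case: (tr).
    have eW p : entry tr (upd s4 (var2 tr) 0 0 l.+1) rW p = entry tr s4 rW p.
      by rewrite /entry upd_other // /var2; case: (tr).
    have ehc : upd s4 (var2 tr) 0 0 l.+1 rhc 0 0 = s4 rhc 0 0.
      by rewrite upd_other // /var2; case: (tr).
    have ecq : upd s4 (var2 tr) 0 0 l.+1 rcq 0 0 = s4 rcq 0 0.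
      by rewrite upd_other // /var2; case: (tr).
    split.
    * exact: same_but_upd.
    * by move=> p' q' np; rewrite eY h2.
    * by move=> q h; rewrite eY h3.
    * split; first by rewrite -h4; apply: eq_psum => q _; rewrite eY.
      apply: le_trans h5; rewrite le_eqVlt; apply/orP; left; apply/eqP.
      by apply: eq_psum => q _; rewrite eY eW.
    * rewrite ehc ecq; case: h6 => [[g1 g2]|[g1 [c [g2 g3 g4 g5 g6]]]]; [left|right]; split => //.
        by move=> q; rewrite eY; apply: g2.
      by exists c; rewrite eY; split => // q; rewrite eY; apply: g6.
  move=> s3 fr3 _ [fr03 other3 rest3 [sum3 cost3] cur3].
  have s3v1 : s3 (var1 tr) 0 0 = k.
    rewrite fr3 ?/s2 ?upd_other //; rewrite /var1 /var2; case: (tr) => //.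
  have W3 p : entry tr s3 rW p = entry tr s1 rW p by rewrite /entry fr03 // fr1.
  have eY (s' : store) (p q : nat) z : entry tr (upd s' (var1 tr) 0 0 z) rY p q =
      entry tr s' rY p q.
    by rewrite /entry upd_other // /var1; case: (tr).
  have eW (s' : store) p z : entry tr (upd s' (var1 tr) 0 0 z) rW p = entry tr s' rW p.
    by rewrite /entry upd_other // /var1; case: (tr).
  have finish (s4 : store) :
    (forall p q : nat, p != k -> entry tr s4 rY p q = entry tr s3 rY p q) ->
      entry tr s4 rW = entry tr s3 rW -> good s4 k ->
      (forall p, (p < k.+1)%N -> good (upd s4 (var1 tr) 0 0 k.+1) p) /\
      (forall p q : nat, (k.+1 <= p)%N ->
         entry tr (upd s4 (var1 tr) 0 0 k.+1) rY p q = entry tr s rY p q).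
    move=> e4 w4 g4; split=> [p|p q kp].
      rewrite ltS_eqVlt => /orP[/eqP->|pk].
        by apply: good_ext g4; [move=> q; rewrite eY|rewrite eW].
      apply: (good_ext s1); last exact: done1.
        by move=> q; rewrite eY e4 ?ltn_eqF // other3 ?ltn_eqF.
      by rewrite eW w4 W3.
    rewrite eY e4 ?gtn_eqF // other3 ?gtn_eqF // rest1 //; exact: ltnW.
  case: cur3 => [[hc none]|[hc [c [cd ec SMc yc none]]]].
    apply: wp_if => //=; rewrite hc // => _; apply: wp_skip; apply: finish => //.
    split => //.
    + by move=> q qd h; apply: rest3; right.
    + by rewrite sum3.
    + by move=> M M0 _; rewrite sum3 subrr.
  apply: wp_if => //=; last by rewrite leNgt hc.
  move=> _; apply: (wp_acc_set s3v1 ec) => //=.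
  set s4 := upd_entry _ _ _ _ _ _.
  have Y4 (p q : nat) : entry tr s4 rY p q =
      if (p == k) && (q == c) then 0 else entry tr s3 rY p q by rewrite /s4 entry_upd eqxx.
  have W4 : entry tr s4 rW = entry tr s3 rW.
    by apply/funext => p; apply/funext => q; rewrite /entry /s4 upd_entry_other.
  apply: finish => //; first by move=> p q np; rewrite Y4 (negPf np).
  have sum4 : line_sum tr (dim2 tr) s4 k = line_sum tr (dim2 tr) s k - entry tr s3 rY k c.
    have := psum_point (fun q => entry tr s3 rY k q) 0 cd; rewrite sub0r -sum3 => <-.
    by apply: eq_psum => q _; rewrite Y4 eqxx.
  split.
  + move=> q qd h; rewrite Y4 eqxx /=; case: eqP => [e|_]; last by apply: rest3; right.
    by rewrite e in h.
  + move=> q qd h; rewrite Y4 eqxx /=; have [_|nc] := eqVneq q c; first by left.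
    exact: none.
  + by rewrite sum4; lia.
  + move=> M M0 hM; rewrite sum4; have := hM c cd; lia.
  + apply: le_trans cost3; apply: le_psum => q qd; rewrite W4 Y4 eqxx /=.
    case: eqP => [->|_] //; rewrite mulr0 mulr_ge0 //; last by lia.
    by have := W0 k c k1 cd; rewrite /entry fr03.
by move=> s1 fr1 _ [h _] p pd; apply: h.
Qed.

End StarCorrect.

(** * Perturbed costs make tight edges a forest *)

Lemma card_disjoint_le (T : finType) (A B C : {set T}) :
  (forall x, x \in A -> x \notin B) -> A \subset C -> B \subset C ->
  (#|A| + #|B| <= #|C|)%N.
Proof.
move=> dis AC BC; rewrite -finset.cardsUI (_ : A :&: B = finset.set0).
  by rewrite finset.cards0 addn0 subset_leq_card // finset.subUset AC.
apply/finset.setP => x; rewrite !inE; apply/negbTE/negP => /andP[xA xB].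
by have := dis x xA; rewrite xB.
Qed.

Section Forest.
Variables (n m : nat) (idx : nat -> nat -> nat) (u v : nat -> int) (K : nat).
Hypothesis idx_inj : forall i j i' j', (i < n)%N -> (j < m)%N -> (i' < n)%N ->
  (j' < m)%N -> idx i j = idx i' j' -> i = i' /\ j = j'.

(** If [u i + v j] is [2 ^ idx i j] modulo [2 ^ K] on all edges, then the edge
    of least index [t] is a bridge: modulo [2 ^ t.+1] it is the only edge whose
    ends carry different values [u i] and [- v j]. *)
Lemma forest_card (E : {set 'I_n * 'I_m}) : E != finset.set0 ->
  (forall e, e \in E -> (idx e.1 e.2 < K)%N /\
     (2 ^+ K %| u e.1 + v e.2 - 2 ^+ idx e.1 e.2)%Z) ->
  (#|E| < #|fst @: E| + #|snd @: E|)%N.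
Proof.
have [k] := ubnP #|E|; elim: k E => // k IH E Ek E0 hE.
have [e1 e1E] := finset.set0Pn _ E0.
pose e0 := [arg min_(e < e1 in E) idx e.1 e.2].
have [e0E e0min] : e0 \in E /\ forall e, e \in E -> (idx e0.1 e0.2 <= idx e.1 e.2)%N.
  by rewrite /e0; case: arg_minnP.
set t := idx e0.1 e0.2; pose d : int := 2 ^+ t.+1.
have tK : (t < K)%N by case: (hE e0 e0E).
have dK : (d %| 2 ^+ K)%Z by rewrite /d -(subnK tK) exprD dvdz_mull.
(* By minimality and injectivity of [idx], every other edge has an index above [t], so its
   perturbation vanishes modulo [d]. *)
have other e : e \in E -> e != e0 -> (d %| u e.1 + v e.2)%Z.
  move=> eE ne; have [_ /(dvdz_trans dK) h] := hE e eE.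
  have lt_t : (t < idx e.1 e.2)%N.
    rewrite ltn_neqAle e0min // andbT; apply: contraNneq ne => ei.
    have [h1 h2] := idx_inj (ltn_ord _) (ltn_ord _) (ltn_ord _) (ltn_ord _) ei.
    by rewrite [e]surjective_pairing [e0]surjective_pairing xpair_eqE -!val_eqE /= h1 h2 !eqxx.
  have h2 : (d %| 2 ^+ idx e.1 e.2)%Z by rewrite /d dvdz_exp2l.
  by have := rpredD h h2; rewrite subrK.
have e0_ndvd : ~~ (d %| v e0.2 + u e0.1)%Z.
  have [_ /(dvdz_trans dK) h] := hE e0 e0E; apply/negP => h2.
  have := rpredB h2 h; rewrite opprB addrC [v _ + _]addrC subrK.
  by rewrite -/t /d dvdz_Pexp2l ?ltnn.
(* Each remaining edge has [u] and [- v] congruent modulo [d], so this residue is constant on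
   connected pieces. Comparing it with that of [e0.1] separates the two sides of the bridge, which
   share no node. *)
pose near_e0 (e : 'I_n * 'I_m) := (d %| u e.1 - u e0.1)%Z.
pose E1 := finset [pred e in E | (e != e0) && near_e0 e].
pose E2 := finset [pred e in E | (e != e0) && ~~ near_e0 e].
have inE1 e : (e \in E1) = [&& e \in E, e != e0 & near_e0 e] by rewrite inE.
have inE2 e : (e \in E2) = [&& e \in E, e != e0 & ~~ near_e0 e] by rewrite inE.
have cardE : #|E| = (1 + (#|E1| + #|E2|))%N.
  have <- : (E :\ e0) :&: finset near_e0 = E1.
    by apply/finset.setP => e; rewrite inE1 !inE -andbA andbCA.
  have <- : (E :\ e0) :\: finset near_e0 = E2.
    by apply/finset.setP => e; rewrite inE2 !inE andbCA [_ && (e \in E)]andbC andbCA.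
  by rewrite (finset.cardsD1 e0) e0E finset.cardsID.
have sub1 : E1 \subset E by apply/fintype.subsetP => e; rewrite inE1 => /and3P[].
have sub2 : E2 \subset E by apply/fintype.subsetP => e; rewrite inE2 => /and3P[].
have lt1 : (#|E1| < k)%N by move: Ek; rewrite cardE; lia.
have lt2 : (#|E2| < k)%N by move: Ek; rewrite cardE; lia.
have v_near e : e \in E1 -> (d %| v e.2 + u e0.1)%Z.
  rewrite inE1 => /and3P[eE ne near].
  have -> : v e.2 + u e0.1 = (u e.1 + v e.2) - (u e.1 - u e0.1) by ring.
  exact: rpredB (other e eE ne) near.
have v_far e : e \in E2 -> ~~ (d %| v e.2 + u e0.1)%Z.
  rewrite inE2 => /and3P[eE ne]; apply: contra => h; rewrite /near_e0.
  have -> : u e.1 - u e0.1 = (u e.1 + v e.2) - (v e.2 + u e0.1) by ring.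
  exact: rpredB (other e eE ne) h.
have u_near e : e \in E1 -> (d %| u e.1 - u e0.1)%Z by rewrite inE1 => /and3P[].
have u_far e : e \in E2 -> ~~ (d %| u e.1 - u e0.1)%Z by rewrite inE2 => /and3P[].
(* Each side also receives its end of [e0] and is thus nonempty even without edges. Each then has at
   least one node more than edges, by induction or because it has no edge; adding [e0] leaves one
   node to spare. *)
pose F1 := e0.1 |: (fst @: E1); pose F2 := fst @: E2.
pose G1 := snd @: E1; pose G2 := e0.2 |: (snd @: E2).
have cF : (#|F1| + #|F2| <= #|fst @: E|)%N.
  apply: card_disjoint_le; last exact: finset.imsetS.
    move=> x; rewrite !inE => /orP[/eqP->|/finset.imsetP[e eE1 ->]].
      by apply/finset.imsetP => -[e /u_far h ei]; move: h; rewrite -ei subrr rpred0.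
    apply/finset.imsetP => -[e' /u_far h ei]; move: h; rewrite -ei.
    by rewrite u_near.
  by rewrite finset.subUset finset.sub1set finset.imset_f // finset.imsetS.
have cG : (#|G1| + #|G2| <= #|snd @: E|)%N.
  apply: card_disjoint_le; first last.
  - by rewrite finset.subUset finset.sub1set finset.imset_f // finset.imsetS.
  - exact: finset.imsetS.
  move=> x /finset.imsetP[e /v_near h1 ->]; rewrite !inE negb_or; apply/andP; split.
    by apply: contraNneq e0_ndvd => <-.
  apply/finset.imsetP => -[e' /v_far h2 ei]; move: h2; rewrite -ei.
  by rewrite h1.
have F1_gt0 : (0 < #|F1|)%N by apply/card_gt0P; exists e0.1; rewrite !inE eqxx.
have G2_gt0 : (0 < #|G2|)%N by apply/card_gt0P; exists e0.2; rewrite !inE eqxx.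
have F1_ge : (#|fst @: E1| <= #|F1|)%N by rewrite subset_leq_card // finset.subsetUr.
have G2_ge : (#|snd @: E2| <= #|G2|)%N by rewrite subset_leq_card // finset.subsetUr.
have IH1 : E1 != finset.set0 -> (#|E1| < #|fst @: E1| + #|G1|)%N.
  by move=> ne; apply: IH => // e /(fintype.subsetP sub1); apply: hE.
have IH2 : E2 != finset.set0 -> (#|E2| < #|F2| + #|snd @: E2|)%N.
  by move=> ne; apply: IH => // e /(fintype.subsetP sub2); apply: hE.
rewrite cardE; move: IH1 IH2; rewrite -!finset.card_gt0.
move: cF cG F1_gt0 G2_gt0 F1_ge G2_ge; clear.
case: (posnP #|E1|) => [e|p]; case: (posnP #|E2|) => [e'|p'] h3 h4 h5 h6 h7 h8 h1 h2.
- by lia.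
- by have := h2 isT; lia.
- by have := h1 isT; lia.
- by have := h1 isT; have := h2 isT; lia.
Qed.

(** Without a leaf every node in use has degree at least 2, so the sources and the sinks in use each
    number at most half of the edges, which contradicts [forest_card]. *)
Lemma forest_leaf (P : nat -> nat -> Prop) :
  (forall i j, P i j -> [/\ (i < n)%N, (j < m)%N, (idx i j < K)%N
     & (2 ^+ K %| u i + v j - 2 ^+ idx i j)%Z]) ->
  (exists i j, P i j) ->
  exists i j, P i j /\
    ((forall j', P i j' -> j' = j) \/ (forall i', P i' j -> i' = i)).
Proof.
move=> hP [i0 [j0 P0]]; apply: contrapT => none.
pose E := finset [pred e : 'I_n * 'I_m | `[< P e.1 e.2 >]].
have inE' e : (e \in E) = `[< P e.1 e.2 >] by rewrite inE.
have E0 : E != finset.set0.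
  have [i0n j0m _ _] := hP _ _ P0; apply/finset.set0Pn.
  by exists (Ordinal i0n, Ordinal j0m); rewrite inE'; apply/asboolP.
have := forest_card E0; rewrite ltnNge => /(_ _)/negP; apply.
  by move=> e; rewrite inE' => /asboolP /hP[].
have fibers (T : finType) (f : 'I_n * 'I_m -> T) :
    (forall e, e \in E -> exists2 e', e' \in E & e' != e /\ f e' = f e) ->
    (2 * #|f @: E| <= #|E|)%N.
  move=> two; rewrite -[#|E|]sum1_card (finset.partition_big_imset f) /=.
  rewrite mulnC -sum_nat_const; apply: leq_sum => x /finset.imsetP[e eE ->].
  have [e' e'E [ne fe]] := two e eE; rewrite (bigD1 e) ?eE ?eqxx //=.
  by rewrite (bigD1 e') ?e'E ?fe ?eqxx //= add1n.
have two1 : (2 * #|fst @: E| <= #|E|)%N.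
  apply: fibers => e; rewrite inE' => /asboolP Pe.
  apply: contrapT => no; apply: none; exists e.1, e.2; split => //; left => j' Pj'.
  have [_ j'm _ _] := hP _ _ Pj'; apply: contrapT => ne; apply: no.
  exists (e.1, Ordinal j'm); first by rewrite inE'; apply/asboolP.
  split => //; apply/eqP => ee; apply: ne; by rewrite -ee.
have two2 : (2 * #|snd @: E| <= #|E|)%N.
  apply: fibers => e; rewrite inE' => /asboolP Pe.
  apply: contrapT => no; apply: none; exists e.1, e.2; split => //; right => i' Pi'.
  have [i'n _ _ _] := hP _ _ Pi'; apply: contrapT => ne; apply: no.
  exists (Ordinal i'n, e.2); first by rewrite inE'; apply/asboolP.
  split => //; apply/eqP => ee; apply: ne; by rewrite -ee.
have aux (a b c : nat) : (2 * a <= c)%N -> (2 * b <= c)%N -> (a + b <= c)%N by lia.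
exact: aux two1 two2.
Qed.

End Forest.

(** * Reading the instance *)

Notation rS := 44%N.
Notation rK := 45%N.
Notation rpw := 46%N.
Notation rL := 47%N.
Notation rnm := 48%N.
Notation rf := 49%N.
Notation rw := 50%N.

Definition low (e : aexp) : aexp := AGet 0 e (ANum 0).

Definition read_sizes : acmd :=
  (S0 rn (low (ANum 0)) ;; S0 rm (low (ANum 1)) ;;
   S0 rnm (ANum 2 * (V rn * V rm)) ;; S0 rf (ANum 2 + V rn + V rm) ;;
   S0 rL (V rf + ANum 2 * V rnm))%P.

Definition read_nodes : acmd :=
  (AFor ri rn (S1 rA (V ri) (low (ANum 2 + V ri))) ;;
   AFor rj rm (S1 rB (V rj) (low (ANum 2 + V rn + V rj))))%P.

(** A multiple of all denominators and capacities is wanted. Multiplying all positive entries of the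
    word, numerators and dimensions included, is simpler than selecting, and the product still has
    polynomial length. *)
Definition common_multiple : acmd :=
  (S0 rS (ANum 1) ;;
   AFor ri rL (AIf (low (V ri)) (S0 rS (V rS * low (V ri))) ASkip))%P.

Definition two_power : acmd :=
  (S0 rK (ANum 1) ;; AFor ri rn (AFor rj rm (S0 rK (V rK + V rK))))%P.

Definition edge_cost : acmd :=
  (AIf (G1 rA (V ri) - G1 rB (V rj))
     (ASet rMM (V ri) (V rj) (G1 rB (V rj))) (ASet rMM (V ri) (V rj) (G1 rA (V ri))) ;;
   S0 rw ((V rS * low (V rf)) / (low (V rf + ANum 1) * AGet rMM (V ri) (V rj))
          + (V rS * low (V rf + V rnm)) / low (V rf + V rnm + ANum 1)) ;;
   AIf (V rw) (ASet rW (V ri) (V rj) (V rK * V rw + V rpw)) ASkip ;;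
   S0 rpw (V rpw + V rpw) ;; S0 rf (V rf + ANum 2))%P.

Definition edge_costs : acmd :=
  (S0 rpw (ANum 1) ;; AFor ri rn (AFor rj rm edge_cost))%P.

Definition read_instance : acmd :=
  (read_sizes ;; read_nodes ;; common_multiple ;; two_power ;; edge_costs)%P.

Fixpoint pos_prod (f : nat -> int) (k : nat) : int :=
  if k is k'.+1 then pos_prod f k' * (if 0 < f k' then f k' else 1) else 1.

Lemma pos_prod_ge1 f k : 1 <= pos_prod f k.
Proof. by elim: k => //= k IH; case: ifP; nia. Qed.

Lemma pos_prod_mono f k l : (k <= l)%N -> pos_prod f k <= pos_prod f l.
Proof.
elim: l => [|l IH]; first by rewrite leqn0 => /eqP->.
rewrite leq_eqVlt => /orP[/eqP->//|kl]; apply: le_trans (IH kl) _ => /=.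
by have := pos_prod_ge1 f l; case: ifP; nia.
Qed.

Lemma pos_prod_dvd f k i : (i < k)%N -> 0 < f i -> (f i %| pos_prod f k)%Z.
Proof.
elim: k => //= k IH; rewrite ltS_eqVlt => /orP[/eqP->|ik] fi; last first.
  by rewrite dvdz_mulr // IH.
by rewrite fi dvdz_mull.
Qed.

(** This handles the divisor formed by the denominator of a fixed cost and a capacity, which are two
    different entries of the word. *)
Lemma pos_prod_dvd2 f k i j : (i < k)%N -> (j < k)%N -> i != j ->
  0 < f i -> 0 < f j -> (f i * f j %| pos_prod f k)%Z.
Proof.
elim: k => //= k IH; rewrite !ltS_eqVlt => /orP[/eqP->|ik] /orP[/eqP->|jk] ne fi fj.
- by rewrite eqxx in ne.
- by rewrite fi mulrC dvdz_mul // pos_prod_dvd.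
- by rewrite fj dvdz_mul // pos_prod_dvd.
- by rewrite dvdz_mulr // IH.
Qed.

Lemma pos_prod_ge f k i : (i < k)%N -> f i <= pos_prod f k.
Proof.
move=> ik; have [fi|fi] := ltP 0 (f i); last first.
  by apply: le_trans fi _; have := pos_prod_ge1 f k; lia.
have /dvdzP[q e] := pos_prod_dvd ik fi; have S1 := pos_prod_ge1 f k.
have q1 : 0 < q by rewrite -(pmulr_lgt0 _ fi) -e; lia.
by rewrite e ler_peMl ?(ltW fi).
Qed.

Section ReadLogic.
Variable lim : limits.

Lemma wp_set_read r e1 e2 e Q s : [&& r != 0%N, no_low e1 & no_low e2] ->
  low_ok (low_len lim) s e -> small_exp e || (`|ev s e| < 2 ^+ word_len lim) ->
  Q (upd s r (ev s e1) (ev s e2) (ev s e)) -> wp lim (ASet r e1 e2 e) Q s.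
Proof.
case/and3P=> r0 n1 n2 le sm q; split => //=; split; last by split.
by rewrite !no_low_ok // r0.
Qed.

Lemma wp_if_read e c1 c2 Q s : low_ok (low_len lim) s e ->
  (0 < ev s e -> wp lim c1 Q s) -> (ev s e <= 0 -> wp lim c2 Q s) ->
  wp lim (AIf e c1 c2) Q s.
Proof. by rewrite /wp /= => -> h1 h2; case: ltP => [/h1|/h2] []. Qed.

End ReadLogic.

Lemma edge_index n m i j : (i < n)%N -> (j < m)%N -> (i * m + j < n * m)%N.
Proof. nia. Qed.

Section ReadInstance.
Variables (lim : limits) (n m : nat) (f : nat -> int).
Let N := max_iter lim.
Let H : int := 2 ^+ word_len lim.
Let len := low_len lim.
Let base := (2 + n + m)%N.
Let S := pos_prod f len.
Hypotheses (lenE : len = (base + 4 * (n * m))%N) (lenN : (len + 3 <= N)%N)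
  (NH : N%:Z + 8 < H).
Hypotheses (f_n : f 0 = n) (f_m : f 1 = m)
  (f_ge0 : forall k, (k < len)%N -> 0 <= f k)
  (f_node : forall k, (1 < k < base)%N -> 0 < f k)
  (f_den : forall k, (base + (2 * k).+1 < len)%N -> 0 < f (base + (2 * k).+1)).
Hypothesis SH : 2 ^+ (n * m) * (2 * S * S + 1) < H.

Definition has_word (s : store) := forall k, (k < len)%N -> s 0%N k%:Z 0 = f k.

Definition cap i j := Num.min (f (2 + i)) (f (2 + n + j)).
(** This is [S] times the price: for encoded instances both divisions are exact. Fixed costs start
    at [base], linear costs [2 * (n * m)] cells later, numerators before denominators. *)
Definition unit_cost i j : int :=
  let k := (base + 2 * (i * m + j))%N in
  ((S * f k) %/ (f k.+1 * cap i j))%Z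
  + ((S * f (k + 2 * (n * m))%N) %/ f (k + 2 * (n * m)).+1)%Z.
(** Modulo [2 ^+ (n * m)] only the power identifying the edge remains, which [forest_leaf] needs.
    Free edges stay free, since a perturbation there could not be charged to any price. *)
Definition pert_cost i j : int :=
  if 0 < unit_cost i j then 2 ^+ (n * m) * unit_cost i j + 2 ^+ (i * m + j) else 0.

Lemma cap_gt0 i j : (i < n)%N -> (j < m)%N -> 0 < cap i j.
Proof. by move=> iN jm; rewrite lt_min !f_node /base; lia. Qed.

(** Each entry of the word is at most [S], so each of the two quotients is at most its numerator and
    hence at most [S * S]. *)
Lemma unit_cost_bounds i j : (i < n)%N -> (j < m)%N -> 0 <= unit_cost i j <= 2 * S * S.
Proof.
move=> iN jm; have idx := edge_index iN jm; have c0 := cap_gt0 iN jm.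
have S1 : 1 <= S := pos_prod_ge1 f len.
have term k d : (k < len)%N -> 0 < d -> 0 <= ((S * f k) %/ d)%Z <= S * S.
  move=> kl d0; have fk0 := f_ge0 kl; have fkS : f k <= S := pos_prod_ge f kl.
  have p0 : 0 <= S * f k by nia.
  rewrite divz_ge0 // p0 /=; apply: le_trans (divz_le_self p0 d0) _; nia.
rewrite /unit_cost; set k := (base + _)%N.
have d1 : 0 < f k.+1 by rewrite /k -addnS f_den // lenE; lia.
have d2 : 0 < f (k + 2 * (n * m)).+1.
  have -> : (k + 2 * (n * m)).+1 = (base + (2 * (i * m + j + n * m)).+1)%N by rewrite /k; lia.
  by rewrite f_den // lenE; lia.
have := @term k (f k.+1 * cap i j); have := @term (k + 2 * (n * m))%N (f (k + 2 * (n * m)).+1).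
move: (_ %/ _)%Z (_ %/ _)%Z => x y h1 h2.
have h3 := h1 _ d2; have h4 := h2 _ (mulr_gt0 d1 c0).
have k1 : (k < len)%N by rewrite /k lenE; lia.
have k2 : (k + 2 * (n * m) < len)%N by rewrite /k lenE; lia.
by have := h3 k2; have := h4 k1; lia.
Qed.

Lemma read_sizesP s : has_word s ->
  wp lim read_sizes (fun s' => [/\ dims n m s', s' rnm 0 0 = (2 * (n * m))%N,
    s' rf 0 0 = base & s' rL 0 0 = len]) s.
Proof.
move=> hw.
have l2 : (2 <= len)%N by rewrite lenE /base; lia.
have nmN : (4 * (n * m) + base <= N)%N by move: lenN; rewrite lenE; lia.
have h0 : s 0%N 0 0 = n by rewrite (hw 0) //; lia.
have h1 : s 0%N 1 0 = m by rewrite (hw 1) //; lia.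
apply/wp_seq/wp_set_read => //=; first by lia.
rewrite h0; apply/wp_seq/wp_set_read => //=; first by lia.
rewrite h1; apply/wp_seq/wp_set => //=; first by rewrite -/H; nia.
apply/wp_seq/wp_set => //=; first by move: nmN; rewrite /base -/H; lia.
apply: wp_set => //=; first by move: nmN; rewrite /base -/H; nia.
by split => //; rewrite ?lenE /base; lia.
Qed.

Let nmN : (n * m + n + m + 3 <= N)%N.
Proof. by move: lenN; rewrite lenE /base; lia. Qed.

Let pow_ge1 k : 1 <= 2 ^+ k :> int. Proof. by rewrite exprn_ege1. Qed.

Let S_ge1 : 1 <= S. Proof. exact: pos_prod_ge1. Qed.

Let SSH : 2 * S * S + 1 < H.
Proof. by have := pow_ge1 (n * m); have := SH; have := S_ge1; nia. Qed.

Let S_lt : S < H.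
Proof. by have := S_ge1; have := SSH; nia. Qed.

Let pow_lt k : (k <= n * m)%N -> 2 ^+ k < H :> int.
Proof.
move=> km; have : 2 ^+ k <= 2 ^+ (n * m) :> int by rewrite ler_weXn2l.
by have := SH; have := S_ge1; have := pow_ge1 (n * m); nia.
Qed.

Let f_lt k : (k < len)%N -> f k < H.
Proof. by move=> kl; apply: le_lt_trans S_lt; apply: pos_prod_ge. Qed.

Lemma has_word_ext w s s' : has_word s -> same_but w s s' -> 0%N \notin w ->
  has_word s'.
Proof. by move=> hw fr h k kl; rewrite fr // hw. Qed.

Lemma read_nodesP s : has_word s -> dims n m s ->
  wp lim read_nodes (fun s' => (forall i, (i < n)%N -> s' rA i 0 = f (2 + i)) /\
    (forall j, (j < m)%N -> s' rB j 0 = f (2 + n + j))) s.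
Proof.
move=> hw [dn dm].
apply: wp_seq; apply: (@wp_for _ n (fun k s1 => forall i, (i < k)%N ->
  s1 rA i 0 = f (2 + i))) => //=; try lia.
  move=> k s1 kn fr1 s1i I1.
  have kl : (2 + k < len)%N by rewrite lenE /base; lia.
  have rd : s1 0%N (2 + s1 ri 0 0) 0 = f (2 + k).
    by rewrite s1i fr1 // (_ : 2 + k%:Z = (2 + k)%N%:Z) ?hw //; lia.
  apply: wp_set_read => //=; first by rewrite s1i; lia.
  rewrite s1i in rd *; move=> i; rewrite eqz_nat andbT rd ltS_eqVlt.
  by have [->//|ne /=] := eqVneq i k; apply: I1.
move=> s1 fr1 _ I1.
apply: (@wp_for _ m (fun k s2 => forall j, (j < k)%N ->
  s2 rB j 0 = f (2 + n + j))) => //=; try lia.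
- by rewrite fr1.
- move=> k s2 km fr2 s2j I2.
  have kl : (2 + n + k < len)%N by rewrite lenE /base; lia.
  have s2n : s2 rn 0 0 = n by rewrite fr2 // fr1.
  have rd : s2 0%N (2 + s2 rn 0 0 + s2 rj 0 0) 0 = f (2 + n + k).
    rewrite s2j s2n fr2 // fr1 // (_ : 2 + n%:Z + k%:Z = (2 + n + k)%N%:Z) ?hw //; lia.
  apply: wp_set_read => //=; first by rewrite s2j s2n; lia.
  rewrite s2j s2n in rd *; move=> j; rewrite eqz_nat andbT rd ltS_eqVlt.
  by have [->//|ne /=] := eqVneq j k; apply: I2.
move=> s2 fr2 _ I2; split => // i iN; by rewrite fr2 // I1.
Qed.

Lemma common_multipleP s : has_word s -> s rL 0 0 = len ->
  wp lim common_multiple (fun s' => s' rS 0 0 = S) s.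
Proof.
move=> hw sL; apply/wp_seq/wp_set => //=.
apply: (@wp_for _ len (fun k s1 => s1 rS 0 0 = pos_prod f k)) => //=; try lia.
move=> k s1 kl fr1 s1i I1.
have rd : s1 0%N (s1 ri 0 0) 0 = f k by rewrite s1i fr1 //= hw.
have le_S : pos_prod f k.+1 <= S by apply: pos_prod_mono.
have ge1 := pos_prod_ge1 f k.+1.
apply: wp_if_read => /=; first by rewrite s1i; lia.
  rewrite rd => pos; move: le_S ge1; rewrite /= pos => le_S ge1.
  apply: wp_set_read => //=; first by rewrite s1i; lia.
    by rewrite rd I1 -/H; have := S_lt; lia.
  by rewrite rd I1 ?pos.
by rewrite rd => neg; apply: wp_skip; rewrite /= ltNge neg mulr1.
Qed.

Lemma two_powerP s : dims n m s ->
  wp lim two_power (fun s' => s' rK 0 0 = 2 ^+ (n * m)) s.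
Proof.
move=> [dn dm]; apply/wp_seq/wp_set => //=.
apply: (@wp_for _ n (fun k s1 => s1 rK 0 0 = 2 ^+ (k * m))) => //=; try lia.
move=> k s1 kn fr1 s1i K1.
apply: (@wp_for _ m (fun l s2 => s2 rK 0 0 = 2 ^+ (k * m + l))) => //=; try lia.
- by rewrite fr1.
- by rewrite addn0.
- move=> l s2 lm fr2 s2j K2.
  have e : 2 ^+ (k * m + l) + 2 ^+ (k * m + l) = 2 ^+ (k * m + l.+1) :> int.
    by rewrite addnS exprS; lia.
  apply: wp_set => //=; rewrite K2 e // -/H ger0_norm ?exprn_ge0 // pow_lt //.
  by have := edge_index kn lm; lia.
- by move=> s2 _ _ ->; rewrite mulSn addnC.
Qed.

Lemma edge_costsP s : has_word s -> dims n m s ->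
  [/\ s rnm 0 0 = (2 * (n * m))%N, s rf 0 0 = base, s rS 0 0 = S
    & s rK 0 0 = 2 ^+ (n * m)] ->
  (forall i, (i < n)%N -> s rA i 0 = f (2 + i)) ->
  (forall j, (j < m)%N -> s rB j 0 = f (2 + n + j)) ->
  (forall i j, (i < n)%N -> (j < m)%N -> s rW i j = 0) ->
  wp lim edge_costs (fun s' => forall i j, (i < n)%N -> (j < m)%N ->
    s' rMM i j = cap i j /\ s' rW i j = pert_cost i j) s.
Proof.
move=> hw [dn dm] [snm sf sS sK] hA hB W0.
apply/wp_seq/wp_set => //=.
pose Inv (k l : nat) (s1 : store) := [/\ s1 rpw 0 0 = 2 ^+ (k * m + l),
  s1 rf 0 0 = (base + 2 * (k * m + l))%N
  & forall i j, (i < n)%N -> (j < m)%N ->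
     if (i < k)%N || ((i == k) && (j < l)%N) then
       s1 rMM i j = cap i j /\ s1 rW i j = pert_cost i j
     else s1 rW i j = 0].
apply: (@wp_for _ n (fun k s1 => Inv k 0%N s1)) => //=; try lia.
- split=> [//||i j iN jm] /=; first by rewrite sf addn0 muln0 addn0.
  by rewrite ltn0 andbF W0.
- move=> k s1 kn fr1 s1i Inv1.
  apply: (@wp_for _ m (fun l s2 => Inv k l s2)) => //=; try lia.
  - by rewrite fr1.
  - move=> l s2 lm fr2 s2j [pw2 f2 val2].
    have s2i : s2 ri 0 0 = k by rewrite fr2.
    have idx := edge_index kn lm.
    set e := (base + 2 * (k * m + l))%N in f2.
    have e1 : (e.+1 < len)%N by rewrite /e lenE; lia.
    have e2 : ((e + 2 * (n * m)).+1 < len)%N by rewrite /e lenE; lia.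
    have S2 : s2 rS 0 0 = S by rewrite fr2 // fr1.
    have K2 : s2 rK 0 0 = 2 ^+ (n * m) by rewrite fr2 // fr1.
    have nm2 : s2 rnm 0 0 = (2 * (n * m))%N by rewrite fr2 // fr1.
    have A2 : s2 rA k 0 = f (2 + k) by rewrite fr2 // fr1 //= hA.
    have B2 : s2 rB l 0 = f (2 + n + l) by rewrite fr2 // fr1 //= hB.
    have W2 : s2 rW k l = 0 by have := val2 k l kn lm; rewrite !ltnn eqxx.
    have low2 q : (q < len)%N -> s2 0%N q%:Z 0 = f q by move=> ql; rewrite fr2 // fr1 //= hw.
    have c_lt : `|cap k l| < H.
      have c0 : 0 < cap k l.
        by rewrite lt_min !f_node /base; lia.
      have h : f (2 + k) < H by apply: f_lt; rewrite lenE /base; lia.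
      by rewrite /cap in c0 *; lia.
    have set_cap : wp lim (AIf (G1 rA (V ri) - G1 rB (V rj))
        (ASet rMM (V ri) (V rj) (G1 rB (V rj))) (ASet rMM (V ri) (V rj) (G1 rA (V ri))))%P
        (fun s3 => s3 = upd s2 rMM k l (cap k l)) s2.
      apply: wp_if => //=; rewrite s2i s2j A2 B2 => h; apply: wp_set => //=;
      rewrite s2i s2j ?A2 ?B2; congr upd; rewrite /cap; lia.
    apply: wp_seq; apply: wp_conseq set_cap _ => s3 _ ->.
    have [u0 uS] := andP (unit_cost_bounds kn lm).
    rewrite -/len -/S in u0 uS.
    have [l0 l1 l2 l3] : [/\ s2 0%N (s2 rf 0 0) 0 = f e,
        s2 0%N (s2 rf 0 0 + 1) 0 = f e.+1,
        s2 0%N (s2 rf 0 0 + s2 rnm 0 0) 0 = f (e + 2 * (n * m))%N &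
        s2 0%N (s2 rf 0 0 + s2 rnm 0 0 + 1) 0 = f (e + 2 * (n * m)).+1].
      rewrite f2 nm2; split.
      + by apply: low2; lia.
      + by rewrite (_ : e%:Z + 1 = e.+1%:Z) ?low2 //; lia.
      + by rewrite (_ : e%:Z + (2 * (n * m))%N%:Z = (e + 2 * (n * m))%N%:Z) ?low2 //; lia.
      + by rewrite (_ : e%:Z + (2 * (n * m))%N%:Z + 1 = (e + 2 * (n * m)).+1%:Z) ?low2 //; lia.
    have uH : unit_cost k l < H by have := SSH; lia.
    set s4 := upd s2 rMM k l (cap k l).
    have eval_w : ev s4 ((V rS * low (V rf)) / (low (V rf + ANum 1) * AGet rMM (V ri) (V rj))
          + (V rS * low (V rf + V rnm)) / low (V rf + V rnm + ANum 1))%P = unit_cost k l.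
      rewrite /s4 /= s2i s2j !eqxx /= S2 l0 l1 l2 l3 /unit_cost -/e.
      by rewrite -[(base + 2 * _ + _)%N]/(e + 2 * (n * m))%N.
    apply: wp_seq; apply: wp_set_read => //.
    + by rewrite /s4 /= f2 nm2; lia.
    + by rewrite eval_w -/H; lia.
    rewrite eval_w; set s5 := upd s4 _ _ _ _.
    have step_W : wp lim (AIf (V rw) (ASet rW (V ri) (V rj) (V rK * V rw + V rpw)) ASkip)%P
        (fun s6 => [/\ same_but [:: rW] s5 s6, s6 rW k l = pert_cost k l &
           forall i j : nat, (i, j) != (k, l) -> s6 rW i j = s2 rW i j]) s5.
      apply: wp_if => //=; rewrite /pert_cost => pos.
        have val : s5 rK 0 0 * s5 rw 0 0 + s5 rpw 0 0 = pert_cost k l.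
          by rewrite /s5 /s4 /= K2 pw2 /pert_cost pos.
        have hp : 2 ^+ (k * m + l) <= 2 ^+ (n * m) :> int.
          by rewrite ler_weXn2l // ltnW.
        have p1 := pow_ge1 (k * m + l).
        apply: wp_set => //=.
          rewrite val /pert_cost pos -/H; have := SH.
          by have := pow_ge1 (n * m); nia.
        have i5 : s5 ri 0 0 = k by rewrite /s5 /s4 /= s2i.
        have j5 : s5 rj 0 0 = l by rewrite /s5 /s4 /= s2j.
        rewrite i5 j5 val; split => [||i j].
        * exact: same_but_upd.
        * by rewrite /= !eqxx /= /pert_cost pos.
        * by rewrite xpair_eqE /= !eqz_nat => /negPf ->.
      have npos : (0 < unit_cost k l) = false by apply/negbTE; rewrite -leNgt.
      by apply: wp_skip; rewrite npos; split.
    apply: wp_seq; apply: wp_conseq step_W _ => s6 _ [fr6 W6 W6'].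
    have pw6 : s6 rpw 0 0 = 2 ^+ (k * m + l) by rewrite fr6.
    have f6 : s6 rf 0 0 = e by rewrite fr6.
    have dbl : 2 ^+ (k * m + l) + 2 ^+ (k * m + l) = 2 ^+ (k * m + l.+1) :> int.
      by rewrite addnS exprS; lia.
    apply/wp_seq/wp_set => //=; rewrite pw6 dbl.
      by rewrite -/H ger0_norm ?exprn_ge0 // pow_lt // addnS.
    apply: wp_set => //=; rewrite f6; first by rewrite -/H; lia.
    split => //=; first by rewrite /e; lia.
    move=> i j iN jm /=; have := val2 i j iN jm.
    have M6 : s6 rMM i j = if (i == k) && (j == l) then cap k l else s2 rMM i j.
      by rewrite fr6 // /s5 /s4 /= !eqz_nat.
    rewrite M6; have [->|ni] := eqVneq i k; last by rewrite /= W6' // xpair_eqE (negPf ni).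
    rewrite ltnn /= ltS_eqVlt; have [->|nj] /= := eqVneq j l.
      by rewrite W6.
    by rewrite W6' // xpair_eqE (negPf nj) andbF.
  - move=> s2 fr2 _ [pw2 f2 val2]; split => /=.
    + by rewrite pw2 mulSn addn0 addnC.
    + by rewrite f2 mulSn; lia.
    + move=> i j iN jm; have := val2 i j iN jm; rewrite /= andbF orbF jm andbT ltS_eqVlt.
      by rewrite orbC.
move=> s1 fr1 _ [_ _ val1] i j iN jm; have := val1 i j iN jm; by rewrite iN.
Qed.

Lemma read_instanceP s : has_word s ->
  (forall i j, (i < n)%N -> (j < m)%N -> s rW i j = 0) ->
  wp lim read_instance (fun s' => [/\ dims n m s',
    forall i, (i < n)%N -> s' rA i 0 = f (2 + i),
    forall j, (j < m)%N -> s' rB j 0 = f (2 + n + j)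
    & forall i j, (i < n)%N -> (j < m)%N ->
        s' rMM i j = cap i j /\ s' rW i j = pert_cost i j]) s.
Proof.
move=> hw W0.
apply: wp_seq; apply: wp_conseq (read_sizesP hw) _ => s1 fr1 [d1 nm1 rf1 rL1].
have hw1 : has_word s1 by apply: has_word_ext hw fr1 _.
apply: wp_seq; apply: wp_conseq (read_nodesP hw1 d1) _ => s2 fr2 [A2 B2].
have hw2 : has_word s2 by apply: has_word_ext hw1 fr2 _.
have rL2 : s2 rL 0 0 = len by rewrite fr2.
apply: wp_seq; apply: wp_conseq (common_multipleP hw2 rL2) _ => s3 fr3 S3.
have hw3 : has_word s3 by apply: has_word_ext hw2 fr3 _.
have d3 : dims n m s3 by rewrite /dims !fr3 // !fr2.
apply: wp_seq; apply: wp_conseq (two_powerP d3) _ => s4 fr4 K4.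
have hw4 : has_word s4 by apply: has_word_ext hw3 fr4 _.
have d4 : dims n m s4 by rewrite /dims !fr4.
apply: wp_conseq (edge_costsP hw4 d4 _ _ _ _) _.
- by split; [rewrite fr4 // fr3 // fr2|rewrite fr4 // fr3 // fr2|rewrite fr4|].
- by move=> i iN; rewrite fr4 // fr3 // A2.
- by move=> j jm; rewrite fr4 // fr3 // B2.
- by move=> i j iN jm; rewrite fr4 // fr3 // fr2 // fr1 // W0.
move=> s5 fr5 val5; split => //.
- by rewrite /dims !fr5.
- by move=> i iN; rewrite fr5 // fr4 // fr3 // A2.
- by move=> j jm; rewrite fr5 // fr4 // fr3 // B2.
Qed.


End ReadInstance.

(** * The whole program *)

Definition init_round (K : int) : acmd :=
  AFor ri rn (AFor rj rm
    (ASet rY (V ri) (V rj) (ANum K * AGet rX (V ri) (V rj)) ;;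
     AIf (AGet rW (V ri) (V rj))
       (AIf (AGet rX (V ri) (V rj))
          (AIf (AGet rMM (V ri) (V rj) - AGet rY (V ri) (V rj))
             (ASet rSM (V ri) (V rj) (ANum 1)) ASkip) ASkip) ASkip))%P.

(** The output overwrites the input word, which is long enough and no longer needed. Entries are
    left as unreduced fractions [a i * y i j] over the row sum, so exact supplies need no
    division. *)
Definition write_output : acmd :=
  (S0 rf (ANum 0) ;;
   AFor ri rn
     (S0 rcnt (ANum 0) ;;
      AFor rj rm (S0 rcnt (V rcnt + AGet rY (V ri) (V rj))) ;;
      AFor rj rm
        (ASet 0 (V rf) (ANum 0) (G1 rA (V ri) * AGet rY (V ri) (V rj)) ;;
         ASet 0 (V rf + ANum 1) (ANum 0) (V rcnt) ;;
         S0 rf (V rf + ANum 2))))%P.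

Definition main_program (K : int) : acmd :=
  (read_instance ;; hungarian ;; init_round K ;; orient ;; star false ;;
   star true ;; write_output)%P.

Lemma wp_set_low lim e1 e Q s : no_low e1 -> no_low e ->
  0 <= ev s e1 < (low_len lim)%:Z -> `|ev s e| < 2 ^+ word_len lim ->
  Q (upd s 0%N (ev s e1) 0 (ev s e)) -> wp lim (ASet 0 e1 (ANum 0) e) Q s.
Proof.
move=> n1 n2 rng sm q; split => //=; rewrite !no_low_ok // rng eqxx /=.
by split => //; split => //; rewrite sm orbT.
Qed.

(** This applies to a node in its role as a child: among its edges only the one to its parent
    changes. *)
Lemma psum_change1 n (f g : nat -> int) M : 0 < M ->
  (forall q, (q < n)%N -> `|g q - f q| < M) ->
  (forall q q', (q < n)%N -> (q' < n)%N -> f q != g q -> f q' != g q' -> q' = q) ->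
  `|psum n g - psum n f| < M.
Proof.
move=> M0 lt uniq; have [[q [qn ne]]|same] := pselect (exists q, (q < n)%N /\ f q != g q).
  rewrite (@eq_psum n g (fun i => if i == q then g q else f i)) => [|i iN].
    by rewrite psum_point // addrC addKr lt.
  case: eqP => [->//|/eqP iq]; apply/esym/eqP; apply: contraNT iq => ne'.
  by rewrite (uniq q i).
rewrite (@eq_psum n g f) ?subrr ?normr0 // => q qn; apply/esym/eqP/negPn/negP => ne.
by apply: same; exists q.
Qed.

Section MainProgram.
Variables (lim : limits) (n m : nat).
Let N := max_iter lim.
Let H : int := 2 ^+ word_len lim.
Let len := low_len lim.
Hypotheses (nN : (n + m + n * m + 3 <= N)%N) (NH : N%:Z + 8 < H).
Variable K : int.

Definition small (s : store) (i j : nat) : bool :=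
  [&& 0 < s rW i j, 0 < s rX i j & K * s rX i j < s rMM i j].

Lemma init_roundP s : dims n m s ->
  (forall i j, (i < n)%N -> (j < m)%N -> s rSM i j = 0) ->
  (forall i j, (i < n)%N -> (j < m)%N -> `|K * s rX i j| < H) ->
  wp lim (init_round K) (fun s' => forall i j, (i < n)%N -> (j < m)%N ->
    s' rY i j = K * s rX i j /\ s' rSM i j = (small s i j)%:Z) s.
Proof.
move=> [dn dm] SM0 XH.
pose Inv (k l : nat) (s1 : store) := forall i j, (i < n)%N -> (j < m)%N ->
  if (i < k)%N || ((i == k) && (j < l)%N) then
    s1 rY i j = K * s rX i j /\ s1 rSM i j = (small s i j)%:Z else s1 rSM i j = 0.
apply: (@wp_for _ n (fun k s1 => Inv k 0%N s1)) => //=; try lia.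
- by move=> i j iN jm /=; rewrite andbF SM0.
- move=> k s1 kn fr1 s1i Inv1.
  apply: (@wp_for _ m (fun l s2 => Inv k l s2)) => //=; try lia.
  + by rewrite fr1.
  + move=> l s2 lm fr2 s2j Inv2.
    have s2i : s2 ri 0 0 = k by rewrite fr2.
    have X2 : s2 rX k l = s rX k l by rewrite fr2 // fr1.
    have W2 : s2 rW k l = s rW k l by rewrite fr2 // fr1.
    have M2 : s2 rMM k l = s rMM k l by rewrite fr2 // fr1.
    have SM2 : s2 rSM k l = 0 by have := Inv2 k l kn lm; rewrite !ltnn eqxx.
    apply/wp_seq/wp_set => //=; rewrite s2i s2j X2; first exact: XH.
    set s3 := upd s2 _ _ _ _.
    have Y3 (i j : nat) : s3 rY i j = if (i == k) && (j == l) then K * s rX k l else s2 rY i j.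
      by rewrite /s3 /= !eqz_nat.
    have skip : small s k l = false -> Inv k l.+1 (upd s3 rj 0 0 l.+1).
      move=> ns i j iN jm; have := Inv2 i j iN jm.
      rewrite [upd s3 _ _ _ _ rY i j]Y3 -[upd s3 _ _ _ _ rSM i j]/(s2 rSM i j).
      have [->|//] := eqVneq i k; rewrite ltnn /= ltS_eqVlt.
      by have [->|//] := eqVneq j l; rewrite ltnn SM2 ns.
    have i3 : s3 ri 0 0 = k by [].
    have j3 : s3 rj 0 0 = l by [].
    have X3 : s3 rX k l = s rX k l by [].
    have W3 : s3 rW k l = s rW k l by [].
    have M3 : s3 rMM k l = s rMM k l by [].
    have Yk : s3 rY k l = K * s rX k l by rewrite Y3 !eqxx.
    apply: wp_if => //=; rewrite i3 j3 W3 => hW; last first.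
      by apply/wp_skip/skip; rewrite /small ltNge hW.
    apply: wp_if => //=; rewrite i3 j3 X3 => hX; last first.
      by apply/wp_skip/skip; rewrite /small [0 < s rX _ _]ltNge hX andbF.
    apply: wp_if => //=; rewrite i3 j3 M3 Yk => hM; last first.
      apply/wp_skip/skip; rewrite /small [_ < s rMM _ _]ltNge -subr_le0 hM.
      by rewrite !andbF.
    apply: wp_set => //=; rewrite i3 j3; set s4 := upd s3 _ _ _ _.
    have sm : small s k l by rewrite /small hW hX -subr_gt0.
    move=> i j iN jm; have := Inv2 i j iN jm.
    rewrite -[upd s4 _ _ _ _ rY i j]/(s3 rY i j) Y3 -[upd s4 _ _ _ _ rSM i j]/(s4 rSM i j).
    have -> : s4 rSM i j = if (i == k) && (j == l) then 1 else s2 rSM i j.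
      by rewrite /s4 /= !eqz_nat.
    have [->|//] := eqVneq i k; rewrite ltnn /= ltS_eqVlt.
    by have [->|//] := eqVneq j l; rewrite ltnn sm.
  + move=> s2 fr2 _ Inv2 i j iN jm /=; have := Inv2 i j iN jm.
    by rewrite jm andbT andbF orbF ltS_eqVlt orbC.
by move=> s1 fr1 _ Inv1 i j iN jm; have := Inv1 i j iN jm; rewrite iN.
Qed.

Lemma write_outputP s : dims n m s -> (2 * (n * m) <= len)%N ->
  (2 * (n * m) + 2 <= N)%N ->
  (forall i j, (i < n)%N -> (j < m)%N -> 0 <= s rY i j) ->
  (forall i, (i < n)%N -> row_sum m s rY i < H) ->
  (forall i j, (i < n)%N -> (j < m)%N -> `|s rA i 0 * s rY i j| < H) ->
  wp lim write_output (fun s' => forall i j, (i < n)%N -> (j < m)%N ->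
    s' 0%N (2 * (i * m + j))%N%:Z 0 = s rA i 0 * s rY i j /\
    s' 0%N (2 * (i * m + j)).+1%:Z 0 = row_sum m s rY i) s.
Proof.
move=> [dn dm] lenB NB Y0 rowH AYH.
have row_pre i l : (i < n)%N -> (l <= m)%N ->
    0 <= psum l (fun j => s rY i j) <= row_sum m s rY i.
  move=> iN lm; rewrite psum_ge0 => [|j jl]; last by rewrite Y0 //; lia.
  by rewrite psum_le_prefix // => j jm; rewrite Y0.
apply/wp_seq/wp_set => //=.
pose Inv (k l : nat) (s1 : store) := s1 rf 0 0 = (2 * (k * m + l))%N /\
  forall i j, (i < n)%N -> (j < m)%N -> (i < k)%N || ((i == k) && (j < l)%N) ->
    s1 0%N (2 * (i * m + j))%N%:Z 0 = s rA i 0 * s rY i j /\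
    s1 0%N (2 * (i * m + j)).+1%:Z 0 = row_sum m s rY i.
apply: (@wp_for _ n (fun k s1 => Inv k 0%N s1)) => //=; try lia.
- by split=> //= i j iN jm; rewrite andbF.
- move=> k s1 kn fr1 s1i [f1 Inv1].
  apply/wp_seq/wp_set => //=; apply: wp_seq.
  apply: (@wp_for _ m (fun l s2 => s2 rcnt 0 0 = psum l (fun j => s rY k j))) => //=; try lia.
  + by rewrite fr1.
  + by rewrite psum0.
  + move=> l s2 lm fr2 s2j c2; have h := row_pre k l.+1 kn lm.
    have Y2 : s2 rY (s2 ri 0 0) (s2 rj 0 0) = s rY k l.
      by rewrite s2j fr2 // fr2 //= s1i fr1.
    apply: wp_set => //=; rewrite c2 Y2 -(psumS l (fun j => s rY k j)) // -/H.
    by have := rowH k kn; lia.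
  move=> s2 fr2 _ c2.
  have s2i : s2 ri 0 0 = k by rewrite fr2.
  apply: (@wp_for _ m (fun l s3 => Inv k l s3)) => //=; try lia.
  + by rewrite fr2 //= fr1.
  + split=> [|i j iN jm h] /=; first by rewrite fr2 //= f1.
    by rewrite fr2 //=; apply: Inv1.
  + move=> l s3 lm fr3 s3j [f3 Inv3].
    have idx := edge_index kn lm.
    have s3i : s3 ri 0 0 = k by rewrite fr3.
    have A3 : s3 rA k 0 = s rA k 0 by rewrite fr3 // fr2 //= fr1.
    have Y3 : s3 rY k l = s rY k l by rewrite fr3 // fr2 //= fr1.
    have c3 : s3 rcnt 0 0 = row_sum m s rY k by rewrite fr3.
    have rk := row_pre k m kn (leqnn _).
    apply: wp_seq; apply: wp_set_low => //=; rewrite ?f3 ?s3i ?s3j ?A3 ?Y3 -?/len.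
    * by lia.
    * exact: AYH.
    apply: wp_seq; apply: wp_set_low => //=; rewrite ?f3 ?c3 -?/len.
    * by lia.
    * by have := rowH k kn; rewrite -/H -/(row_sum m s rY k) in rk *; lia.
    apply: wp_set => //=; rewrite f3; first by rewrite -/H; lia.
    split=> [|i j iN jm /=]; first by rewrite /=; lia.
    rewrite ltS_eqVlt andb_orr orbA => h.
    have idx' := edge_index iN jm.
    have [/andP[/eqP ei /eqP ej]|ne] := boolP ((i == k) && (j == l)).
      subst i j; set q := (2 * (k * m + l))%N.
      have e1 : (q%:Z == q%:Z + 1) = false by apply/eqP; lia.
      have e2 : (q.+1%:Z == q%:Z + 1) = true by apply/eqP; lia.
      by rewrite e1 e2 !eqxx /=; split.
    have old : (i < k)%N || ((i == k) && (j < l)%N) by move: h; rewrite orbAC (negPf ne) orbF.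
    have lt_idx : (i * m + j < k * m + l)%N.
      case/orP: old => [ik|/andP[/eqP-> jl]]; last by lia.
      have : ((i * m + m) <= k * m)%N by rewrite -mulSnr leq_mul2r ik orbT.
      by lia.
    have [h1 h2] := Inv3 i j iN jm old.
    by split; rewrite !ifN ?h1 ?h2 // andbT; apply/eqP; lia.
  + move=> s3 fr3 _ [f3 Inv3]; split=> [|i j iN jm] /=.
      by rewrite f3 mulSn; lia.
    rewrite andbF orbF ltS_eqVlt => h; apply: Inv3 => //.
    by rewrite jm andbT orbC.
by move=> s1 fr1 _ [_ Inv1] i j iN jm; apply: Inv1; rewrite // iN.
Qed.

End MainProgram.

Section MainCorrect.
Variables (lim : limits) (n m : nat) (f : nat -> int).
Let N := max_iter lim.
Let H : int := 2 ^+ word_len lim.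
Let len := low_len lim.
Let base := (2 + n + m)%N.
Let S := pos_prod f len.
Let wmax : int := 2 ^+ (n * m) * (2 * S * S + 1).
Variables (K tot : int) (T : nat).
Hypotheses (lenE : len = (base + 4 * (n * m))%N) (lenN : (len + 3 <= N)%N)
  (NH : N%:Z + 8 < H).
Hypotheses (f_n : f 0 = n) (f_m : f 1 = m)
  (f_ge0 : forall k, (k < len)%N -> 0 <= f k)
  (f_node : forall k, (1 < k < base)%N -> 0 < f k)
  (f_den : forall k, (base + (2 * k).+1 < len)%N -> 0 < f (base + (2 * k).+1)).
Hypotheses (totA : psum n (fun i => f (2 + i)) = tot)
  (totB : psum m (fun j => f (2 + n + j)) = tot).
Hypotheses (K4 : 4 <= K) (totT : tot < 2 ^+ T) (TN : (T <= N)%N)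
  (TH : (K + 2) * 2 ^+ T * 2 ^+ T + 1 < H)
  (dualH : 4 ^+ (m * (n + m) * T) * wmax < H).

Let cst := pert_cost lim n m f.
Let cp := cap n f.
Let a i := f (2 + i).
Let b j := f (2 + n + j).

Definition small_edge (x : nat -> nat -> int) i j : bool :=
  [&& 0 < cst i j, 0 < x i j & K * x i j < cp i j].

(** Optimality is recorded as complementary slackness; minimality is drawn from it in
    [optimal_flow_le]. *)
Definition optimal_flow (x : nat -> nat -> int) (u v : nat -> int) : Prop :=
  [/\ forall i j, (i < n)%N -> (j < m)%N -> 0 <= x i j /\ u i + v j <= cst i j,
      forall i j, (i < n)%N -> (j < m)%N -> 0 < x i j -> u i + v j = cst i j,
      forall i, (i < n)%N -> psum m (x i) = a i
    & forall j, (j < m)%N -> psum n (x^~ j) = b j].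

Definition rounded_flow (x y : nat -> nat -> int) : Prop :=
  [/\ forall i j, (i < n)%N -> (j < m)%N ->
        if small_edge x i j then y i j = 0 \/ y i j = cp i j else y i j = K * x i j,
      forall i, (i < n)%N -> (K - 2) * a i <= psum m (y i) <= (K + 2) * a i,
      forall j, (j < m)%N -> (K - 2) * b j <= psum n (y^~ j) <= (K + 2) * b j
    & psum n (fun i => psum m (fun j => cst i j * y i j)) <=
      K * psum n (fun i => psum m (fun j => cst i j * x i j))].

Let nmN : (n + m + n * m + 3 <= N)%N.
Proof. by move: lenN; rewrite lenE /base; clear; lia. Qed.

Let a_gt0 i : (i < n)%N -> 0 < a i.
Proof. by move=> iN; apply: f_node; rewrite /base; clear - iN; lia. Qed.

Let b_gt0 j : (j < m)%N -> 0 < b j.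
Proof. by move=> jm; apply: f_node; rewrite /base; clear - jm; lia. Qed.

Let cp_gt0 i j : (i < n)%N -> (j < m)%N -> 0 < cp i j.
Proof.
move=> iN jm; have := a_gt0 iN; have := b_gt0 jm; rewrite /cp /cap -/(a i) -/(b j).
by clear; lia.
Qed.

Let cp_le i j : cp i j <= a i /\ cp i j <= b j.
Proof. by rewrite /cp /cap -/(a i) -/(b j); clear; lia. Qed.

Let a_le i : (i < n)%N -> a i <= tot.
Proof.
move=> iN; rewrite -totA; apply: (@psum_ge n i a) => // k kn; exact/ltW/a_gt0.
Qed.

Let tot_ge0 : 0 <= tot.
Proof. by rewrite -totA psum_ge0 // => i iN; apply/ltW/a_gt0. Qed.

Let T_ge1 : 1 <= 2 ^+ T :> int. Proof. by rewrite exprn_ege1. Qed.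

Let tot_lt : tot < H.
Proof.
by have := T_ge1; have := totT; have := TH; have := K4; clear; move: (2 ^+ T) H => t h; nia.
Qed.

(** The first bound is for row sums of the rounded flow, the second for the numerators [a i * y i j]
    of the output. *)
Let Ktot_lt : (K + 2) * tot < H /\ (K + 2) * tot * tot < H.
Proof.
have := T_ge1; have := totT; have := TH; have := K4; have := tot_ge0; clear.
move: (2 ^+ T) H => t h h1 h2 h3 h4 h5.
have h6 : (K + 2) * tot <= (K + 2) * t by nia.
have h7 : (K + 2) * tot * tot <= (K + 2) * t * t by apply: ler_pM; nia.
by split; nia.
Qed.

Let one_wmax : 1 <= wmax.
Proof.
have p1 : 1 <= 2 ^+ (n * m) :> int by rewrite exprn_ege1.
have := pos_prod_ge1 f len; rewrite -/S /wmax => S1.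
by move: p1 S1; clear; move: (2 ^+ _) => p; nia.
Qed.

Let wmaxH : wmax < H.
Proof.
have p1 : 1 <= 4 ^+ (m * (n + m) * T) :> int by rewrite exprn_ege1.
by have := one_wmax; have := dualH; move: p1; clear; move: (4 ^+ _) => p; nia.
Qed.

Let unit_bounds i j (iN : (i < n)%N) (jm : (j < m)%N) :=
  unit_cost_bounds lenE lenN NH f_n f_m f_ge0 f_node f_den wmaxH iN jm.

Let cst_bounds i j : (i < n)%N -> (j < m)%N -> 0 <= cst i j <= wmax.
Proof.
move=> iN jm; have := unit_bounds iN jm; rewrite -/len -/S /cst /pert_cost.
have p1 : 0 <= (2 ^+ (i * m + j) : int) <= 2 ^+ (n * m).
  by rewrite exprn_ge0 //= ler_weXn2l // ltnW // edge_index.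
have p2 : 1 <= 2 ^+ (n * m) :> int by rewrite exprn_ege1.
have := one_wmax; rewrite /wmax.
case: ifP => _; first by move: p1 p2; clear; move: (2 ^+ _) (2 ^+ _) => p q; nia.
by clear; lia.
Qed.

Lemma main_programP s : has_word lim f s ->
  (forall r i j, r != 0%N -> s r i j = 0) ->
  wp lim (main_program K) (fun s' => dims n m s' /\ exists x y u v,
    [/\ optimal_flow x u v, rounded_flow x y &
      forall i j, (i < n)%N -> (j < m)%N ->
        s' 0%N (2 * (i * m + j))%N%:Z 0 = a i * y i j /\
        s' 0%N (2 * (i * m + j)).+1%:Z 0 = psum m (y i)]) s.
Proof.
move=> hw zero.
have nm3 : (n + m + 3 <= N)%N by move: nmN; clear; lia.
have NH' : N%:Z < H by move: NH; clear; lia.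
apply: wp_seq; apply: wp_conseq (read_instanceP lenE lenN NH f_n f_m f_ge0 f_node
  f_den wmaxH hw _) _.
  by move=> *; apply: zero.
move=> s1 fr1 [dm1 A1 B1 MW1].
have MM1 i j : (i < n)%N -> (j < m)%N -> s1 rMM i j = cp i j.
  by move=> iN jm; case: (MW1 i j iN jm).
have W1 i j : (i < n)%N -> (j < m)%N -> s1 rW i j = cst i j.
  by move=> iN jm; case: (MW1 i j iN jm).
have z1 r i j : r \in [:: rX; rU; rVd; rE; rD; rET; rDT; rSM] -> s1 r i j = 0.
  by rewrite !inE => h; rewrite fr1 ?zero //; do ?case/orP: h => [/eqP->//|h]; move/eqP: h => ->.
have val1 : valid_input n m tot s1.
  split => //.
  - by move=> i iN; rewrite A1 // a_gt0.
  - by move=> j jm; rewrite B1 // b_gt0.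
  - by rewrite -totA; apply: eq_psum => i iN; apply: A1.
  - by rewrite -totB; apply: eq_psum => j jm; apply: B1.
apply: wp_seq; apply: wp_conseq (hungarianP nm3 NH'
  (f := wmax) (T := T) val1 _ _ _ _ _ _ _ _) _ => //.
- by split=> *; apply: z1.
- by split=> *; apply: z1.
- by move=> i j iN jm; rewrite W1 // cst_bounds.
- rewrite -/H; have := T_ge1; have := TH; have := K4; clear.
  by move: (2 ^+ T) H => t h; nia.
move=> s2 fr2 [feas2 tight2 row2 col2].
pose x i j := s2 rX (i : nat) (j : nat).
pose u i := s2 rU (i : nat) 0; pose v j := s2 rVd (j : nat) 0.
have W2 i j : (i < n)%N -> (j < m)%N -> s2 rW i j = cst i j.
  by move=> iN jm; rewrite fr2 // W1.
have MM2 i j : (i < n)%N -> (j < m)%N -> s2 rMM i j = cp i j.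
  by move=> iN jm; rewrite fr2 // MM1.
have opt : optimal_flow x u v.
  split.
  - by move=> i j iN jm; have [h _] := tight2 i j iN jm; split => //; rewrite -W2 //; apply: feas2.
  - by move=> i j iN jm pos; have [_ h] := tight2 i j iN jm; rewrite -W2 //; apply: h.
  - by move=> i iN; rewrite -[LHS]/(row_sum m s2 rX i) row2 // A1.
  - by move=> j jm; rewrite -[LHS]/(col_sum n s2 rX j) col2 // B1.
have [opt1 opt2 opt3 opt4] := opt.
have x_le i j : (i < n)%N -> (j < m)%N -> 0 <= x i j <= tot.
  move=> iN jm; have [-> _] := opt1 i j iN jm; rewrite (le_trans _ (a_le iN)) // -opt3 //.
  by apply: (@psum_ge m j (x i)) => // k km; case: (opt1 i k iN km).
have dm2 : dims n m s2 by rewrite /dims !fr2.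
apply: wp_seq; apply: wp_conseq (init_roundP nmN NH (K := K) (s := s2) _ _ _) _ => //.
- by move=> i j iN jm; rewrite fr2 // z1.
- move=> i j iN jm; have := x_le i j iN jm; rewrite -/(x i j).
  have [h1 _] := Ktot_lt; rewrite -/H; move: h1 K4; clear; move: H (x i j) => h z *.
  by rewrite ger0_norm; nia.
move=> s3 fr3 YS3.
have sm3 i j : (i < n)%N -> (j < m)%N -> small K s2 i j = small_edge x i j.
  by move=> iN jm; rewrite /small /small_edge W2 // MM2.
have Y3 i j : (i < n)%N -> (j < m)%N -> s3 rY i j = K * x i j.
  by move=> iN jm; case: (YS3 i j iN jm).
have SM3 i j : (i < n)%N -> (j < m)%N -> s3 rSM i j = (small_edge x i j)%:Z.
  by move=> iN jm; rewrite -sm3 //; case: (YS3 i j iN jm).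
have dm3 : dims n m s3 by rewrite /dims !fr3.
apply: wp_seq; apply: wp_conseq (orientP nmN NH (s := s3) dm3 _ _) _.
- by move=> i j iN jm; rewrite SM3 //; case: (small_edge x i j).
- move=> E hE exE; apply: (@forest_leaf n m (fun i j => i * m + j)%N u v (n * m)) => //.
    move=> i j i' j' iN jm iN' jm' e; have ei : i = i' by clear - jm jm' e; nia.
    by split => //; move: e; rewrite ei => /addnI.
  move=> i j Eij; have [iN jm] := hE i j Eij; rewrite SM3 //.
  case: (boolP (small_edge x i j)) => // /and3P[c0 x0 _] _; split => //.
    exact: edge_index.
  (* Tightness turns [u i + v j] into the perturbed cost, whose first summand is a multiple of
     [2 ^+ (n * m)]. *)
  rewrite opt2 //; move: c0; rewrite /cst /pert_cost; case: ifP => // _ _.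
  by rewrite addrK dvdz_mulr.
move=> s4 fr4 [SM4 src4 snk4].
have {}SM4 i j : (i < n)%N -> (j < m)%N ->
    if small_edge x i j then s4 rSM i j = 2 \/ s4 rSM i j = 3 else s4 rSM i j = 0.
  by move=> iN jm; have := SM4 i j iN jm; rewrite SM3 //; case: (small_edge x i j).
have Y4 i j : (i < n)%N -> (j < m)%N -> s4 rY i j = K * x i j.
  by move=> iN jm; rewrite fr4 // Y3.
have W4 i j : (i < n)%N -> (j < m)%N -> s4 rW i j = cst i j.
  by move=> iN jm; rewrite fr4 // fr3 // W2.
have MM4 i j : (i < n)%N -> (j < m)%N -> s4 rMM i j = cp i j.
  by move=> iN jm; rewrite fr4 // fr3 // MM2.
have rng4 i j : (i < n)%N -> (j < m)%N -> 0 <= s4 rSM i j <= 3.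
  by move=> iN jm; have := SM4 i j iN jm; case: ifP => _ => [[->|->]|->].
have frac4 i j : (i < n)%N -> (j < m)%N -> 0 < s4 rSM i j -> 0 < K * x i j < cp i j.
  move=> iN jm; have := SM4 i j iN jm; case: ifP => [/and3P[_ x0 xc] _ _|_ -> //].
  by rewrite xc mulr_gt0 //; move: K4; clear; lia.
have cpH i j : (i < n)%N -> (j < m)%N -> cp i j < H.
  move=> iN jm; apply: le_lt_trans tot_lt; apply: le_trans (a_le iN).
  by case: (cp_le i j).
have dm4 : dims n m s4 by rewrite /dims !fr4.
apply: wp_seq; apply: wp_conseq (@starP lim n m nmN NH false s4 dm4 _ _ _ _) _ => //.
- by move=> i j iN jm e; rewrite /entry Y4 // MM4 //; apply: frac4; rewrite // [s4 _ _ _]e.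
- by move=> i j iN jm; rewrite /entry MM4 // cpH.
- by move=> i j iN jm; rewrite /entry W4 //; case/andP: (cst_bounds iN jm).
move=> s5 fr5; rewrite /entry /code => star5.
have SM5 : s5 rSM = s4 rSM by rewrite fr5.
have W5 i j : (i < n)%N -> (j < m)%N -> s5 rW i j = cst i j.
  by move=> iN jm; rewrite fr5 // W4.
have MM5 i j : (i < n)%N -> (j < m)%N -> s5 rMM i j = cp i j.
  by move=> iN jm; rewrite fr5 // MM4.
have keep5 i j : (i < n)%N -> (j < m)%N -> s4 rSM i j <> 3 -> s5 rY i j = K * x i j.
  by move=> iN jm ne; have [h _ _ _ _] := star5 i iN; rewrite h // Y4.
have done5 i j : (i < n)%N -> (j < m)%N -> s4 rSM i j = 3 -> s5 rY i j = 0 \/ s5 rY i j = cp i j.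
  by move=> iN jm e; have [_ h _ _ _] := star5 i iN; rewrite -MM4 //; apply: h.
have dm5 : dims n m s5 by rewrite /dims !fr5.
apply: wp_seq; apply: wp_conseq (@starP lim n m nmN NH true s5 dm5 _ _ _ _) _ => //.
- by move=> j i jm iN; rewrite /entry SM5; apply: rng4.
- move=> j i jm iN; rewrite /entry SM5 /code => e; rewrite keep5 // ?e // MM5 //.
  by apply: frac4; rewrite // e.
- by move=> j i jm iN; rewrite /entry MM5 // cpH.
- by move=> j i jm iN; rewrite /entry W5 //; case/andP: (cst_bounds iN jm).
move=> s6 fr6; rewrite /entry /code SM5 => star6.
pose y i j := s6 rY (i : nat) (j : nat).
have keep6 i j : (i < n)%N -> (j < m)%N -> s4 rSM i j <> 2 -> y i j = s5 rY i j.
  by move=> iN jm ne; have [h _ _ _ _] := star6 j jm; apply: h.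
have done6 i j : (i < n)%N -> (j < m)%N -> s4 rSM i j = 2 -> y i j = 0 \/ y i j = cp i j.
  by move=> iN jm e; have [_ h _ _ _] := star6 j jm; rewrite -MM5 //; apply: h.
(* An edge pushed from strictly inside to 0 or to its capacity changes by less than the capacity,
   hence by less than the supply and the demand at its ends. *)
have near5 i j : (i < n)%N -> (j < m)%N -> `|s5 rY i j - s4 rY i j| < b j.
  move=> iN jm; have [e|ne] := eqVneq (s4 rSM i j) 3; last first.
    by rewrite keep5 ?Y4 ?subrr ?normr0 ?b_gt0 //; apply/eqP.
  have := frac4 i j iN jm; rewrite e Y4 // => /(_ isT); have [_ hb] := cp_le i j.
  by move: hb; case: (done5 i j iN jm e) => ->; clear; lia.
have near6 i j : (i < n)%N -> (j < m)%N -> `|y i j - s5 rY i j| < a i.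
  move=> iN jm; have [e|ne] := eqVneq (s4 rSM i j) 2; last first.
    by rewrite keep6 ?subrr ?normr0 ?a_gt0 //; apply/eqP.
  have := frac4 i j iN jm; rewrite keep5 ?e // => /(_ isT); have [ha _] := cp_le i j.
  by move: ha; case: (done6 i j iN jm e) => ->; clear; lia.
have rowK i : (i < n)%N -> psum m (fun j => s4 rY i j) = K * a i.
  by move=> iN; rewrite -opt3 // -psumZ; apply: eq_psum => j jm; apply: Y4.
have colK j : (j < m)%N -> psum n (fun i => s4 rY i j) = K * b j.
  by move=> jm; rewrite -opt4 // -psumZ; apply: eq_psum => i iN; apply: Y4.
(* A source loses one dropped edge as a parent in the first pass, and as a child it changes in one
   edge in the second pass; for sinks the passes are exchanged. Each contribution is below the
   supply or demand, which gives [K - 2] and [K + 2]. *)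
have row5 i : (i < n)%N -> K * a i - a i < psum m (fun j => s5 rY i j) <= K * a i.
  move=> iN; have [_ _ h1 h2 _] := star5 i iN; rewrite /line_sum /= rowK // in h1 h2.
  rewrite h1 andbT ltrBlDr -ltrBlDl; apply: h2; first exact: a_gt0.
  by move=> j jm; rewrite MM4 //; case: (cp_le i j).
have row6 i : (i < n)%N -> `|psum m (y i) - psum m (fun j => s5 rY i j)| < a i.
  move=> iN; apply: psum_change1 => [||j j' jm jm' h h']; first exact: a_gt0.
    by move=> j jm; apply: near6.
  by apply: (src4 i) => //; apply: contrapT => ne; [move/eqP: h|move/eqP: h'];
    rewrite -/(y _ _) keep6.
have col5 j : (j < m)%N -> `|psum n (fun i => s5 rY i j) - psum n (fun i => s4 rY i j)| < b j.
  move=> jm; apply: psum_change1 => [||i i' iN iN' h h']; first exact: b_gt0.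
    by move=> i iN; apply: near5.
  by apply: (snk4 _ _ j) => //; apply: contrapT => ne; [move/eqP: h|move/eqP: h'];
    rewrite keep5 // Y4.
have col6 j : (j < m)%N -> psum n (fun i => s5 rY i j) - b j < psum n (y^~ j) <=
    psum n (fun i => s5 rY i j).
  move=> jm; have [_ _ h1 h2 _] := star6 j jm; rewrite /line_sum /= in h1 h2.
  rewrite h1 andbT ltrBlDr -ltrBlDl; apply: h2; first exact: b_gt0.
  by move=> i iN; rewrite MM5 //; case: (cp_le i j).
have rounded : rounded_flow x y.
  split.
  - move=> i j iN jm; have := SM4 i j iN jm; case: ifP => _ [].
    + exact: done6.
    + by move=> e; rewrite keep6 ?e //; apply: done5.
    + by move=> e; rewrite keep6 ?e // keep5 ?e.
  - move=> i iN; have := row5 i iN; have := row6 i iN; have := a_gt0 iN.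
    by move: (psum m _) (psum m _); clear; lia.
  - move=> j jm; have := col5 j jm; have := col6 j jm; have := b_gt0 jm; rewrite colK //.
    by move: (psum n _) (psum n _); clear; lia.
  apply: (@le_trans _ _ (psum n (fun i => psum m (fun j => cst i j * s5 rY i j)))).
    rewrite (exchange_psum _ _ (fun i j => cst i j * y i j)).
    rewrite (exchange_psum _ _ (fun i j => cst i j * s5 rY i j)).
    apply: le_psum => j jm; have [_ _ _ _] := star6 j jm; rewrite /line_cost /=.
    rewrite (@eq_psum n _ (fun i => cst i j * y i j)) => [|i iN]; last first.
      by rewrite fr6 // W5.
    by rewrite (@eq_psum n (fun i => s5 rW i j * _)
      (fun i => cst i j * s5 rY i j)) // => i iN; rewrite W5.
  rewrite -psumZ; apply: le_psum => i iN; rewrite -psumZ.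
  have [_ _ _ _] := star5 i iN; rewrite /line_cost /=.
  rewrite (@eq_psum m _ (fun j => cst i j * s5 rY i j)) => [|j jm]; last by rewrite W5.
  rewrite (@eq_psum m (fun j => s4 rW i j * _) (fun j => K * (cst i j * x i j))) // => j jm.
  by rewrite W4 // Y4 // mulrCA.
have [rnd1 rnd2 rnd3 rnd4] := rounded.
have y_ge0 i j : (i < n)%N -> (j < m)%N -> 0 <= y i j.
  move=> iN jm; have := rnd1 i j iN jm; case: ifP => _.
    by case=> ->; rewrite ?lexx // ltW // cp_gt0.
  by move=> ->; rewrite mulr_ge0 //; [move: K4; clear; lia|case/andP: (x_le i j iN jm)].
have A6 i : (i < n)%N -> s6 rA i 0 = a i.
  by move=> iN; rewrite fr6 // fr5 // fr4 // fr3 // fr2 // A1.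
have rowH i : (i < n)%N -> psum m (y i) <= (K + 2) * tot.
  move=> iN; have /andP[_ h] := rnd2 i iN; apply: le_trans h _.
  by rewrite ler_wpM2l ?a_le //; move: K4; clear; lia.
have [KH1 KH2] := Ktot_lt.
have dm6 : dims n m s6 by rewrite /dims !fr6.
apply: wp_conseq (write_outputP nmN NH (s := s6) dm6 _ _ _ _ _) _.
- by rewrite -/len lenE; clear; lia.
- by rewrite -/N; move: lenN; rewrite lenE /base; clear; lia.
- by move=> i j iN jm; apply: y_ge0.
- by move=> i iN; apply: le_lt_trans (rowH i iN) KH1.
- move=> i j iN jm; rewrite A6 // -/(y i j) ger0_norm ?mulr_ge0 ?y_ge0 ?ltW ?a_gt0 //.
  apply: le_lt_trans KH2; rewrite mulrC; apply: ler_pM => //;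
    rewrite ?y_ge0 ?a_le ?(ltW (a_gt0 iN)) //.
  apply: le_trans (rowH i iN); apply: (@psum_ge m j (y i)) => // k km; exact: y_ge0.
move=> s7 fr7 out; split; first by rewrite /dims !fr7.
exists x, y, u, v; split => // i j iN jm.
by have [h1 h2] := out i j iN jm; rewrite h1 h2 A6.
Qed.

End MainCorrect.

(** * The encoding of an instance *)

Lemma nth_flatten_blocks (T : eqType) (x0 : T) (c : nat) (ss : seq (seq T)) i r :
  (forall s, s \in ss -> size s = c) -> (i < size ss)%N -> (r < c)%N ->
  nth x0 (flatten ss) (i * c + r) = nth x0 (nth [::] ss i) r.
Proof.
elim: ss i => // s ss IH [|i] hc /= hi hr; rewrite nth_cat (hc s) ?mem_head //.
  by rewrite mul0n add0n hr.
rewrite ifN; last by rewrite -leqNgt mulSn -addnA leq_addr.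
rewrite mulSn -addnA addKn IH // => s' s's; apply: hc; rewrite in_cons s's.
by rewrite orbT.
Qed.

Lemma size_flatten_blocks (T : eqType) (c : nat) (ss : seq (seq T)) :
  (forall s, s \in ss -> size s = c) -> size (flatten ss) = (size ss * c)%N.
Proof.
elim: ss => // s ss IH hc /=; rewrite size_cat hc ?mem_head // IH //.
by move=> s' s's; apply: hc; rewrite in_cons s's orbT.
Qed.

Lemma nth_map_ord (T : Type) (x0 : T) n (g : 'I_n -> T) (i : 'I_n) :
  nth x0 [seq g k | k <- enum 'I_n] i = g i.
Proof.
by rewrite (nth_map i) ?size_enum_ord ?ltn_ord // nth_ord_enum.
Qed.

Section EncodeMatrix.
Variables (n m : nat) (A : 'M[rat]_(n, m)).

Let cell (i : 'I_n) (j : 'I_m) := [:: numq (A i j); denq (A i j)].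
Let rows := [seq [seq cell i j | j <- enum 'I_m] | i <- enum 'I_n].

Let rows_size r : r \in rows -> size r = m.
Proof. by case/mapP => i _ ->; rewrite size_map size_enum_ord. Qed.

Let cells_size c : c \in flatten rows -> size c = 2.
Proof. by case/flattenP => r /mapP[i _ ->] /mapP[j _ ->]. Qed.

Lemma size_enc_mx : size (enc_mx A) = (2 * (n * m))%N.
Proof.
rewrite (size_flatten_blocks cells_size) (size_flatten_blocks rows_size).
by rewrite size_map size_enum_ord mulnC.
Qed.

Lemma nth_enc_mx (i : 'I_n) (j : 'I_m) :
  (enc_mx A)`_(2 * (i * m + j)) = numq (A i j) /\
  (enc_mx A)`_(2 * (i * m + j)).+1 = denq (A i j).
Proof.
have cellE : nth [::] (flatten rows) (i * m + j) = cell i j.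
  have lt : (i < size rows)%N by rewrite size_map size_enum_ord.
  rewrite (nth_flatten_blocks [::] rows_size lt (ltn_ord j)).
  by rewrite /rows !nth_map_ord.
have lt : (i * m + j < size (flatten rows))%N.
  rewrite (size_flatten_blocks rows_size) size_map size_enum_ord.
  exact: edge_index (ltn_ord i) (ltn_ord j).
have := nth_flatten_blocks 0 cells_size lt (isT : 0 < 2)%N.
have := nth_flatten_blocks 0 cells_size lt (isT : 1 < 2)%N.
rewrite cellE addn0 addn1 mulnC /= => h1 h2.
by split; [exact: h2 | exact: h1].
Qed.

End EncodeMatrix.

Lemma ord_index n m k : (k < n * m)%N ->
  exists (i : 'I_n) (j : 'I_m), k = (i * m + j)%N.
Proof.
move=> kl; have m0 : (0 < m)%N by case: m kl => //; rewrite muln0.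
have ilt : (k %/ m < n)%N by rewrite ltn_divLR.
by exists (Ordinal ilt), (Ordinal (ltn_pmod k m0)); rewrite /= -divn_eq.
Qed.

Section EncodeInstance.
Variable I : fct.
Let n := nsrc I.
Let m := nsnk I.
Let w := enc_fct I.
Let base := (2 + n + m)%N.

Lemma size_enc : size w = (base + 4 * (n * m))%N.
Proof.
rewrite /w /enc_fct !size_cat 2!size_map 2!size_enum_ord !size_enc_mx.
rewrite [size [:: _; _]]/=; by rewrite /base -/n -/m; lia.
Qed.

Lemma nth_enc_supply (i : 'I_n) : w`_(2 + i) = supply i.
Proof.
by rewrite /w /enc_fct /= nth_cat size_map size_enum_ord ltn_ord nth_map_ord.
Qed.

Lemma nth_enc_demand (j : 'I_m) : w`_(2 + n + j) = demand j.
Proof.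
have h k : w`_(2 + k) = ([seq (supply i)%:Z | i <- enum 'I_n] ++
  [seq (demand j)%:Z | j <- enum 'I_m] ++
  enc_mx (fixed_cost I) ++ enc_mx (linear_cost I))`_k by [].
rewrite -addnA h nth_cat size_map size_enum_ord.
rewrite ltnNge leq_addr /= addKn nth_cat size_map size_enum_ord.
by rewrite ltn_ord nth_map_ord.
Qed.

Let nth_w k : w`_(base + k) = if (k < 2 * (n * m))%N then (enc_mx (fixed_cost I))`_k
  else (enc_mx (linear_cost I))`_(k - 2 * (n * m)).
Proof.
have -> : w = ([:: n%:Z; m%:Z] ++ [seq (supply i)%:Z | i <- enum 'I_n]
   ++ [seq (demand j)%:Z | j <- enum 'I_m])
   ++ (enc_mx (fixed_cost I) ++ enc_mx (linear_cost I)) by rewrite -!catA.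
have -> : base = size ([:: n%:Z; m%:Z] ++ [seq (supply i)%:Z | i <- enum 'I_n]
   ++ [seq (demand j)%:Z | j <- enum 'I_m]).
  by rewrite !size_cat 2!size_map 2!size_enum_ord /base addnA.
by rewrite nth_cat ltnNge leq_addr /= addKn nth_cat size_enc_mx.
Qed.

Lemma nth_enc_fixed (i : 'I_n) (j : 'I_m) :
  w`_(base + 2 * (i * m + j)) = numq (fixed_cost I i j) /\
  w`_(base + 2 * (i * m + j)).+1 = denq (fixed_cost I i j).
Proof.
have [h1 h2] := nth_enc_mx (fixed_cost I) i j.
have lt := edge_index (ltn_ord i) (ltn_ord j).
by rewrite -addnS !nth_w !ifT //; lia.
Qed.

Lemma nth_enc_linear (i : 'I_n) (j : 'I_m) :
  w`_(base + 2 * (i * m + j) + 2 * (n * m)) = numq (linear_cost I i j) /\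
  w`_(base + 2 * (i * m + j) + 2 * (n * m)).+1 = denq (linear_cost I i j).
Proof.
have [h1 h2] := nth_enc_mx (linear_cost I) i j.
rewrite -addnA -addnS [(_ + 2 * (n * m))%N]addnC -addnS !nth_w.
by rewrite !ltnNge !leq_addr /= !addKn.
Qed.

Lemma enc_ge0 k : (k < size w)%N -> 0 <= w`_k.
Proof.
move=> kl; suff: all (fun z : int => 0 <= z) w by move/all_nthP; apply.
rewrite /w /enc_fct !all_cat /=.
have mx (A : 'M[rat]_(n, m)) : (forall i j, 0 <= A i j) -> all (fun z : int => 0 <= z) (enc_mx A).
  move=> A0; apply/allP => z /flattenP[c /allpairsP[[i j] [_ _ ->]]].
  by rewrite !inE => /orP[]/eqP-> /=; rewrite ?numq_ge0.
rewrite !mx ?andbT; try by [apply: fixed_cost_ge0 | apply: linear_cost_ge0].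
by apply/andP; split; apply/allP => z /mapP[? _ ->].
Qed.

Lemma enc_node_gt0 k : (1 < k < base)%N -> 0 < w`_k.
Proof.
case/andP=> k1 kb; have [kn|kn] := ltnP (k - 2) n.
  have -> : k = (2 + Ordinal kn)%N by rewrite [nat_of_ord _]/=; lia.
  rewrite nth_enc_supply; exact: supply_gt0.
have km : (k - 2 - n < m)%N by move: kb; rewrite /base; lia.
have -> : k = (2 + n + Ordinal km)%N by rewrite [nat_of_ord _]/=; lia.
rewrite nth_enc_demand; exact: demand_gt0.
Qed.

Lemma enc_den_gt0 k : (base + (2 * k).+1 < size w)%N -> 0 < w`_(base + (2 * k).+1).
Proof.
rewrite size_enc => kl; have [kn|kn] := ltnP k (n * m).
  have [i [j ->]] := ord_index kn; have [_ h] := nth_enc_fixed i j.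
  by rewrite addnS h.
have kn' : (k - n * m < n * m)%N by lia.
have [i [j e]] := ord_index kn'; have [_ h] := nth_enc_linear i j.
rewrite (_ : (base + (2 * k).+1 = (base + 2 * (i * m + j) + 2 * (n * m)).+1)%N); last by lia.
by rewrite h.
Qed.

Lemma enc_total : psum n (fun i => w`_(2 + i)) = (\sum_(i < n) supply i)%N%:Z /\
  psum m (fun j => w`_(2 + n + j)) = (\sum_(i < n) supply i)%N%:Z.
Proof.
split; last rewrite balanced; rewrite /psum (big_morph Posz PoszD (erefl (Posz 0))).
  by apply: eq_bigr => i _; rewrite nth_enc_supply.
by apply: eq_bigr => j _; rewrite nth_enc_demand.
Qed.

End EncodeInstance.

(** * Comparison with the fractional optimum *)

Lemma intr_divz (F : numFieldType) (p d : int) : d != 0 -> (d %| p)%Z ->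
  ((p %/ d)%Z)%:~R = p%:~R / d%:~R :> F.
Proof.
move=> d0 /divzK e; have dF : d%:~R != 0 :> F by rewrite intr_eq0.
by rewrite -[in RHS]e intrM mulfK.
Qed.

Section RealCost.
Variables (R : realType) (I : fct) (lim : limits) (K : int).
Let n := nsrc I.
Let m := nsnk I.
Let f := nth 0 (enc_fct I).
Hypotheses (lenE : low_len lim = size (enc_fct I)) (K4 : 4 <= K).
Let S := pos_prod f (low_len lim).
Let cst := pert_cost lim n m f.
Let scale : R := (2 ^+ (n * m) * S)%:~R.
Implicit Types (i : 'I_n) (j : 'I_m) (X : 'M[R]_(n, m)).

Let base := (2 + n + m)%N.
Let sizeE : low_len lim = (base + 4 * (n * m))%N.
Proof. by rewrite lenE size_enc. Qed.

Let capR i j : R := (cap n f i j)%:~R.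
Let price i j : R := ratr (fixed_cost I i j) / capR i j + ratr (linear_cost I i j).

Lemma capRE i j : capR i j = Num.min (supply i)%:R (demand j)%:R.
Proof.
rewrite /capR /cap /f nth_enc_supply nth_enc_demand.
have [le|lt] := leqP (supply i) (demand j).
  by rewrite !min_l ?lez_nat ?ler_nat.
by rewrite !min_r ?lez_nat ?ler_nat 1?ltnW.
Qed.

Lemma capR_gt0 i j : 0 < capR i j.
Proof. by rewrite capRE lt_min !ltr0n supply_gt0 demand_gt0. Qed.

Lemma unit_costE i j : (unit_cost lim n m f i j)%:~R = S%:~R * price i j.
Proof.
have idx := edge_index (ltn_ord i) (ltn_ord j).
have [n1 d1] := nth_enc_fixed i j; have [n2 d2] := nth_enc_linear i j.
rewrite /unit_cost -/base -/S /f; set k := (base + _)%N.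
have ke : k = (base + 2 * (i * m + j))%N by [].
rewrite n1 d1 n2 d2 -/f intrD /price mulrDr; congr (_ + _).
  have c0 : 0 < cap n f i j by have := capR_gt0 i j; rewrite ltr0z.
  have dv : (denq (fixed_cost I i j) * cap n f i j %| S)%Z.
    have := d1; rewrite -/k -/f => <-.
    have fk : 0 < f k.+1 by rewrite /f d1 denq_gt0.
    rewrite /cap /Num.min; case: ifP => _; apply: pos_prod_dvd2 => //.
    - by rewrite sizeE ke; lia.
    - by rewrite sizeE; have := ltn_ord i; rewrite /base; lia.
    - by apply/eqP; rewrite ke /base; have := ltn_ord i; lia.
    - by rewrite /f nth_enc_supply ltz_nat supply_gt0.
    - by rewrite sizeE ke; lia.
    - by rewrite sizeE; have := ltn_ord j; rewrite /base; lia.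
    - by apply/eqP; rewrite ke /base; have := ltn_ord j; lia.
    - by rewrite /f nth_enc_demand ltz_nat demand_gt0.
  rewrite intr_divz ?dvdz_mulr ?mulf_neq0 ?denq_neq0 ?gt_eqF //.
  by rewrite !intrM /ratr /capR; field; rewrite !intr_eq0 denq_neq0 gt_eqF.
rewrite intr_divz ?denq_neq0 //; first by rewrite intrM mulrA.
apply: dvdz_mulr; have := d2; rewrite -ke -/f => <-.
by apply: pos_prod_dvd; rewrite ?sizeE ?ke /f ?d2 ?denq_gt0 //; lia.
Qed.

Lemma price_ge0 i j : 0 <= price i j.
Proof.
apply: addr_ge0; last by rewrite ler0q linear_cost_ge0.
by apply: divr_ge0; [rewrite ler0q fixed_cost_ge0 | apply/ltW/capR_gt0].
Qed.

Let S_gt0 : 0 < S%:~R :> R.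
Proof. by rewrite ltr0z; have := pos_prod_ge1 f (low_len lim); rewrite -/S; lia. Qed.

Let scale_gt0 : 0 < scale.
Proof. by rewrite /scale intrM mulr_gt0 // ltr0z exprn_gt0. Qed.

(** A positive [unit_cost] is an integer, so at least 1, and its multiple by [2 ^+ (n * m)]
    dominates the added power; hence the factor 2. *)
Lemma pert_cost_bounds i j :
  scale * price i j <= (cst i j)%:~R <= 2 * (scale * price i j).
Proof.
rewrite /scale intrM -mulrA -unit_costE -intrM.
rewrite -[X in _ <= X * _]/((2 : int)%:~R) -intrM !ler_int /cst /pert_cost -/base.
have uc0 : 0 <= unit_cost lim n m f i j.
  by rewrite -(ler0z R) unit_costE mulr_ge0 ?price_ge0 // ltW.
case: ifP => uc; last by rewrite (_ : unit_cost _ _ _ _ _ _ = 0) ?mulr0 //; lia.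
have le : 2 ^+ (i * m + j) <= 2 ^+ (n * m) :> int.
  by rewrite ler_eXn2l // ltnW // edge_index.
have := exprn_gt0 (i * m + j) (isT : 0 < 2 :> int).
move: (2 ^+ _) (2 ^+ _) le => p q; nia.
Qed.

Lemma feasible_le_cap X i j : feasible X -> X i j <= capR i j.
Proof.
case=> X0 Xr Xc; rewrite capRE le_min -Xr -Xc (bigD1 j) //= lerDl sumr_ge0 //=.
by rewrite (bigD1 i) //= lerDl sumr_ge0.
Qed.

(** Since [X i j] is at most the capacity, the linearized fixed cost of a used edge is at most its
    fixed cost. *)
Lemma price_le_cost X : feasible X -> \sum_i \sum_j price i j * X i j <= cost X.
Proof.
move=> feasX; have [X0 _ _] := feasX.
apply: ler_sum => i _; apply: ler_sum => j _; rewrite mulrDl lerD2r.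
case: ltP => [_|Xle]; last by rewrite (_ : X i j = 0) ?mulr0 //; apply/le_anti/andP.
rewrite -mulrA ler_piMr ?ler0q ?fixed_cost_ge0 // mulrC ler_pdivrMr ?capR_gt0 //.
by rewrite mul1r feasible_le_cap.
Qed.

Section Flow.
Variables (x y : nat -> nat -> int) (u v : nat -> int).
Hypotheses (opt_x : optimal_flow lim n m f x u v)
  (rnd_y : rounded_flow lim n m f K x y).

Let xR : 'M[R]_(n, m) := \matrix_(i, j) (x i j)%:~R.

Let psumR k (g : nat -> int) : (psum k g)%:~R = \sum_(i < k) (g i)%:~R :> R.
Proof. by rewrite /psum rmorph_sum. Qed.

Lemma optimal_flow_feasible : feasible xR.
Proof.
have [x0 _ xa xb] := opt_x; split=> [i j|i|j].
- by rewrite mxE ler0z; have [] := x0 i j (ltn_ord i) (ltn_ord j).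
- under eq_bigr do rewrite mxE.
  by rewrite -(psumR m (x i)) (etrans (xa i (ltn_ord i)) (nth_enc_supply i)).
- under eq_bigr do rewrite mxE.
  by rewrite -(psumR n (x^~ j)) (etrans (xb j (ltn_ord j)) (nth_enc_demand j)).
Qed.

Let potential_sum X : feasible X ->
  \sum_(i < n) \sum_(j < m) (u i + v j)%:~R * X i j =
  \sum_(i < n) (u i)%:~R * (supply i)%:R + \sum_(j < m) (v j)%:~R * (demand j)%:R.
Proof.
case=> _ Xr Xc.
under eq_bigr do under eq_bigr do rewrite intrD mulrDl.
under eq_bigr do rewrite big_split /= -mulr_sumr Xr.
rewrite big_split /=; congr (_ + _); rewrite exchange_big /=.
by apply: eq_bigr => j _; rewrite -mulr_sumr Xc.
Qed.

(** This is weak duality. The sum of [(u i + v j) * X i j] depends only on row and column sums, so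
    it is the same for all feasible flows; it is at most the cost of [X] and equals the cost of [xR]
    by tightness. *)
Lemma optimal_flow_le X : feasible X ->
  \sum_(i < n) \sum_(j < m) (cst i j)%:~R * xR i j <=
  \sum_(i < n) \sum_(j < m) (cst i j)%:~R * X i j.
Proof.
move=> feasX; have [x0 xt _ _] := opt_x; have [X0 _ _] := feasX.
have -> : \sum_(i < n) \sum_(j < m) (cst i j)%:~R * xR i j =
    \sum_(i < n) \sum_(j < m) (u i + v j)%:~R * xR i j.
  apply: eq_bigr => i _; apply: eq_bigr => j _; rewrite mxE.
  have [xp|xn] := ltP 0 (x i j); first by rewrite /cst -xt.
  by have [h _] := x0 i j (ltn_ord i) (ltn_ord j); rewrite (_ : x i j = 0) ?mulr0 //; lia.
rewrite (potential_sum optimal_flow_feasible) -(potential_sum feasX).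
apply: ler_sum => i _; apply: ler_sum => j _; rewrite ler_wpM2r // ler_int.
by have [] := x0 i j (ltn_ord i) (ltn_ord j).
Qed.

Let rowY i := psum m (y i).

Lemma rounded_row_bounds i :
  (K - 2) * (supply i)%:Z <= psum m (y i) <= (K + 2) * (supply i)%:Z.
Proof.
have [_ h _ _] := rnd_y; have := h i (ltn_ord i).
by rewrite {1 2}/f nth_enc_supply.
Qed.

Lemma rounded_row_gt0 i : 0 < psum m (y i).
Proof.
have /andP[h _] := rounded_row_bounds i; have := supply_gt0 i.
by move: (supply i) h => a h a0; nia.
Qed.

Lemma rounded_ge0 i j : 0 <= y i j.
Proof.
have [h _ _ _] := rnd_y; have := h i j (ltn_ord i) (ltn_ord j).
have [x0 _ _ _] := opt_x; have [xij _] := x0 i j (ltn_ord i) (ltn_ord j).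
have c0 : 0 < cap n f i j by rewrite -(ltr0z R) capR_gt0.
by case: ifP => _; [case=> ->; lia | move=> ->; apply: mulr_ge0; lia].
Qed.

Definition rescaled : 'M[rat]_(n, m) :=
  \matrix_(i, j) (((supply i)%:Z * y i j)%:~R / (psum m (y i))%:~R).

Let z : 'M[R]_(n, m) := map_mx ratr rescaled.

Let zE i j : z i j = (supply i)%:R * (y i j)%:~R / (rowY i)%:~R.
Proof.
by rewrite !mxE fmorph_div /= !ratr_int intrM -pmulrn.
Qed.

Let row_neq0 i : (rowY i)%:~R != 0 :> R.
Proof. by rewrite intr_eq0 gt_eqF // rounded_row_gt0. Qed.

Lemma rescaled_ge0 i j : 0 <= z i j.
Proof.
rewrite zE; apply: divr_ge0; last by rewrite ler0z ltW ?rounded_row_gt0.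
by apply: mulr_ge0; rewrite ?ler0n // ler0z rounded_ge0.
Qed.

Lemma rescaled_row i : \sum_j z i j = (supply i)%:R.
Proof.
under eq_bigr do rewrite zE.
by rewrite -mulr_suml -mulr_sumr -(psumR m (y i)) -/(rowY i) mulfK.
Qed.

(** Rescaling multiplies each entry by a factor between [1 / (K + 2)] and [1 / (K - 2)], and the
    column sum of [y] lies between [K - 2] and [K + 2] demands. The relative error is therefore at
    most [4 / (K - 2)]. *)
Lemma rescaled_column (eps : R) j : 4 <= eps * (K%:~R - 2) ->
  (1 - eps) * (demand j)%:R <= \sum_i z i j <= (1 + eps) * (demand j)%:R.
Proof.
move=> hK; have K4R : 4 <= K%:~R :> R by rewrite (ler_int R 4).
have two : (2 : int)%:~R = 2 :> R by [].
have [_ _ h _] := rnd_y; have {h} := h j (ltn_ord j).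
rewrite {1 2}/f nth_enc_demand => /andP[].
rewrite -!(ler_int R) (psumR n (y^~ j)).
rewrite !intrM intrB intrD two -!pmulrn => lo hi.
have b0 : 0 < (demand j)%:R :> R by rewrite ltr0n demand_gt0.
have bnd i : (y i j)%:~R / (K%:~R + 2) <= z i j <= (y i j)%:~R / (K%:~R - 2).
  have y0 : 0 <= (y i j)%:~R :> R by rewrite ler0z rounded_ge0.
  have Y0 : 0 < (rowY i)%:~R :> R by rewrite ltr0z rounded_row_gt0.
  have /andP[] := rounded_row_bounds i.
  rewrite -!(ler_int R) !intrM intrB intrD two -!pmulrn.
  move=> h1 h2; rewrite zE; set a := (supply i)%:R in h1 h2 *.
  rewrite ler_pdivlMr // mulrAC ler_pdivrMr; last lra.
  rewrite ler_pdivrMr // [X in _ && (_ <= X)]mulrAC ler_pdivlMr; last lra.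
  by apply/andP; split; nra.
have lo' : \sum_(i < n) (y i j)%:~R / (K%:~R + 2) <= \sum_i z i j.
  by apply: ler_sum => i _; have /andP[] := bnd i.
have hi' : \sum_i z i j <= \sum_(i < n) (y i j)%:~R / (K%:~R - 2).
  by apply: ler_sum => i _; have /andP[] := bnd i.
have eps0 : 0 <= eps by nra.
have hK2 : 4 <= eps * (K%:~R + 2) by lra.
apply/andP; split.
  apply: le_trans lo'; rewrite -mulr_suml ler_pdivlMr; last lra.
  by apply: le_trans lo; rewrite mulrAC ler_pM2r //; lra.
apply: le_trans hi' _; rewrite -mulr_suml ler_pdivrMr; last lra.
by apply: le_trans hi _; rewrite [leRHS]mulrAC ler_pM2r //; lra.
Qed.

(** The comparison is made edge by edge. Row sums of [y] are at least [(K - 2) * a >= a], so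
    [z <= y]; and where [y] reaches the capacity, the linearized fixed cost already pays the whole
    fixed cost. *)
Lemma rescaled_cost_le : cost z <= \sum_(i < n) \sum_(j < m) price i j * (y i j)%:~R.
Proof.
apply: ler_sum => i _; apply: ler_sum => j _.
have F0 : 0 <= ratr (fixed_cost I i j) :> R by rewrite ler0q fixed_cost_ge0.
have L0 : 0 <= ratr (linear_cost I i j) :> R by rewrite ler0q linear_cost_ge0.
have c0 := capR_gt0 i j.
have [y0|yn] := ltP 0 (y i j); last first.
  have e : y i j = 0 by apply/le_anti; rewrite yn rounded_ge0.
  by rewrite zE e mulr0 mul0r ltxx !mulr0 addr0.
have zy : z i j <= (y i j)%:~R.
  have /andP[h _] := rounded_row_bounds i; have a0 := supply_gt0 i.
  rewrite zE ler_pdivrMr ?ltr0z ?rounded_row_gt0 // mulrC.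
  rewrite ler_wpM2l ?ler0z ?rounded_ge0 // [_%:R]pmulrn ler_int.
  by apply: le_trans h; move: (supply i) a0 => a; nia.
have [cy|yc] := lerP (capR i j) (y i j)%:~R.
  rewrite mulrDl lerD ?ler_wpM2l //.
  apply: le_trans (_ : ratr (fixed_cost I i j) <= _); first by case: ifP.
  by rewrite -mulrA ler_peMr // mulrC ler_pdivlMr // mul1r.
(* What remains is a used edge below its capacity. It was not rounded, so it is not small, which is
   only possible if its perturbed cost is 0; then both of its costs vanish. *)
have [h _ _ _] := rnd_y; have := h i j (ltn_ord i) (ltn_ord j).
rewrite ltr_int in yc; case: ifP => small; first by case=> e; [move: y0 | move: yc]; rewrite e ltxx.
move=> e; have x0 : 0 < x i j by move: y0; rewrite e pmulr_rgt0 //; lia.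
have c : cst i j <= 0 by move: small; rewrite /small_edge x0 -e yc /= andbT -/cst; lia.
have p0 : price i j <= 0.
  have /andP[lo _] := pert_cost_bounds i j.
  rewrite -(pmulr_rle0 _ scale_gt0); apply: le_trans lo _.
  by rewrite lerz0.
have F0' : 0 <= ratr (fixed_cost I i j) / capR i j by rewrite divr_ge0 // ltW.
have L00 : ratr (linear_cost I i j) = 0 :> R by move: p0; rewrite /price; lra.
have F00 : ratr (fixed_cost I i j) = 0 :> R.
  have : ratr (fixed_cost I i j) / capR i j = 0 by move: p0; rewrite /price; lra.
  by move/eqP; rewrite mulf_eq0 invr_eq0 (gt_eqF c0) orbF => /eqP.
by rewrite /price F00 L00 !mul0r !addr0 mul0r; case: ifP.
Qed.

(** Up to [scale], the chain is: cost of [z], perturbed cost of [y], [K] times that of [xR], [K]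
    times that of any feasible [X], and finally [2 * K] times the cost of [X] because the
    perturbation at most doubles prices. *)
Lemma rescaled_cost_opt : cost z <= 2 * K%:~R * opt R I.
Proof.
have K0 : 0 < 2 * K%:~R :> R by rewrite mulr_gt0 // ltr0z; lia.
rewrite mulrC -ler_pdivrMr //; apply: lb_le_inf.
  (* The infimum is bounded below only over a nonempty set; the computed flow itself provides a
     feasible point. *)
  by exists (cost xR), xR => //; apply: optimal_flow_feasible.
move=> _ [X feasX <-]; rewrite ler_pdivrMr // -(ler_pM2l scale_gt0).
have [_ _ _ h] := rnd_y.
have {h} : \sum_(i < n) \sum_(j < m) (cst i j)%:~R * (y i j)%:~R <=
    K%:~R * \sum_(i < n) \sum_(j < m) (cst i j)%:~R * xR i j.
  move: h; rewrite -(ler_int R) intrM !psumR.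
  under eq_bigr do rewrite psumR; under [in X in _ <= X -> _]eq_bigr do rewrite psumR.
  under eq_bigr do under eq_bigr do rewrite intrM.
  under [in X in _ <= X -> _]eq_bigr do under eq_bigr do rewrite intrM.
  by under [in X in _ -> _ <= X]eq_bigr do under eq_bigr do rewrite mxE.
move=> h; apply: le_trans (_ : \sum_(i < n) \sum_(j < m) (cst i j)%:~R * (y i j)%:~R <= _).
  apply: le_trans (ler_wpM2l (ltW scale_gt0) rescaled_cost_le) _.
  rewrite mulr_sumr; apply: ler_sum => i _; rewrite mulr_sumr; apply: ler_sum => j _.
  rewrite mulrA ler_wpM2r ?ler0z ?rounded_ge0 //.
  by have /andP[] := pert_cost_bounds i j.
apply: le_trans h _.
have K0' : 0 <= K%:~R :> R by rewrite ler0z; lia.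
apply: le_trans (ler_wpM2l K0' (optimal_flow_le feasX)) _.
have [X0 _ _] := feasX.
have le : \sum_(i < n) \sum_(j < m) (cst i j)%:~R * X i j <= 2 * (scale * cost X).
  apply: le_trans (_ : 2 * (scale * \sum_(i < n) \sum_(j < m) price i j * X i j) <= _); last first.
    by rewrite !ler_wpM2l ?price_le_cost // ltW.
  rewrite !mulr_sumr; apply: ler_sum => i _; rewrite !mulr_sumr; apply: ler_sum => j _.
  by rewrite !mulrA ler_wpM2r // -mulrA; have /andP[] := pert_cost_bounds i j.
apply: le_trans (ler_wpM2l K0' le) _.
by rewrite le_eqVlt; apply/orP; left; apply/eqP; ring.
Qed.

End Flow.
End RealCost.

(** * Resources *)

Lemma size_bitsize s : (size s <= bitsize s)%N.
Proof.
by elim: s => // z s IH; rewrite /bitsize big_cons -/(bitsize s) /= -add1n leq_add.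
Qed.

Lemma bitlen_nth (s : seq int) k : (k < size s)%N -> (bitlen s`_k <= bitsize s)%N.
Proof.
elim: s k => // z s IH [|k] /= kl; rewrite /bitsize big_cons -/(bitsize s).
  exact: leq_addr.
exact: leq_trans (IH k kl) (leq_addl _ _).
Qed.

Lemma pos_prod_le f (b : int) k : 1 <= b ->
  (forall i, (i < k)%N -> f i <= b) -> pos_prod f k <= b ^+ k.
Proof.
move=> b1; elim: k => //= k IH hb; rewrite exprSr; apply: ler_pM.
- by have := pos_prod_ge1 f k; lia.
- by case: ifP => [/ltW|].
- by apply: IH => i ik; apply: hb; apply: leqW.
- by case: ifP => _; rewrite ?hb.
Qed.

Section Resources.
Variables (kn : nat) (I : fct).
Let w := enc_fct I.
Let n := nsrc I.
Let m := nsnk I.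
Let f := nth 0 w.
Let Z := bitsize w.

(** [2 * Z] scales suffice because the total supply is below [2 ^+ (2 * Z)], and the other loops are
    shorter than the word plus 3. In the word length the cubic term covers potentials, the quadratic
    one the common multiple, and [4 * Z + kn] the products of supplies with the scaled flow. *)
Definition size_limits : limits :=
  Limits (2 * Z + 3) (8 * Z ^ 3 + 2 * Z ^ 2 + 4 * Z + kn + 11) (size w).
Let lim := size_limits.

Let Lz : (size w <= Z)%N. Proof. exact: size_bitsize. Qed.
Let sizes : (2 + n + m + 4 * (n * m) <= Z)%N.
Proof. by rewrite -size_enc. Qed.

Let entry_lt k : (k < size w)%N -> f k < 2 ^+ Z.
Proof.
move=> kl; apply: le_lt_trans (ler_norm _) _; rewrite abs_lt_pow2 -bitlen_leP.
  exact: bitlen_nth.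
by apply: leq_trans Lz; apply: leq_ltn_trans kl.
Qed.

Lemma two_pow_le a b : (a <= b)%N -> 2 ^+ a <= 2 ^+ b :> int.
Proof. by move=> ab; rewrite ler_eXn2l. Qed.

Lemma two_pow_lt a b : (a < b)%N -> 2 ^+ a < 2 ^+ b :> int.
Proof. by move=> ab; rewrite ltr_eXn2l. Qed.

Lemma nat_lt_two_pow a : a%:Z < 2 ^+ a.
Proof.
by rewrite -[X in X < _]ger0_norm // abs_lt_pow2 ltn_expl.
Qed.

Lemma psum_le_const k g (b : int) : (forall i, (i < k)%N -> g i <= b) ->
  psum k g <= k%:Z * b.
Proof.
elim: k => [|k IH] hb; first by rewrite /psum big_ord0 mul0r.
rewrite psumS intS mulrDl mul1r addrC lerD ?hb //.
by apply: IH => i ik; apply: hb; apply: leqW.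
Qed.

Lemma total_lt : psum n (fun i => f (2 + i)) < 2 ^+ (2 * Z).
Proof.
apply: (@le_lt_trans _ _ (n%:Z * 2 ^+ Z)).
  by apply: psum_le_const => i iN; apply/ltW/entry_lt; rewrite size_enc; lia.
rewrite mul2n -addnn exprD ltr_pM2r ?exprn_gt0 //.
by apply: le_lt_trans (nat_lt_two_pow Z); rewrite lez_nat; apply: leq_trans sizes; lia.
Qed.

Lemma common_multiple_le : pos_prod f (size w) <= 2 ^+ (Z ^ 2).
Proof.
have one : 1 <= 2 ^+ Z :> int by apply: exprn_ege1.
apply: le_trans (pos_prod_le one (fun i il => ltW (entry_lt il))) _.
by rewrite -exprM two_pow_le // -mulnn leq_mul.
Qed.

Lemma iteration_limit : (max_iter lim)%:Z + 8 < 2 ^+ word_len lim.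
Proof.
apply: lt_le_trans (nat_lt_two_pow (2 * Z + 3 + 8)) _; rewrite two_pow_le //=.
by lia.
Qed.

Lemma flow_limit : (kn%:Z + 2) * 2 ^+ (2 * Z) * 2 ^+ (2 * Z) + 1 < 2 ^+ word_len lim.
Proof.
have k2 := nat_lt_two_pow (kn + 2); have t1 : 1 <= 2 ^+ (2 * Z) :> int by apply: exprn_ege1.
apply: (@lt_le_trans _ _ (2 ^+ (kn + 2) * 2 ^+ (2 * Z) * 2 ^+ (2 * Z) * 2)).
  by rewrite PoszD in k2; move: (2 ^+ (2 * Z)) (2 ^+ (kn + 2)) k2 t1 => t k; clear; nia.
by rewrite -!exprD -exprSr two_pow_le //=; lia.
Qed.

(** The exponent of 4 counts sinks per search, searches per phase and phases: [m], [n + m] and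
    [2 * Z], together at most [2 * Z ^ 3]. The other factor bounds the perturbed costs. *)
Lemma dual_limit : 4 ^+ (m * (n + m) * (2 * Z)) *
  (2 ^+ (n * m) * (2 * pos_prod f (size w) * pos_prod f (size w) + 1)) < 2 ^+ word_len lim.
Proof.
have S1 := pos_prod_ge1 f (size w).
have Sq : 2 * pos_prod f (size w) * pos_prod f (size w) + 1 <= 2 ^+ (2 * Z ^ 2 + 2).
  rewrite exprD mul2n -addnn exprD; have := common_multiple_le.
  by move: (pos_prod _ _) (2 ^+ (Z ^ 2)) S1 => S b; clear; nia.
have nm : (n * m <= Z)%N by apply: leq_trans sizes; lia.
have pw : (m * (n + m) * (2 * Z) <= 2 * Z ^ 3)%N.
  have h : (m * (n + m) <= Z * Z)%N by apply: leq_mul; apply: leq_trans sizes; lia.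
  by rewrite [(Z ^ 3)%N]expnSr -mulnn mulnCA leq_mul2l leq_mul.
apply: (@le_lt_trans _ _ (2 ^+ (4 * Z ^ 3) * (2 ^+ Z * 2 ^+ (2 * Z ^ 2 + 2)))).
  apply: ler_pM.
  - exact: exprn_ge0.
  - by apply: mulr_ge0; [exact: exprn_ge0 | nia].
  - rewrite (_ : 4 = 2 ^+ 2) // -exprM two_pow_le //.
    by move: (_ * _ * _)%N (Z ^ 3)%N pw => p q; clear; lia.
  - by apply: ler_pM => //; [exact: exprn_ge0 | nia | exact: two_pow_le].
rewrite -!exprD two_pow_lt //=; move: (Z ^ 3)%N (Z ^ 2)%N Z => p q r; clear; lia.
Qed.

Lemma limits_le : (max_iter lim + word_len lim <= (kn + 30) * Z ^ 3)%N.
Proof.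
have Z1 : (0 < Z)%N by apply: leq_trans sizes.
have z2 : (Z ^ 2 <= Z ^ 3)%N by rewrite leq_pexp2l.
have z1 : (Z <= Z ^ 3)%N by rewrite -[leqLHS]expn1 leq_pexp2l.
rewrite /=; move: (Z ^ 3)%N (Z ^ 2)%N Z Z1 z1 z2 => p q r; clear; nia.
Qed.

Lemma input_bounded : bounded_mem (word_len lim) (input_memory w).
Proof.
have ZB : (Z <= word_len lim)%N by rewrite /=; lia.
move=> k; apply: leq_trans ZB; case: k => [|k].
  rewrite bitlen_leP /=; last by apply: leq_trans sizes.
  by apply: leq_ltn_trans Lz _; rewrite ltn_expl.
rewrite /input_memory /=; have [kl|kl] := ltnP k (size w); first exact: bitlen_nth.
by rewrite nth_default // bitlen_leP ?expn_gt0 //; apply: leq_trans sizes.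
Qed.

End Resources.

(** * Assembly *)

Definition output_size : aexp := (ANum 2 * (V rn * V rm))%P.

Definition transport_regs K := maxn (regs (main_program K)) (exp_regs output_size).

(** The output length is stored by a plain machine command at the very end: until then register 0
    must keep the input length, from which compiled code computes all array addresses. *)
Definition transport_program K : cmd :=
  Seq (compile (transport_regs K) (main_program K))
      (Store (Const 0) (compile_exp (transport_regs K) output_size)).

Lemma ev_output_size s : ev s output_size = 2 * (s rn 0 0 * s rm 0 0).
Proof. by []. Qed.

Lemma low_ok_output_size len s : low_ok len s output_size.
Proof. by []. Qed.

Lemma bitsize_output (mu : memory) b : (forall k, bitlen (mu k.+1) <= b)%N ->
  (bitsize (output_word mu) <= `|mu 0| * b)%N.
Proof.
move=> bm; rewrite /bitsize /output_word big_map.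
have h l : forall a, (\sum_(k <- iota a l) bitlen (mu k.+1) <= l * b)%N.
  by elim: l => [|l IH] a /=; rewrite ?big_nil // big_cons mulSn leq_add.
exact: h.
Qed.

Lemma store_time b x mu e1 e2 : (0 < b)%N -> (b <= x)%N -> bounded_mem b mu ->
  (test_cost mu e1 + test_cost mu e2 <= time_bound (Store e1 e2) x)%N.
Proof.
by move=> b0 bx bm; rewrite [leqRHS]mulnDl leq_add //; apply: test_cost_weight bm.
Qed.

Section Run.
Variables (kn : nat) (I : fct).
Let w := enc_fct I.
Let n := nsrc I.
Let m := nsnk I.
Let f := nth 0 w.
Let lim := size_limits kn I.
Let K := kn%:Z.
Hypothesis kn4 : (4 <= kn)%N.

Let initial : store := fun r i j =>
  if (r == 0%N) && (j == 0) && (0 <= i) then f `|i|%N else 0.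

Lemma transport_run : exists (t : nat) (mu : memory) x y u v,
  [/\ exec (transport_program K) (input_memory w) t mu,
     (t <= time_bound (transport_program K) (max_iter lim + word_len lim))%N,
     (bitsize (output_word mu) <= (max_iter lim + word_len lim) ^ 2)%N,
     optimal_flow lim n m f x u v /\ rounded_flow lim n m f K x y
   & size (output_word mu) = (n * m).*2 /\
     forall i j, (i < n)%N -> (j < m)%N ->
       (output_word mu)`_(i * m + j).*2 = f (2 + i) * y i j /\
       (output_word mu)`_(i * m + j).*2.+1 = psum m (y i)].
Proof.
have lenE : low_len lim = (2 + n + m + 4 * (n * m))%N by exact: size_enc.
have lenN : (low_len lim + 3 <= max_iter lim)%N.
  have h : (low_len lim <= bitsize w)%N := size_bitsize w.
  by rewrite (_ : max_iter lim = (2 * bitsize w + 3)%N) //; lia.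
have [totA totB] := enc_total I.
have tot_lt : (\sum_(i < n) supply i)%N%:Z < 2 ^+ (2 * bitsize w) :> int.
  by rewrite -totA; apply: total_lt.
have TN : (2 * bitsize w <= max_iter lim)%N by apply: leq_addr.
have word : has_word lim f initial by [].
have zero (r : nat) i j : r != 0%N -> initial r i j = 0.
  by rewrite /initial => /negPf->.
have [ok_run [[sn sm] [x [y [u [v [opt_x rnd_y out]]]]]]] :=
  main_programP lenE lenN (iteration_limit kn I) erefl erefl (@enc_ge0 I)
    (@enc_node_gt0 I) (@enc_den_gt0 I) totA totB (kn4 : 4 <= K) tot_lt TN
    (flow_limit kn I) (dual_limit kn I) word zero.
set s' := run lim _ _ in sn sm out.
have regsM : (regs (main_program K) <= transport_regs K)%N by apply: leq_maxl.
(* All array cells lie beyond the input word, where the input memory is 0 by the default value of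
   [nth]. *)
have rep : represents_store (transport_regs K) lim initial (input_memory w).
  split; [exact: erefl | move=> k _; exact: erefl |] => r i j /andP[r0 _].
  rewrite [RHS](zero r i j (_ : r != 0%N)); last by rewrite -lt0n.
  apply: nth_default; rewrite (_ : size _ = (size w).+1); last exact: erefl.
  have -> : addr (transport_regs K) lim r i j =
      (low_len lim)%:Z + r%:Z + (transport_regs K)%:Z * pair_code i j by case: (r) r0.
  have p0 : 0 <= (transport_regs K)%:Z * pair_code i j by rewrite mulr_ge0 ?pair_code_ge0.
  have -> : low_len lim = size w by [].
  move: (_ * pair_code _ _) p0 (size w) r0 => p p0 l r0; clear -p0 r0; lia.
have b0 : (0 < word_len lim)%N by rewrite /=; lia.
have [t [mu [ex rep' bm tle]]] := simulation b0 regsM rep (input_bounded kn I) ok_run.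
rewrite -/s' in rep'.
have countE : eval mu (compile_exp (transport_regs K) output_size) = (2 * (n * m))%N.
  rewrite (eval_compile rep' (leq_maxr _ _) (low_ok_output_size _ _)).
  by rewrite ev_output_size sn sm -!PoszM.
have [_ low_mu _] := rep'.
set out_cell := compile_exp _ _ in countE.
exists (t + (test_cost mu (Const 0) + test_cost mu out_cell))%N.
exists (update mu 0 (2 * (n * m))%N), x, y, u, v.
have sizeN : (2 * (n * m) <= low_len lim)%N by rewrite lenE; lia.
have out_size : size (output_word (update mu 0 (2 * (n * m))%N)) = (2 * (n * m))%N.
  by rewrite size_mkseq.
have outE k : (k < 2 * (n * m))%N ->
    (output_word (update mu 0 (2 * (n * m))%N))`_k = s' 0%N k 0.
  move=> kl; rewrite nth_mkseq; last exact: kl.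
  rewrite /update [_ == _]/=; apply: low_mu; apply: leq_trans kl sizeN.
split; last 2 first.
- exact: conj opt_x rnd_y.
- split; first by rewrite out_size mul2n.
  move=> i j iN jm; have lt := edge_index iN jm.
  rewrite -!mul2n !outE; try lia.
  exact: out.
- apply: exec_seq ex _; rewrite -countE; exact: exec_store.
- exact: leq_add tle (store_time _ _ b0 (leq_addl _ _) bm).
- apply: leq_trans (bitsize_output (b := word_len lim) _) _ => [k|]; first exact: bm.
  rewrite -mulnn; apply: leq_mul; last exact: leq_addl.
  have h : (2 * (n * m) <= max_iter lim)%N.
    by apply: leq_trans sizeN (leq_trans _ lenN); apply: leq_addr.
  exact: leq_trans h (leq_addr _ _).
Qed.

End Run.

Theorem theorem1p9 (R : realType) :
  exists2 C : R, 0 < C &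
  forall eps : R, 0 < eps ->
  polytime_solvable enc_fct (fun (I : fct) (out : seq int) =>
    exists x : 'M[rat]_(nsrc I, nsnk I),
      let xR : 'M[R]_(nsrc I, nsnk I) := map_mx ratr x in
      [/\ represents out x,
          approx_feasible eps xR
        & cost xR <= C * Num.max 1 eps^-1 * opt R I]).
Proof.
exists 16 => // eps eps0.
(* The column estimate needs [K - 2 >= 4 / eps], and the rounding needs [K >= 4]. Then [2 * K] is at
   most [8 + 8 / eps], whence the constant 16; the maximum with 1 is there for large [eps]. *)
pose kn := (4 + Num.truncn (4 / eps))%N.
have kn4 : (4 <= kn)%N by apply: leq_addr.
have kn4' : 4 <= kn%:Z by [].
have e0 : 0 <= 4 / eps by rewrite divr_ge0 // ltW.
have /andP[tr_le tr_gt] := truncn_itv e0.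
have knE : (kn%:Z)%:~R = 4 + (Num.truncn (4 / eps))%:R :> R by rewrite -natrD.
have hK : 4 <= eps * ((kn%:Z)%:~R - 2).
  rewrite knE mulrC -ler_pdivrMr // -[X in _ <= X]addrA.
  by move: tr_gt; rewrite -natr1; lra.
have hC : 2 * (kn%:Z)%:~R <= 16 * Num.max 1 eps^-1.
  have m1 : 1 <= Num.max 1 eps^-1 by rewrite le_max lexx.
  have m2 : eps^-1 <= Num.max 1 eps^-1 by rewrite le_max lexx orbT.
  by rewrite knE; lra.
have [c [d poly]] := time_bound_poly (transport_program kn%:Z).
(* [eps] enters only through the program constant [kn]. The limits are at most [(kn + 30) * Z ^ 3]
   in the input length [Z]: running time has degree [3 * d], and the output length is bounded by the
   square of the limits, of degree 6. *)
exists (transport_program kn%:Z), (c * (kn + 30) ^ d + (kn + 30) ^ 2)%N, (3 * d + 6)%N => I.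
have [t [mu [x [y [u [v [ex tle ole [opt_x rnd_y] [out_size out]]]]]]]] := transport_run I kn4.
exists t, mu; split => //.
  have X0 : (0 < max_iter (size_limits kn I) + word_len (size_limits kn I))%N.
    by rewrite addn_gt0 addn_gt0 orbT.
  have Xle := limits_le kn I.
  have Z1 : (0 < bitsize (enc_fct I))%N by apply: leq_trans (size_bitsize _).
  apply: leq_trans (leq_addr _ _).
  apply: leq_trans (leq_add (leq_trans tle (poly _ X0)) ole) _.
  have pow_le e : ((max_iter (size_limits kn I) + word_len (size_limits kn I)) ^ e <=
      (kn + 30) ^ e * bitsize (enc_fct I) ^ (3 * e))%N.
    by rewrite expnM -expnMn; case: e => // e; rewrite leq_exp2r.
  rewrite [leqRHS]mulnDl; apply: leq_add.
    rewrite -mulnA leq_mul //; apply: leq_trans (pow_le d) _.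
    by rewrite leq_mul // leq_pexp2l // leq_addr.
  by apply: leq_trans (pow_le 2) _; rewrite leq_mul // leq_pexp2l // leq_addl.
have lenE : low_len (size_limits kn I) = size (enc_fct I) by [].
have cost_le := rescaled_cost_opt R lenE kn4' opt_x rnd_y.
(* Replacing [2 * K] by the larger constant requires [0 <= opt R I], which follows since a
   nonnegative cost is at most a positive multiple of it. *)
have cost0 : 0 <= cost (map_mx ratr (rescaled I y) : 'M[R]_(nsrc I, nsnk I)).
  apply: sumr_ge0 => i _; apply: sumr_ge0 => j _; apply: addr_ge0.
    by case: ifP => // _; rewrite ler0q fixed_cost_ge0.
  by rewrite mulr_ge0 ?ler0q ?linear_cost_ge0 // (rescaled_ge0 R lenE kn4' opt_x rnd_y).
exists (rescaled I y); split.
- split; first exact: out_size.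
  move=> i j /=; have [h1 h2] := out i j (ltn_ord i) (ltn_ord j).
  rewrite h1 h2; split; first exact: (rounded_row_gt0 R lenE kn4' rnd_y i).
  by rewrite mxE nth_enc_supply.
- split=> [i j|i|j].
  + exact: (rescaled_ge0 _ lenE kn4' opt_x rnd_y i j).
  + exact: (rescaled_row _ lenE kn4' rnd_y i).
  + exact: (rescaled_column lenE kn4' opt_x rnd_y j hK).
have K0 : 0 < 2 * (kn%:Z)%:~R :> R.
  by apply: mulr_gt0 => //; rewrite ltr0z ltz_nat (leq_trans _ kn4).
apply: (le_trans cost_le); apply: ler_wpM2r hC.
by rewrite -(pmulr_rge0 _ K0); apply: le_trans cost0 cost_le.
Qed.
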